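(* Let $(A,\phi_0)$ be a Jacobi algebroid of rank $n$ over a manifold $M$, with anchor $\rho$, and let $Q_A=\wedge^nA\otimes\wedge^{\mathrm{top}}T^*M$. The bilinear map $D^{\phi_0}:\Gamma(A)\times\Gamma(Q_A)\to\Gamma(Q_A)$ defined by $$D^{\phi_0}_X(\eta\otimes\mu)=[X,\eta]^{\phi_0}\otimes\mu+\eta\otimes\mathcal L_{\rho(X)}\mu$$ is a representation of the Lie algebroid $A$ on the line bundle $Q_A$.
   Context: A Jacobi algebroid $(A,\phi_0)$ is a Lie algebroid $(A,[\cdot,\cdot],\rho)$ over $M$ with a 1-cocycle $\phi_0\in\Gamma(A^* )$ ($\mathrm d\phi_0=0$ for the Lie algebroid differential). The Schouten bracket on $\Gamma(\wedge^\bullet A)$ extends the Lie bracket with $[X,f]=\rho(X)f$, $[P,Q]=-(-1)^{(p-1)(q-1)}[Q,P]$, $[P,Q\wedge R]=[P,Q]\wedge R+(-1)^{(p-1)q}Q\wedge[P,R]$. The Schouten-Jacobi bracket is $[P,Q]^{\phi_0}=[P,Q]+(p-1)P\wedge i_{\phi_0}Q-(-1)^{p-1}(q-1)\,i_{\phi_0}P\wedge Q$ for $P\in\Gamma(\wedge^pA)$, $Q\in\Gamma(\wedge^qA)$. A representation of a Lie algebroid $A$ on a vector bundle $E\to M$ is an $\mathbb R$-bilinear map $D:\Gamma(A)\times\Gamma(E)\to\Gamma(E)$ with $D_{fX}s=fD_Xs$, $D_X(fs)=fD_Xs+(\rho(X)f)s$ and $D_XD_Ys-D_YD_Xs=D_{[X,Y]}s$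 for $f\in C^\infty(M)$, $X,Y\in\Gamma(A)$, $s\in\Gamma(E)$. *)

(* Defs.v *)
From HB Require Import structures.
From mathcomp Require Import all_boot all_order all_algebra.
From mathcomp Require Import boolp classical_sets functions cardinality reals.
From mathcomp Require Import topology normedtype derive.
From mathcomp Require Import ring.

Set Implicit Arguments.
Unset Strict Implicit.
Unset Printing Implicit Defensive.

Import Order.TTheory GRing.Theory Num.Theory numFieldNormedType.Exports.
Local Open Scope classical_set_scope.
Local Open Scope ring_scope.

Section SmoothEuclidean.
Variables (R : realType) (m : nat).
Implicit Types (U : set 'rV[R]_m) (f g : 'rV[R]_m -> R).

(* f has continuous iterated partial derivatives of all orders up to k at the
   points of U; used for U open. *)
Fixpoint Ck (k : nat) U f : Prop :=
  (forall y, U y -> {for y, continuous f}) /\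
  (if k is k'.+1 then
     forall i : 'I_m, (forall y, U y -> derivable f y (delta_mx 0 i)) /\
                      Ck k' U (fun y => 'D_(delta_mx 0 i) f y)
   else True).

Definition smooth_on U f : Prop := forall k, Ck k U f.

Lemma near_eq_continuous f g (y : 'rV[R]_m) : (\near y, f y = g y) ->
  {for y, continuous f} -> {for y, continuous g}.
Proof.
move=> fg; rewrite /prop_for /continuous_at -(nbhs_singleton fg) => cf.
by move=> P /cf; apply: filterS2 fg => z /= <-.
Qed.

Lemma Ck_ext k U f g : open U -> (forall y, U y -> f y = g y) ->
  Ck k U f -> Ck k U g.
Proof.
move=> oU; elim: k f g => [|k IH] f g fg [cf df].
all: have nfg y : U y -> \near y, f y = g y
  by move=> Uy; apply: filterS (open_nbhs_nbhs (conj oU Uy)).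
all: split; first by move=> y Uy; exact: near_eq_continuous (nfg y Uy) (cf y Uy).
  by [].
move=> i; have [d1 d2] := df i; split.
  by move=> y Uy; apply: near_eq_derivable (d1 y Uy); exact: nfg.
by apply: IH d2 => y Uy; apply: near_eq_derive; exact: nfg.
Qed.

Lemma Ck_S k U f : Ck k.+1 U f -> Ck k U f.
Proof.
elim: k f => [|k IH] f; first by move=> [? _].
move=> [cf df]; split=> // i; have [d1 d2] := df i; split=> //; exact: IH.
Qed.

Lemma Ck_cst k U c : Ck k U (fun=> c).
Proof.
elim: k c => [|k IH] c; first by split=> // y _; exact: cst_continuous.
split; first by move=> y _; exact: cst_continuous.
move=> i; split; first by move=> y _; exact: derivable_cst.
have -> : (fun y => 'D_(delta_mx 0 i) (fun=> c) y) = (fun=> 0) :> ('rV[R]_m -> R).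
  by apply/funext => y; exact: derive_cst.
exact: IH.
Qed.

Lemma CkD k U f g : open U -> Ck k U f -> Ck k U g -> Ck k U (fun y => f y + g y).
Proof.
move=> oU; elim: k f g => [|k IH] f g [cf df] [cg dg].
  by split=> // y Uy; apply: continuousD; [exact: cf|exact: cg].
split; first by move=> y Uy; apply: continuousD; [exact: cf|exact: cg].
move=> i; have [f1 f2] := df i; have [g1 g2] := dg i; split.
  by move=> y Uy; apply: derivableD; [exact: f1|exact: g1].
apply: (Ck_ext oU _ (IH _ _ f2 g2)) => y Uy.
by rewrite (deriveD (f1 y Uy) (g1 y Uy)).
Qed.

Lemma CkM k U f g : open U -> Ck k U f -> Ck k U g -> Ck k U (fun y => f y * g y).
Proof.
move=> oU; elim: k f g => [|k IH] f g Hf Hg; have [cf df] := Hf; have [cg dg] := Hg.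
  by split=> // y Uy; apply: continuousM; [exact: cf|exact: cg].
split; first by move=> y Uy; apply: continuousM; [exact: cf|exact: cg].
move=> i; have [f1 f2] := df i; have [g1 g2] := dg i; split.
  by move=> y Uy; apply: derivableM; [exact: f1|exact: g1].
apply: (Ck_ext oU _ (CkD oU (IH _ _ (Ck_S Hf) g2) (IH _ _ (Ck_S Hg) f2))) => y Uy.
by rewrite (deriveM (f1 y Uy) (g1 y Uy)).
Qed.

End SmoothEuclidean.

(* An atlas of charts [mchart i : mdom i -> R^m]; all maps are total, and only
   their restrictions to the open sets [mdom i] and [mchart i @` mdom i] matter.*)
Record manifold (R : realType) (m : nat) := Manifold {
  mspace :> topologicalType;
  mindex : Type;
  mdom : mindex -> set mspace;
  mchart : mindex -> mspace -> 'rV[R]_m;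
  mchartV : mindex -> 'rV[R]_m -> mspace;
  _ : hausdorff_space mspace;
  _ : @second_countable mspace;
  mdom_open : forall i, open (mdom i);
  mdom_cover : forall x, exists i, mdom i x;
  mimg_open : forall i, open (mchart i @` mdom i);
  mchartK : forall i x, mdom i x -> mchartV i (mchart i x) = x;
  mchart_continuous : forall i x, mdom i x -> {for x, continuous (mchart i)};
  mchartV_continuous : forall i x, mdom i x ->
    {for mchart i x, continuous (mchartV i)};
  mchart_smooth : forall i j (k : 'I_m),
    smooth_on (mchart i @` (mdom i `&` mdom j))
              (fun y => mchart j (mchartV i y) 0 k) }.

Section SmoothManifold.
Variables (R : realType) (m : nat) (M : manifold R m).
Implicit Types (U : set M) (f g : M -> R).

Definition msmooth_on U f : Prop :=
  forall i, smooth_on (mchart i @` (mdom i `&` U)) (f \o mchartV i).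

Lemma open_mchart (i : mindex M) U : open U -> open (mchart i @` (mdom i `&` U)).
Proof.
move=> oU; rewrite openE => _ [x [ix Ux] <-].
have oI : nbhs (mchart i x) (mchart i @` mdom i).
  by apply: open_nbhs_nbhs; split; [exact: mimg_open|exists x].
have cV := mchartV_continuous ix.
have oV : nbhs (mchart i x) (mchartV i @^-1` U).
  by apply: cV; rewrite mchartK //; exact: open_nbhs_nbhs.
apply: filterS (filterI oI oV) => _ [[z iz <-]] /=; rewrite mchartK // => Uz.
by exists z.
Qed.

Lemma msmooth_onD U f g : open U -> msmooth_on U f -> msmooth_on U g ->
  msmooth_on U (fun x => f x + g x).
Proof. by move=> oU F G i k; have := CkD (open_mchart (i := i) oU) (F i k) (G i k). Qed.

Lemma msmooth_onM U f g : open U -> msmooth_on U f -> msmooth_on U g ->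
  msmooth_on U (fun x => f x * g x).
Proof. by move=> oU F G i k; have := CkM (open_mchart (i := i) oU) (F i k) (G i k). Qed.

Lemma msmooth_on_cst U c : msmooth_on U (fun=> c).
Proof. by move=> i k; exact: Ck_cst. Qed.

Lemma msmooth_on_sub U V f : V `<=` U -> msmooth_on U f -> msmooth_on V f.
Proof.
move=> VU sf i k; move: (sf i k); set h := f \o _; move: h.
elim: k => [|k IH] h [ch dh]; (split; first by
  move=> _ [x [ix Vx] <-]; apply: ch; exists x => //; split=> //; exact: VU) => //.
move=> j; have [d1 d2] := dh j; split; last exact: IH.
by move=> _ [x [ix Vx] <-]; apply: d1; exists x => //; split=> //; exact: VU.
Qed.

Definition msmooth f : Prop := msmooth_on setT f.

Definition smooth_pred : {pred M -> R} := fun f => `[< msmooth f >].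

Lemma smooth_subring : subring_closed smooth_pred.
Proof.
split.
- by apply/asboolP; exact: msmooth_on_cst.
- move=> f g /asboolP Hf /asboolP Hg; apply/asboolP.
  have HN : msmooth (fun x => -1 * g x).
    by apply: msmooth_onM => //; [exact: openT|exact: msmooth_on_cst].
  have -> : f - g = (fun x => f x + -1 * g x).
    by apply/funext => x; rewrite mulN1r.
  by apply: msmooth_onD => //; exact: openT.
- by move=> f g /asboolP Hf /asboolP Hg; apply/asboolP/msmooth_onM => //; exact: openT.
Qed.

HB.instance Definition _ := GRing.isSubringClosed.Build (M -> R) smooth_pred
  smooth_subring.

Record Cinf := MkCinf { cfun :> M -> R; _ : cfun \in smooth_pred }.

HB.instance Definition _ := [isSub for cfun].
HB.instance Definition _ := [Choice of Cinf by <:].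
HB.instance Definition _ := GRing.SubChoice_isSubComPzRing.Build 
  (M -> R) smooth_pred Cinf (subringClosedP _).

Lemma CinfP (f : Cinf) : msmooth f.
Proof. by case: f => f H; exact: asboolW H. Qed.

Definition mkCinf f (sf : msmooth f) : Cinf := MkCinf (introT (asboolP _) sf).

Definition constC (c : R) : Cinf := mkCinf (@msmooth_on_cst setT c).

End SmoothManifold.

Section LinearAlgebra.
Variable K : comPzRingType.

Section Dual.
Variable V : lmodType K.

Definition dual_pred : {pred V -> K^o} :=
  fun f => `[< forall a u v, f (a *: u + v) = a * f u + f v >].

Lemma dual_submod : submod_closed dual_pred.
Proof.
split; first by apply/asboolP => a u v; rewrite mulr0 addr0.
move=> c f g /asboolP Hf /asboolP Hg; apply/asboolP => a u v.
have cE (x : K^o) : c *: x = c * x by [].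
by rewrite !fctE Hf Hg !cE !mulrDr addrACA mulrCA.
Qed.

Record dual := MkDual { dualfun :> V -> K^o; _ : dualfun \in dual_pred }.
HB.instance Definition _ := [isSub for dualfun].
HB.instance Definition _ := [Choice of dual by <:].
HB.instance Definition _ :=
  GRing.SubChoice_isSubLmodule.Build K (V -> K^o) dual_pred dual dual_submod.
End Dual.

Section Alternating.
Variable V : lmodType K.
Implicit Types (f : seq V -> K) (s t r : seq V) (u v : V).

Definition multilinear f : Prop := forall s t a u v,
  f (s ++ (a *: u + v) :: t) = a * f (s ++ u :: t) + f (s ++ v :: t).

Definition alternating f : Prop := forall s t r v,
  f (s ++ v :: t ++ v :: r) = 0.

Definition alt_pred : {pred seq V -> K^o} :=
  fun f => `[< multilinear f /\ alternating f >].

Lemma alt_comb c f g : multilinear f /\ alternating f ->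
  multilinear g /\ alternating g ->
  multilinear (fun s => c * f s + g s) /\ alternating (fun s => c * f s + g s).
Proof.
move=> [f1 f2] [g1 g2]; split=> [s t a u v|s t r v].
  by rewrite f1 g1 !mulrDr addrACA mulrCA.
by rewrite f2 g2 mulr0 addr0.
Qed.

Lemma alt_submod : submod_closed alt_pred.
Proof.
split; first by apply/asboolP; split=> // s t a u v; rewrite mulr0 addr0.
move=> c f g /asboolP Hf /asboolP Hg; apply/asboolP; exact: alt_comb.
Qed.

(* An element of [altmap V] is an alternating multilinear map in each number of
   arguments, i.e. one form of each degree; when V is finite-dimensional this is
   the whole exterior algebra of the dual of V. *)
Record altmap := MkAlt { altfun :> seq V -> K^o; _ : altfun \in alt_pred }.
HB.instance Definition _ := [isSub for altfun].
HB.instance Definition _ := [Choice of altmap by <:].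
HB.instance Definition _ :=
  GRing.SubChoice_isSubLmodule.Build K (seq V -> K^o) alt_pred altmap alt_submod.

Lemma altmapP (P : altmap) : multilinear P /\ alternating P.
Proof. by case: P => P H; exact: asboolW H. Qed.

Definition mkAlt f (Hf : multilinear f) (Af : alternating f) : altmap :=
  MkAlt (introT (asboolP _) (conj Hf Af)).

(* Recursion on the arguments through
     i_v (P /\ Q) = i_v P /\ Q + (-1)^deg(P) P /\ i_v Q,
   i.e. the signed sum over shuffles:
   (P /\ Q)(u, v) = P(u) Q(v) - P(v) Q(u) for P and Q of degree 1. *)
Fixpoint wedge_fun (P Q : seq V -> K) s : K :=
  if s is v :: s' then
    wedge_fun (fun t => P (v :: t)) Q s' +
    wedge_fun (fun t => (-1) ^+ size t * P t) (fun t => Q (v :: t)) s'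
  else P [::] * Q [::].

Lemma wedge_funDl a P P' Q s :
  wedge_fun (fun t => a * P t + P' t) Q s =
  a * wedge_fun P Q s + wedge_fun P' Q s.
Proof.
elim: s P P' Q => [|v s IH] P P' Q /=; first by rewrite mulrDl mulrA.
rewrite IH mulrDr addrACA; congr (_ + _); rewrite -IH; congr wedge_fun.
by apply/funext => t; rewrite mulrDr mulrCA.
Qed.

Lemma wedge_funDr a P Q Q' s :
  wedge_fun P (fun t => a * Q t + Q' t) s =
  a * wedge_fun P Q s + wedge_fun P Q' s.
Proof.
elim: s P Q Q' => [|v s IH] P Q Q' /=; first by rewrite mulrDr mulrCA.
by rewrite !IH mulrDr addrACA.
Qed.

Lemma wedge_fun0l Q s : wedge_fun (fun=> 0) Q s = 0.
Proof.
elim: s Q => [|v s IH] Q /=; first by rewrite mul0r.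
rewrite IH add0r -[RHS](IH (fun t => Q (v :: t))); congr wedge_fun.
by apply/funext => t; rewrite mulr0.
Qed.

Lemma wedge_fun0r P s : wedge_fun P (fun=> 0) s = 0.
Proof. by elim: s P => [|v s IH] P /=; rewrite ?mulr0// !IH addr0. Qed.

Lemma wedge_funNl P Q s : wedge_fun (fun t => - P t) Q s = - wedge_fun P Q s.
Proof.
have := wedge_funDl (-1) P (fun=> 0) Q s; rewrite wedge_fun0l addr0 mulN1r => <-.
by congr wedge_fun; apply/funext => t; rewrite mulN1r addr0.
Qed.

Lemma multilinear_cons f v : multilinear f -> multilinear (fun t => f (v :: t)).
Proof. by move=> Hf s t a u w; rewrite -!cat_cons Hf. Qed.

Lemma multilinear_sign f : multilinear f ->
  multilinear (fun t => (-1) ^+ size t * f t).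
Proof.
move=> Hf s t a u w; rewrite Hf !size_cat /= mulrDr; congr (_ + _).
by rewrite mulrCA.
Qed.

Lemma wedge_multilinear P Q : multilinear P -> multilinear Q ->
  multilinear (wedge_fun P Q).
Proof.
move=> HP HQ s; elim: s P Q HP HQ => [|w s IH] P Q HP HQ t a u v /=.
  have -> : (fun r => P (a *: u + v :: r)) =
            (fun r => a * P (u :: r) + P (v :: r)).
    by apply/funext => r; exact: (HP [::]).
  have -> : (fun r => Q (a *: u + v :: r)) =
            (fun r => a * Q (u :: r) + Q (v :: r)).
    by apply/funext => r; exact: (HQ [::]).
  by rewrite wedge_funDl wedge_funDr mulrDr addrACA.
rewrite (IH _ _ (multilinear_cons w HP) HQ).
rewrite (IH _ _ (multilinear_sign HP) (multilinear_cons w HQ)).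
by rewrite mulrDr addrACA.
Qed.

Lemma alternating_adjacent f : multilinear f ->
  (forall s r v, f (s ++ v :: v :: r) = 0) -> alternating f.
Proof.
move=> Hf Af s t; elim: t s => [|w t IH] s r v /=; first exact: Af.
have swap z : f (s ++ v :: w :: z) = - f (s ++ w :: v :: z).
  apply/eqP; rewrite -addr_eq0; apply/eqP.
  have := Af s z (v + w); have /= E1 := Hf s (v + w :: z) 1 v w.
  have E2 := Hf (rcons s v) z 1 v w; have E3 := Hf (rcons s w) z 1 v w.
  rewrite !scale1r !mul1r !cat_rcons in E1 E2 E3.
  by rewrite E1 E2 E3 !Af add0r addr0.
by rewrite swap -cat_rcons IH oppr0.
Qed.

Lemma wedge_alternating P Q : multilinear P -> multilinear Q ->
  alternating P -> alternating Q -> alternating (wedge_fun P Q).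
Proof.
move=> HP HQ AP AQ; apply: alternating_adjacent; first exact: wedge_multilinear.
have {}AP s r v : P (s ++ v :: v :: r) = 0 by exact: (AP s [::]).
have {}AQ s r v : Q (s ++ v :: v :: r) = 0 by exact: (AQ s [::]).
move=> s r v; elim: s P Q AP AQ {HP HQ} => [|w s IH] P Q AP AQ /=.
  have -> : (fun t => P [:: v, v & t]) = (fun=> 0).
    by apply/funext => t; exact: (AP [::]).
  have -> : (fun t => Q [:: v, v & t]) = (fun=> 0).
    by apply/funext => t; exact: (AQ [::]).
  rewrite wedge_fun0l wedge_fun0r add0r addr0.
  apply/eqP; rewrite addr_eq0 -wedge_funNl; apply/eqP; congr wedge_fun.
  by apply/funext => t; rewrite exprS mulN1r mulNr opprK.
rewrite !IH ?addr0 // => s' r' v'; rewrite -?cat_cons ?AP ?AQ //.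
by rewrite mulr0.
Qed.

Definition wedge (P Q : altmap) : altmap :=
  mkAlt (wedge_multilinear (altmapP P).1 (altmapP Q).1)
        (wedge_alternating (altmapP P).1 (altmapP Q).1
                           (altmapP P).2 (altmapP Q).2).

Lemma insertion_proof (v : V) (P : altmap) :
  multilinear (fun t => P (v :: t)) /\ alternating (fun t => P (v :: t)).
Proof.
have [HP AP] := altmapP P; split; first exact: multilinear_cons.
by move=> s t r w; rewrite -cat_cons AP.
Qed.

Definition insertion (v : V) (P : altmap) : altmap :=
  mkAlt (insertion_proof v P).1 (insertion_proof v P).2.

End Alternating.

(* For finite-dimensional V and W, [bialt n p V W] is the tensor product of the
   n-th exterior power of the dual of V and the p-th one of the dual of W. *)
Section BiAlternating.
Variables (n p : nat) (V W : lmodType K).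

Definition bialt_pred : {pred seq V -> seq W -> K^o} := fun q => `[<
  [/\ forall w, multilinear (q ^~ w) /\ alternating (q ^~ w),
      forall v, multilinear (q v) /\ alternating (q v) &
      forall v w, q v w != 0 -> size v = n /\ size w = p] >].

Lemma bialt_submod : submod_closed bialt_pred.
Proof.
split.
  apply/asboolP; split=> [w|v|v w]; last by rewrite eqxx.
    by split=> // s t a u v; rewrite mulr0 addr0.
  by split=> // s t a u w; rewrite mulr0 addr0.
move=> c f g /asboolP[f1 f2 f3] /asboolP[g1 g2 g3]; apply/asboolP; split.
- by move=> w; exact: alt_comb (f1 w) (g1 w).
- by move=> v; exact: alt_comb (f2 v) (g2 v).
- move=> v w; have [f0|/f3//] := eqVneq (f v w) 0.
  have [g0|/g3//] := eqVneq (g v w) 0.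
  by rewrite !fctE f0 g0 scaler0 addr0 eqxx.
Qed.

Record bialt := MkBialt
  { bialtfun :> seq V -> seq W -> K^o; _ : bialtfun \in bialt_pred }.
HB.instance Definition _ := [isSub for bialtfun].
HB.instance Definition _ := [Choice of bialt by <:].
HB.instance Definition _ := GRing.SubChoice_isSubLmodule.Build
  K (seq V -> seq W -> K^o) bialt_pred bialt bialt_submod.

Definition tensor_fun (P : altmap V) (Q : altmap W) (v : seq V) (w : seq W) : K :=
  if (size v == n) && (size w == p) then P v * Q w else 0.

Lemma tensor_proof P Q : (tensor_fun P Q : seq V -> seq W -> K^o) \in bialt_pred.
Proof.
have [HP AP] := altmapP P; have [HQ AQ] := altmapP Q.
apply/asboolP; split=> [w|v|v w]; last first.
- by rewrite /tensor_fun; case: ifP => [/andP[/eqP + /eqP]|]; rewrite ?eqxx.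
- split=> [s t a u u'|s t r u]; rewrite /tensor_fun ?size_cat /=.
    by case: ifP => _; rewrite ?mulr0 ?addr0// HQ mulrDr mulrCA.
  by rewrite AQ mulr0 if_same.
- split=> [s t a u u'|s t r u]; rewrite /tensor_fun ?size_cat /=.
    by case: ifP => _; rewrite ?mulr0 ?addr0// HP mulrDl mulrA.
  by rewrite AP mul0r if_same.
Qed.

Definition tensor P Q : bialt := MkBialt (tensor_proof P Q).

End BiAlternating.
End LinearAlgebra.

Section Bundles.
Variables (R : realType) (m : nat) (M : manifold R m).
Local Notation C := (Cinf M).

Lemma msmooth_comb (f : C) (g h : M -> R) : msmooth g -> msmooth h ->
  msmooth (fun x => f x * g x + h x).
Proof.
move=> sg sh; apply: msmooth_onD => //; first exact: openT.
by apply: msmooth_onM => //; [exact: openT|exact: CinfP].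
Qed.

(* A family of vector spaces with a notion of smooth section.  The tensor bundles
   below are given in this form: the smoothness of a tensor is tested on smooth
   arguments. *)
Record bundle := Bundle {
  fib :> M -> lmodType R;
  smooth_section : (forall x, fib x) -> Prop;
  smooth_section0 : smooth_section (fun=> 0);
  smooth_sectionP : forall (f : C) s t, smooth_section s -> smooth_section t ->
    smooth_section (fun x => f x *: s x + t x) }.

Section Sections.
Variable E : bundle.

Record sec := Sec { secfun :> forall x, E x; secP : smooth_section secfun }.

Lemma sec_eq (s t : sec) : (forall x, s x = t x) -> s = t.
Proof.
case: s t => [s Hs] [t Ht] /= st.
have {}st : s = t by exact: functional_extensionality_dep.
by rewrite {}st in Hs *; congr Sec; exact: Prop_irrelevance.
Qed.

HB.instance Definition _ := gen_eqMixin sec.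
HB.instance Definition _ := gen_choiceMixin sec.

Definition sec0 : sec := Sec (smooth_section0 E).

Lemma secD_proof (s t : sec) : smooth_section (fun x => s x + t x).
Proof.
have := smooth_sectionP 1 (secP s) (secP t); congr smooth_section.
by apply: functional_extensionality_dep => x; rewrite /= scale1r.
Qed.
Definition secD s t : sec := Sec (secD_proof s t).

Lemma secZ_proof (f : C) (s : sec) : smooth_section (fun x => f x *: s x).
Proof.
have := smooth_sectionP f (secP s) (smooth_section0 E); congr smooth_section.
by apply: functional_extensionality_dep => x; rewrite /= addr0.
Qed.
Definition secZ f s : sec := Sec (secZ_proof f s).
Definition secN s : sec := secZ (-1) s.

Fact secDA : associative secD.
Proof. by move=> s t u; apply: sec_eq => x; exact: addrA. Qed.
Fact secDC : commutative secD.
Proof. by move=> s t; apply: sec_eq => x; exact: addrC. Qed.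
Fact sec0D : left_id sec0 secD.
Proof. by move=> s; apply: sec_eq => x; exact: add0r. Qed.
Fact secND : left_inverse sec0 secN secD.
Proof. by move=> s; apply: sec_eq => x; rewrite /= scaleN1r addNr. Qed.
HB.instance Definition _ := GRing.isZmodule.Build sec secDA secDC sec0D secND.

Fact secZA f g s : secZ f (secZ g s) = secZ (f * g) s.
Proof. by apply: sec_eq => x; exact: scalerA. Qed.
Fact sec1Z : left_id 1 secZ.
Proof. by move=> s; apply: sec_eq => x; exact: scale1r. Qed.
Fact secZDr : right_distributive secZ +%R.
Proof. by move=> f s t; apply: sec_eq => x; exact: scalerDr. Qed.
Fact secZDl s : {morph secZ^~ s : f g / f + g}.
Proof. by move=> f g; apply: sec_eq => x; exact: scalerDl. Qed.
HB.instance Definition _ :=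
  GRing.Zmodule_isLmodule.Build C sec secZA sec1Z secZDr secZDl.

End Sections.

Section DualBundle.
Variable E : bundle.

Definition smooth_dual (a : forall x, dual (E x)) : Prop :=
  forall X : sec E, msmooth (fun x => a x (X x)).

Fact smooth_dual0 : smooth_dual (fun=> 0).
Proof. by move=> X; exact: msmooth_on_cst. Qed.
Fact smooth_dualP (f : C) s t : smooth_dual s -> smooth_dual t ->
  smooth_dual (fun x => f x *: s x + t x).
Proof. by move=> Hs Ht X; exact: (msmooth_comb f (Hs X) (Ht X)). Qed.

Definition dual_bundle : bundle := Bundle smooth_dual0 smooth_dualP.

Definition pairing (a : sec dual_bundle) (X : sec E) : C := mkCinf (secP a X).
End DualBundle.

Definition sec_eval (E : bundle) (l : seq (sec E)) (x : M) : seq (E x) :=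
  [seq X x | X : sec E <- l].

Section ExteriorBundle.
Variable E : bundle.

Definition smooth_alt (P : forall x, altmap (E x)) : Prop :=
  forall l : seq (sec E), msmooth (fun x => P x (sec_eval l x)).

Fact smooth_alt0 : smooth_alt (fun=> 0).
Proof. by move=> l; exact: msmooth_on_cst. Qed.
Fact smooth_altP (f : C) s t : smooth_alt s -> smooth_alt t ->
  smooth_alt (fun x => f x *: s x + t x).
Proof. by move=> Hs Ht l; exact: (msmooth_comb f (Hs l) (Ht l)). Qed.

(* The full exterior algebra bundle of the dual of E. *)
Definition alt_bundle : bundle := Bundle smooth_alt0 smooth_altP.

Definition alt_eval (P : sec alt_bundle) (l : seq (sec E)) : C :=
  mkCinf (secP P l).

Definition of_degree (p : nat) (P : sec alt_bundle) : Prop :=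
  forall x (l : seq (E x)), size l <> p -> P x l = 0.

Lemma smooth_wedge_fun (l : seq (sec E)) (P Q : forall x, seq (E x) -> R) :
  (forall l, msmooth (fun x => P x (sec_eval l x))) ->
  (forall l, msmooth (fun x => Q x (sec_eval l x))) ->
  msmooth (fun x => wedge_fun (P x) (Q x) (sec_eval l x)).
Proof.
elim: l P Q => [|X l IH] P Q HP HQ /=.
  by apply: msmooth_onM; [exact: openT|exact: (HP [::])|exact: (HQ [::])].
apply: msmooth_onD; first exact: openT.
  by apply: (IH (fun x t => P x (X x :: t)) Q _ HQ) => k; exact: (HP (X :: k)).
apply: (IH (fun x t => (-1) ^+ size t * P x t) (fun x t => Q x (X x :: t))) => k.
  apply: msmooth_onM (HP k); first exact: openT.
  rewrite (_ : (fun x => _) = (fun=> (-1) ^+ size k)); first exact: msmooth_on_cst.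
  by apply/funext => x; rewrite size_map.
exact: (HQ (X :: k)).
Qed.

Definition sec_wedge (P Q : sec alt_bundle) : sec alt_bundle :=
  @Sec alt_bundle (fun x => wedge (P x) (Q x))
    (fun l => smooth_wedge_fun l (secP P) (secP Q)).

Definition sec_insertion (X : sec E) (P : sec alt_bundle) : sec alt_bundle :=
  @Sec alt_bundle (fun x => insertion (X x) (P x)) (fun l => secP P (X :: l)).

End ExteriorBundle.

Section Tangent.

Section TangentSpace.
Variable x : M.

Definition derivation_pred : {pred C -> R^o} := fun v => `[<
  (forall a f g, v (constC M a * f + g) = a * v f + v g) /\
  (forall f g : C, v (f * g) = f x * v g + g x * v f) >].

Lemma derivation_submod : submod_closed derivation_pred.
Proof.
split.
  by apply/asboolP; split=> *; rewrite /= !mulr0 addr0.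
move=> c v w /asboolP[v1 v2] /asboolP[w1 w2]; apply/asboolP.
have cE (y : R^o) : c *: y = c * y by [].
split=> [a f g|f g]; rewrite !fctE !cE ?v1 ?w1 ?v2 ?w2.
  by rewrite !mulrDr addrACA mulrCA.
by rewrite !mulrDr addrACA ![c * (_ * _)]mulrCA.
Qed.

Record tangent := MkTangent
  { tanfun :> C -> R^o; _ : tanfun \in derivation_pred }.
HB.instance Definition _ := [isSub for tanfun].
HB.instance Definition _ := [Choice of tangent by <:].
HB.instance Definition _ := GRing.SubChoice_isSubLmodule.Build
  R (C -> R^o) derivation_pred tangent derivation_submod.

Lemma tangentP (v : tangent) :
  (forall a f g, v (constC M a * f + g) = a * v f + v g) /\
  (forall f g : C, v (f * g) = f x * v g + g x * v f).
Proof. by case: v => v H; exact: asboolW H. Qed.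
End TangentSpace.

Definition smooth_field (V : forall x, tangent x) : Prop :=
  forall f : C, msmooth (fun x => V x f).

Fact smooth_field0 : smooth_field (fun=> 0).
Proof. by move=> f; exact: msmooth_on_cst. Qed.
Fact smooth_fieldP (f : C) s t : smooth_field s -> smooth_field t ->
  smooth_field (fun x => f x *: s x + t x).
Proof. by move=> Hs Ht g; exact: (msmooth_comb f (Hs g) (Ht g)). Qed.

Definition tangent_bundle : bundle := Bundle smooth_field0 smooth_fieldP.

Implicit Types V W : sec tangent_bundle.

Definition field_act V (f : C) : C := mkCinf (secP V f).

Definition field_bracket_fun V W x (f : C) : R :=
  V x (field_act W f) - W x (field_act V f).

Lemma field_bracket_proof V W x :
  (field_bracket_fun V W x : C -> R^o) \in derivation_pred x.
Proof.
have actD U a f g :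
    field_act U (constC M a * f + g) = constC M a * field_act U f + field_act U g.
  by apply: val_inj; apply/funext => y; exact: (tangentP (U y)).1.
have actM U f g : field_act U (f * g) = f * field_act U g + g * field_act U f.
  by apply: val_inj; apply/funext => y; exact: (tangentP (U y)).2.
have tD (U : sec tangent_bundle) (f g : C) : U x (f + g) = U x f + U x g.
  by have := (tangentP (U x)).1 1 f g; rewrite mul1r (_ : constC M 1 = 1) ?mul1r//;
     exact: val_inj.
apply/asboolP; split=> [a f g|f g]; rewrite /field_bracket_fun.
  by rewrite !actD !(tangentP _).1 mulrBr opprD addrACA.
rewrite !actM !tD !(tangentP _).2 /=; ring.
Qed.

Fact field_bracket_smooth V W :
  smooth_field (fun x => MkTangent (field_bracket_proof V W x)).
Proof.
move=> f.
exact: (CinfP (field_act V (field_act W f) - field_act W (field_act V f))).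
Qed.

Definition field_bracket V W : sec tangent_bundle :=
  @Sec tangent_bundle _ (field_bracket_smooth V W).

End Tangent.

(* Local trivialisations [vtriv i x : A_x -> R^n] for x in the open set [vdom i],
   with inverse [vtrivV i x] and smooth transition matrices. *)
Record vector_bundle (n : nat) := VectorBundle {
  vfib : M -> lmodType R;
  vindex : Type;
  vdom : vindex -> set M;
  vtriv : vindex -> forall x, {linear vfib x -> 'rV[R]_n};
  vtrivV : vindex -> forall x, 'rV[R]_n -> vfib x;
  vdom_open : forall i, open (vdom i);
  vdom_cover : forall x, exists i, vdom i x;
  vtrivK : forall i x, vdom i x -> cancel (vtriv i x) (vtrivV i x);
  vtrivVK : forall i x, vdom i x -> cancel (vtrivV i x) (vtriv i x);
  vtriv_smooth : forall i j (k l : 'I_n), msmooth_on (vdom i `&` vdom j)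
    (fun x => vtriv j x (vtrivV i x (delta_mx 0 k)) 0 l) }.

Section VectorBundle.
Variables (n : nat) (A : vector_bundle n).

Definition smooth_vsection (s : forall x, vfib A x) : Prop :=
  forall i (k : 'I_n), msmooth_on (vdom i) (fun x => vtriv i x (s x) 0 k).

Fact smooth_vsection0 : smooth_vsection (fun=> 0).
Proof.
move=> i k; rewrite (_ : (fun x => _) = (fun=> 0)); first exact: msmooth_on_cst.
by apply/funext => x; rewrite linear0 mxE.
Qed.
Fact smooth_vsectionP (f : C) s t : smooth_vsection s -> smooth_vsection t ->
  smooth_vsection (fun x => f x *: s x + t x).
Proof.
move=> Hs Ht i k.
rewrite (_ : (fun x => _) =
  (fun x => f x * vtriv i x (s x) 0 k + vtriv i x (t x) 0 k)); last first.
  by apply/funext => x; rewrite linearP !mxE.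
apply: msmooth_onD => //; first exact: vdom_open.
apply: msmooth_onM => //; first exact: vdom_open.
exact: msmooth_on_sub (CinfP f).
Qed.

Definition bundle_of : bundle := Bundle smooth_vsection0 smooth_vsectionP.
End VectorBundle.

End Bundles.

Coercion bundle_of : vector_bundle >-> bundle.

Record lie_algebroid (R : realType) (m : nat) (M : manifold R m) (n : nat) :=
  LieAlgebroid {
  la_bundle :> vector_bundle M n;
  la_bracket : sec la_bundle -> sec la_bundle -> sec la_bundle;
  la_anchor : forall x, {linear la_bundle x -> tangent x};
  la_anchor_smooth : forall X : sec la_bundle,
    smooth_field (fun x => la_anchor x (X x));
  la_bilinear : forall (c : R) X Y Z,
    la_bracket (constC M c *: X + Y) Z =
      constC M c *: la_bracket X Z + la_bracket Y Z;
  la_skew : forall X Y, la_bracket X Y = - la_bracket Y X;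
  la_jacobi : forall X Y Z,
    la_bracket X (la_bracket Y Z) + la_bracket Y (la_bracket Z X) +
    la_bracket Z (la_bracket X Y) = 0;
  la_leibniz : forall (f : Cinf M) X Y,
    la_bracket X (f *: Y) =
      f *: la_bracket X Y +
      field_act (@Sec _ _ _ (tangent_bundle M) _ (la_anchor_smooth X)) f *: Y }.

Section LieAlgebroid.
Variables (R : realType) (m : nat) (M : manifold R m) (n : nat).
Variable A : lie_algebroid M n.
Local Notation C := (Cinf M).

Definition rho (X : sec A) : sec (tangent_bundle M) :=
  @Sec _ _ _ (tangent_bundle M) _ (la_anchor_smooth X).

Definition is_cocycle (phi : sec (dual_bundle A)) : Prop := forall X Y : sec A,
  field_act (rho X) (pairing phi Y) - field_act (rho Y) (pairing phi X)
  - pairing phi (la_bracket X Y) = 0.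

(* The exterior algebra of A_x is that of the bidual: a p-vector is an
   alternating form in p covectors. *)
Definition multivector : bundle M := alt_bundle (dual_bundle A).

Section Degree01.
Variables (f : C) (X : sec A).

Definition scalar_fun x (l : seq (dual (A x))) : R^o := if l is [::] then f x else 0.
Definition vector_fun x (l : seq (dual (A x))) : R^o :=
  if l is [:: a] then a (X x) else 0.

Lemma scalar_proof x : @scalar_fun x \in alt_pred (V := dual (A x)).
Proof.
apply/asboolP; split=> [[|? s] t a u v|[|? s] t r v] //=;
  by rewrite mulr0 addr0.
Qed.

Lemma vector_proof x : @vector_fun x \in alt_pred (V := dual (A x)).
Proof.
apply/asboolP; split=> [[|? [|? s]] [|? t] a u v|[|? [|? s]] [|? t] r v] //=;
  by rewrite mulr0 addr0.
Qed.

Fact scalar_smooth : @smooth_alt _ _ _ (dual_bundle A) (fun x => MkAlt (scalar_proof x)).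
Proof. by move=> [|a l]; [exact: CinfP|exact: msmooth_on_cst]. Qed.

Fact vector_smooth : @smooth_alt _ _ _ (dual_bundle A) (fun x => MkAlt (vector_proof x)).
Proof.
move=> [|a [|b l]]; [exact: msmooth_on_cst| |exact: msmooth_on_cst].
exact: CinfP (pairing a X).
Qed.

Definition scalar : sec multivector := @Sec _ _ _ multivector _ scalar_smooth.
Definition vector : sec multivector := @Sec _ _ _ multivector _ vector_smooth.
End Degree01.

(* Signs and degrees are shifted to stay in nat: (-1)^(p-1) is written
   (-1)^(p+1), and a bracket of degree p + q - 1 is one whose values vanish
   unless (number of arguments) + 1 = p + q; in particular [f, g] = 0. *)
Record is_schouten (br : sec multivector -> sec multivector -> sec multivector)
  : Prop := IsSchouten {
  schouten_linearl : forall (c : R) P P' Q,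
    br (constC M c *: P + P') Q = constC M c *: br P Q + br P' Q;
  schouten_linearr : forall (c : R) P Q Q',
    br P (constC M c *: Q + Q') = constC M c *: br P Q + br P Q';
  schouten_degree : forall p q P Q, of_degree p P -> of_degree q Q ->
    forall x (l : seq (dual (A x))), (size l).+1 <> (p + q)%N -> br P Q x l = 0;
  schouten_vector : forall X Y, br (vector X) (vector Y) = vector (la_bracket X Y);
  schouten_scalar : forall X f,
    br (vector X) (scalar f) = scalar (field_act (rho X) f);
  schouten_antisym : forall p q P Q, of_degree p P -> of_degree q Q ->
    br P Q = - ((-1) ^+ (p.+1 * q.+1) *: br Q P);
  schouten_leibniz : forall p q r P Q S,
    of_degree p P -> of_degree q Q -> of_degree r S ->
    br P (sec_wedge Q S) =
      sec_wedge (br P Q) S + (-1) ^+ (p.+1 * q) *: sec_wedge Q (br P S) }.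

Definition schouten_jacobi (br : sec multivector -> sec multivector -> sec multivector)
    (phi : sec (dual_bundle A)) (p q : nat) (P Q : sec multivector) :
    sec multivector :=
  br P Q + (p%:R - 1) *: sec_wedge P (sec_insertion phi Q)
  - ((-1) ^+ p.+1 * (q%:R - 1)) *: sec_wedge (sec_insertion phi P) Q.

Record is_representation (E : bundle M) (D : sec A -> sec E -> sec E) : Prop :=
  IsRepresentation {
  repr_addl : forall X Y s, D (X + Y) s = D X s + D Y s;
  repr_linearr : forall (c : R) X s t,
    D X (constC M c *: s + t) = constC M c *: D X s + D X t;
  repr_scalel : forall f X s, D (f *: X) s = f *: D X s;
  repr_leibniz : forall f X s,
    D X (f *: s) = f *: D X s + field_act (rho X) f *: s;
  repr_flat : forall X Y s, D X (D Y s) - D Y (D X s) = D (la_bracket X Y) s }.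

End LieAlgebroid.

Section CanonicalBundle.
Variables (R : realType) (m : nat) (M : manifold R m).
Local Notation C := (Cinf M).

Definition form : bundle M := alt_bundle (tangent_bundle M).

Definition is_lie_derivative (V : sec (tangent_bundle M)) (mu nu : sec form) :
    Prop :=
  forall l : seq (sec (tangent_bundle M)),
    alt_eval nu l = field_act V (alt_eval mu l) -
      \sum_(i < size l) alt_eval mu (set_nth 0 l i (field_bracket V l`_i)).

(* The form determined by [is_lie_derivative]. *)
Definition lie_derivative (V : sec (tangent_bundle M)) (mu : sec form) : sec form :=
  xget 0 [set nu | is_lie_derivative V mu nu].

Variables (n : nat) (A : lie_algebroid M n).

Definition smooth_bialt
    (s : forall x, bialt n m (dual (A x)) (tangent x)) : Prop :=
  forall (a : seq (sec (dual_bundle A))) (v : seq (sec (tangent_bundle M))),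
    msmooth (fun x => s x (sec_eval a x) (sec_eval v x)).

Fact smooth_bialt0 : smooth_bialt (fun=> 0).
Proof. by move=> a v; exact: msmooth_on_cst. Qed.
Fact smooth_bialtP (f : C) s t : smooth_bialt s -> smooth_bialt t ->
  smooth_bialt (fun x => f x *: s x + t x).
Proof. by move=> Hs Ht a v; exact: (msmooth_comb f (Hs a v) (Ht a v)). Qed.

(* The fibre at x is the tensor product of the top exterior powers of A_x and of
   the cotangent space at x. *)
Definition QA : bundle M := Bundle smooth_bialt0 smooth_bialtP.

Section Tensor.
Variables (eta : sec (multivector A)) (mu : sec form).

Fact tensor_smooth : smooth_bialt (fun x => tensor n m (eta x) (mu x)).
Proof.
move=> a v; rewrite /= (_ : (fun x => _) = fun x =>
  if (size a == n) && (size v == m)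
  then eta x (sec_eval a x) * mu x (sec_eval v x) else 0); last first.
  by apply/funext => x; rewrite /tensor_fun !size_map.
case: (_ && _); last exact: msmooth_on_cst.
by apply: msmooth_onM; [exact: openT|exact: (secP eta a)|exact: (secP mu v)].
Qed.

(* [tens eta mu] is the component in top degrees of the tensor product; it is
   used for eta of degree n and mu of degree m. *)
Definition tens : sec QA := @Sec _ _ _ QA _ tensor_smooth.
End Tensor.

(* Sections of Q_A are only locally of the form eta (x) mu, hence the open set U;
   the formula for D_X (eta (x) mu) itself is the case U = M. *)
Record is_Dphi (br : sec (multivector A) -> sec (multivector A) -> sec (multivector A))
    (phi : sec (dual_bundle A)) (D : sec A -> sec QA -> sec QA) : Prop := IsDphi {
  Dphi_linearl : forall (c : R) X Y s,
    D (constC M c *: X + Y) s = constC M c *: D X s + D Y s;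
  Dphi_linearr : forall (c : R) X s t,
    D X (constC M c *: s + t) = constC M c *: D X s + D X t;
  Dphi_tens : forall (U : set M) X (s : sec QA) eta mu, open U ->
    of_degree n eta -> of_degree m mu ->
    (forall x, U x -> s x = tens eta mu x) ->
    forall x, U x ->
      D X s x = (tens (schouten_jacobi br phi 1 n (vector X) eta) mu +
                 tens eta (lie_derivative (rho X) mu)) x }.

End CanonicalBundle.

(* Main.v *)
(* Evaluated on covectors, the bracket [X, .] on top multivectors is the Lie derivative
   (it is a derivation of the wedge product with the right values on functions and
   vectors, and it is local).  Hence on lists of covectors and vector fields
     (D_X s)(a, v) = rho(X)(s(a, v)) - sum_i s(.., L_X a_i, ..; v)
                     - sum_j s(a; .., [rho(X), v_j], ..) - (n - 1) phi(X) s(a, v).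
   This determines D, since every section of Q_A is locally a tensor product of top forms,
   and it defines D, since near each point the right-hand side is such a tensor.
   Flatness follows from the Jacobi identities and the cocycle condition.  In D_(fX) the
   terms with derivatives of f are traces of rank-one endomorphisms of the dual of A_x
   and of T_xM, both equal to rho(X)(f), and they cancel.

   The geometric input is that T_xM, defined by derivations of smooth functions, is
   spanned by the m coordinate derivations, and that frames extend globally: this uses
   bump functions, the chain rule for C^1 functions, and Hadamard's lemma
     G(z) = G(p) + sum_k (z - p)_k int_0^1 d_k G(p + s (z - p)) ds. *)
Require Import Defs.
From HB Require Import structures.
From mathcomp Require Import all_boot all_order all_algebra.
From mathcomp Require Import all_classical all_reals all_analysis.
From mathcomp Require Import ring lra.

Import Defs.

Set Implicit Arguments.
Unset Strict Implicit.
Unset Printing Implicit Defensive.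

Import Order.TTheory GRing.Theory Num.Theory numFieldNormedType.Exports.
Local Open Scope classical_set_scope.
Local Open Scope ring_scope.

(** * Calculus in several variables *)

(** The Schouten bracket is known only through its axioms, and the Lie derivative of forms only
    through a choice operator. Both are compared with [lie_op], which differentiates the value of a
    form and subtracts the changes of its arguments. That the values of [lie_op] on global sections
    come from an element of each fibre is not checked slot by slot. For covectors it is
    [tensorial_functional]; wedge products inherit it from the Leibniz rule [lie_op_wedge], and top
    forms from their local expression as a function times a wedge product of frame covectors.
    Locality takes the place of partitions of unity: fibre elements are chosen point by point, and
    their smoothness is read off a formula that is already global.

    Compatibility of the anchor with brackets is not among the axioms of [lie_algebroid]; it is
    extracted from the Jacobi identity in [rho_bracket], and flatness relies on it. *)

Lemma cvg_sumr (R : realType) (T I : Type) (F : set_system T) (FF : Filter F)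
    (r : seq I) (f : I -> T -> R) (l : I -> R) :
  (forall i, f i x @[x --> F] --> l i) ->
  \sum_(i <- r) f i x @[x --> F] --> \sum_(i <- r) l i.
Proof.
move=> fl; elim: r => [|i r IH].
  by under eq_fun do rewrite big_nil; rewrite big_nil; exact: cvg_cst.
by under eq_fun do rewrite big_cons; rewrite big_cons; exact: cvgD.
Qed.

Section DirectionalDerivative.
Variables (R : realType) (V : normedModType R).
Implicit Types (G : V -> R) (x v : V).

Lemma is_derive_line G x v (t : R) : derivable G (x + t *: v) v ->
  is_derive t 1 (fun s => G (x + s *: v)) ('D_v G (x + t *: v)).
Proof.
have E : (fun h : R => h^-1 *: (G (x + (h *: (1 : R^o) + t) *: v) - G (x + t *: v))) =
         (fun h : R => h^-1 *: (G (h *: v + (x + t *: v)) - G (x + t *: v))).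
  apply/funext => h; rewrite [h *: (1 : R^o)]mulr1 scalerDl.
  by rewrite addrCA (addrCA _ x).
by move=> dG; split; rewrite /derivable ?/derive E.
Qed.

Lemma MVT_line G x v (h : R) :
  (forall c : R, `|c| <= `|h| -> derivable G (x + c *: v) v) ->
  exists2 c : R, `|c| <= `|h| & G (x + h *: v) - G x = h * 'D_v G (x + c *: v).
Proof.
move=> dG; pose f (s : R) := G (x + s *: v).
have fd (t : R) : `|t| <= `|h| -> is_derive t 1 f ('D_v G (x + t *: v)).
  by move=> th; exact: is_derive_line (dG _ th).
have f0 : f 0 = G x by rewrite /f scale0r addr0.
have cf (a b : R) : (forall t, t \in `[a, b] -> `|t| <= `|h|) ->
    {within `[a, b], continuous f}.
  move=> ab; apply: derivable_within_continuous => t /ab th.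
  by have [] := fd t th.
have [h0|h0] := lerP 0 h.
  have H (t : R) : t \in `[0, h] -> `|t| <= `|h|.
    by rewrite in_itv /= => /andP[t0 th]; rewrite !ger0_norm.
  have [|c ch E] := MVT_segment h0 (f := f) (df := fun t => 'D_v G (x + t *: v)) _ (cf _ _ H).
    by move=> t th; apply: fd; apply: H; move: th; rewrite !in_itv /= => /andP[/ltW-> /ltW->].
  by exists c; [exact: H|rewrite -f0 E subr0 mulrC].
have H (t : R) : t \in `[h, 0] -> `|t| <= `|h|.
  by rewrite in_itv /= => /andP[t0 th]; rewrite !ler0_norm ?lerN2// ltW.
have [|c ch E] := MVT_segment (ltW h0) (f := f) (df := fun t => 'D_v G (x + t *: v)) _ (cf _ _ H).
  by move=> t th; apply: fd; apply: H; move: th; rewrite !in_itv /= => /andP[/ltW-> /ltW->].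
exists c; first exact: H.
by rewrite -[LHS]opprB -[G x]f0 E; ring.
Qed.

End DirectionalDerivative.

Lemma is_diff_of_bound (R : realType) (V W : normedModType R) (f : V -> W)
    (L : {linear V -> W}) (x : V) : continuous L ->
  (forall e : R, 0 < e -> \forall h \near (0 : V),
     `|f (h + x) - f x - L h| <= e * `|h|) ->
  is_diff x f L.
Proof.
move=> cL H; have LO : f \o shift x = cst (f x) + L +o_ 0 id.
  apply/eqaddoP => e e0; apply: filterS (H e e0) => h.
  by rewrite !fctE opprD addrA.
have eL : 'd f x = L :> (V -> W) by exact: diff_unique.
by split=> //; apply/diff_locallyP; rewrite eL.
Qed.

Section TotalDerivative.
Variables (R : realType) (m : nat).
Implicit Types (U : set 'rV[R]_m) (G f g : 'rV[R]_m -> R) (p : 'rV[R]_m).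

Local Notation d k := (delta_mx 0 k : 'rV[R]_m).

Lemma row_norm_le p (e : R) : 0 <= e -> (forall k, `|p 0 k| <= e) -> `|p| <= e.
Proof.
move=> e0 H; rewrite [`|p|]mx_normrE (bigmax_le _ e0) //= => -[i j] _.
by rewrite ord1.
Qed.

Lemma coord_norm_le p k : `|p 0 k| <= `|p|.
Proof.
rewrite [`|p|]mx_normrE.
exact: (le_bigmax _ (fun ij : 'I_1 * 'I_m => `|p ij.1 ij.2|) (0, k)).
Qed.

(** The path from [p] to [z] runs through the points [q k], which have the first k coordinates of
    [z] and the remaining ones of [p]. Each step moves one coordinate, so the mean value theorem on
    a line applies, and in the maximum norm no intermediate point is farther from [p] than [z]. *)
Lemma total_increment G p (e : R) (z : 'rV[R]_m) : 
  (forall k y, `|y - p| <= `|z - p| ->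
     derivable G y (d k) /\ `|'D_(d k) G y - 'D_(d k) G p| <= e) ->
  `|G z - G p - \sum_k (z - p) 0 k * 'D_(d k) G p| <= m%:R * (e * `|z - p|).
Proof.
move=> H; pose q (k : nat) : 'rV[R]_m := \row_j (if (j < k)%N then z 0 j else p 0 j).
have qz : q m = z by apply/rowP => j; rewrite mxE ltn_ord.
have q0 : q 0%N = p by apply/rowP => j; rewrite mxE.
have -> : G z - G p = \sum_(k < m) (G (q k.+1) - G (q k)).
  by have := telescope_sumr (fun k => G (q k)) (leq0n m); rewrite big_mkord /= qz q0.
rewrite -sumrB; apply: le_trans (ler_norm_sum _ _ _) _.
apply: (@le_trans _ _ (\sum_(k < m) e * `|z - p|)); last first.
  by rewrite sumr_const card_ord -[leLHS]mulr_natl lexx.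
apply: ler_sum => k _.
have qS : q k.+1 = q k + (z - p) 0 k *: d k.
  apply/rowP => j; rewrite !mxE eqxx /= ltnS leq_eqVlt.
  have [->|jk] := eqVneq j k; first by rewrite eqxx ltnn /= mulr1 addrC subrK.
  rewrite (_ : (j == k :> nat) = false); first by rewrite mulr0 addr0.
  by apply/negbTE.
have near_q (c : R) : `|c| <= `|(z - p) 0 k| -> `|q k + c *: d k - p| <= `|z - p|.
  move=> cz; apply: row_norm_le => // j; rewrite !mxE eqxx /=.
  have [->|jk] := eqVneq j k.
    rewrite ltnn mulr1 addrAC subrr add0r; apply: le_trans cz _; exact: coord_norm_le.
  rewrite mulr0 addr0; case: ifP => _; last by rewrite subrr normr0.
  by have := coord_norm_le (z - p) j; rewrite !mxE.
have [|c cz E] := @MVT_line _ _ G (q k) (d k) ((z - p) 0 k).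
  by move=> c cz; have [] := H k _ (near_q c cz).
rewrite qS E -mulrBr normrM mulrC ler_pM//; last exact: coord_norm_le.
by have [] := H k _ (near_q c cz).
Qed.

Lemma C1_differentiable G p :
  (forall k, \forall y \near p, derivable G y (d k)) ->
  (forall k, {for p, continuous (fun y => 'D_(d k) G y)}) ->
  is_diff p G (fun v => \sum_k v 0 k * 'D_(d k) G p).
Proof.
move=> dG cG; pose L (v : 'rV[R]_m) : R := \sum_k v 0 k * 'D_(d k) G p.
have Llin : linear L.
  move=> a u v; rewrite /L scaler_sumr -big_split /=; apply: eq_bigr => k _.
  by rewrite !mxE mulrDl -mulrA.
pose LL := GRing.isLinear.Build R 'rV[R]_m R _ L Llin.
pose L' : {linear 'rV[R]_m -> R} := HB.pack L LL.
have cL : continuous L'.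
  rewrite -[X in continuous X]/L => v; rewrite /continuous_at /L.
  apply: (@cvg_sumr _ _ _ (nbhs v)) => k.
  by apply: cvgM; [exact: coord_continuous|exact: cvg_cst].
apply: (@is_diff_of_bound _ _ _ G L' p cL) => e e_gt0.
  (* [total_increment] loses a factor m; dividing by m + 1 also covers m = 0. *)
  have e0 : 0 < e / (m%:R + 1) by rewrite divr_gt0// ltr_wpDl.
  have : \forall y \near p, forall k : 'I_m, derivable G y (d k) /\
      `|'D_(d k) G y - 'D_(d k) G p| <= e / (m%:R + 1).
    apply: (@filter_forall _ _ _ (nbhs p)) => k; near=> y; split; first by near: y; exact: dG.
    by near: y; move/cvgrPdist_le : (cG k) => /(_ _ e0); apply: filterS => y; rewrite distrC.
  case/nbhs_ballP => r /= r0 Hr.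
  apply/nbhs_ballP; exists r => //= h; rewrite -ball_normE /= sub0r normrN => hr.
  have := @total_increment G p (e / (m%:R + 1)) (h + p).
  rewrite addrK => /(_ _)/le_trans H.
  apply: H.
    move=> k y yh; apply: Hr; rewrite -ball_normE /= distrC.
    exact: le_lt_trans yh hr.
  rewrite mulrA; apply: ler_wpM2r => //.
  rewrite mulrCA -[leRHS]mulr1 ler_pM2l// ler_pdivrMr ?ltr_wpDl//.
  by rewrite mul1r lerDl.
Unshelve. all: by end_near. Qed.
End TotalDerivative.

(** [f] is derivable along [v] only, but its restriction to the line through [x] is a differentiable
    function of one variable, to which the chain rule for differentials applies. *)
Lemma is_derive_comp_diff (R : realType) (U V W : normedModType R)
    (f : U -> V) (g : V -> W) (x v : U) (df : V) (dg : V -> W) :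
  is_diff (f x) g dg -> is_derive x v f df -> is_derive x v (g \o f) (dg df).
Proof.
move=> [dg1 dg2] [df1 df2].
have line (Z : normedModType R) (h : U -> Z) :
    'D_v h x = 'D_1 (fun t : R => h (t *: v + x)) 0.
  rewrite /derive; set g1 := fun h => h^-1 *: _; set g2 := fun h => h^-1 *: _.
  suff -> : g1 = g2 by []. apply/funext => t; rewrite /g1 /g2 /=.
  by rewrite addr0 scale0r add0r [t *: 1]mulr1.
set c := fun t : R => f (t *: v + x).
have c0 : c 0 = f x by rewrite /c scale0r add0r.
have dc : differentiable c 0 by move/derivable1P : df1 => /derivable1_diffP.
have dgc : differentiable g (c 0) by rewrite c0.
have dgoc : differentiable (g \o c) 0 by apply: differentiable_comp.
split; first by apply/derivable1P/derivable1_diffP.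
rewrite line (_ : derive _ _ _ = 'd g (c 0) ('D_1 c 0)).
  by rewrite c0 dg2; congr dg; rewrite -df2 [RHS]line.
by rewrite (deriveE _ dc) (deriveE _ dgoc) diff_comp.
Qed.

Lemma row_continuous (R : realType) (m : nat) (T : topologicalType)
    (F : T -> 'rV[R]_m) (y : T) :
  (forall j, {for y, continuous (fun z => F z 0 j)}) -> {for y, continuous F}.
Proof.
move=> cF; apply/cvgrPdist_le => e e0; near=> z.
apply: row_norm_le; first exact: ltW.
move=> j; rewrite !mxE; move: j; near: z.
apply: (@filter_forall _ _ _ (nbhs y)) => j.
by have /cvgrPdist_le/(_ _ e0) := cF j.
Unshelve. all: by end_near. Qed.

(** * Functions of class C^k: locality, sums, products, composition *)

Section CkTheory.
Variables (R : realType) (m : nat).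
Implicit Types (U V : set 'rV[R]_m) (f g : 'rV[R]_m -> R).
Local Notation d k := (delta_mx 0 k : 'rV[R]_m).

Lemma Ck_sub k U V f : V `<=` U -> Ck k U f -> Ck k V f.
Proof.
move=> VU; elim: k f => [|k IH] f [cf df]; (split; first by move=> y /VU; exact: cf) => //.
by move=> i; have [d1 d2] := df i; split; [move=> y /VU; exact: d1|exact: IH].
Qed.

Lemma Ck_continuous k U f y : Ck k U f -> U y -> {for y, continuous f}.
Proof. by case: k => [|k] [cf _] Uy; exact: cf. Qed.

Lemma Ck_local k U f :
  (forall y, U y -> exists V, [/\ open V, V y & Ck k V f]) -> Ck k U f.
Proof.
elim: k f => [|k IH] f H; (split; first by
  move=> y /H[V [_ Vy [cf _]]]; exact: cf) => //.
move=> i; split; first by move=> y /H[V [_ Vy [_ /(_ i)[+ _]]]]; exact.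
by apply: IH => y /H[V [oV Vy [_ /(_ i)[_ ?]]]]; exists V.
Qed.

Lemma Ck_eq_local k U f : (forall y, U y -> exists V g,
  [/\ open V, V y, (forall z, V z -> f z = g z) & Ck k V g]) -> Ck k U f.
Proof.
move=> H; apply: Ck_local => y /H[V [g [oV Vy fg sg]]]; exists V; split => //.
by apply: Ck_ext sg => // z /fg.
Qed.

Lemma Ck_sum k U n (f : 'I_n -> 'rV[R]_m -> R) : open U ->
  (forall j, Ck k U (f j)) -> Ck k U (fun y => \sum_j f j y).
Proof.
move=> oU; elim: n f => [|n IH] f H.
  rewrite (_ : (fun y => _) = (fun=> 0)); first exact: Ck_cst.
  by apply/funext => y; rewrite big_ord0.
rewrite (_ : (fun y => _) = (fun y => f ord0 y + \sum_j f (lift ord0 j) y)).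
  by apply: CkD => //; exact: IH.
by apply/funext => y; rewrite big_ord_recl.
Qed.

Lemma Ck_prod k U n (f : 'I_n -> 'rV[R]_m -> R) : open U ->
  (forall j, Ck k U (f j)) -> Ck k U (fun y => \prod_j f j y).
Proof.
move=> oU; elim: n f => [|n IH] f H.
  rewrite (_ : (fun y => _) = (fun=> 1)); first exact: Ck_cst.
  by apply/funext => y; rewrite big_ord0.
rewrite (_ : (fun y => _) = (fun y => f ord0 y * \prod_j f (lift ord0 j) y)).
  by apply: CkM => //; exact: IH.
by apply/funext => y; rewrite big_ord_recl.
Qed.

Lemma is_derive_coord (y : 'rV[R]_m) i j :
  is_derive y (d j) (fun y : 'rV[R]_m => y 0 i : R) ((i == j)%:R).
Proof.
have := @derivable_id _ _ y (d j) => /derivable_mxP/(_ 0 i) did.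
split => //; have := derive_mx (@derivable_id _ _ y (d j)).
by rewrite derive_id => /matrixP/(_ 0 i); rewrite !mxE eqxx /= => <-.
Qed.

Lemma Ck_coord k U i : Ck k U (fun y => y 0 i).
Proof.
case: k => [|k]; (split; first by move=> y _; exact: coord_continuous) => //.
move=> j; split; first by move=> y _; have [] := is_derive_coord y i j.
rewrite (_ : (fun y => _) = (fun=> (i == j)%:R)); first exact: Ck_cst.
by apply/funext => y; have [] := is_derive_coord y i j.
Qed.

Lemma Ck1_differentiable k U f y : open U -> U y -> Ck k.+1 U f ->
  is_diff y f (fun v => \sum_j v 0 j * 'D_(d j) f y).
Proof.
move=> oU Uy [_ H]; apply: C1_differentiable => j; have [df sf] := H j.
  exact: filterS (open_nbhs_nbhs (conj oU Uy)).
exact: Ck_continuous sf Uy.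
Qed.

(** A class [S] closed under derivation encodes the smoothness of [h]: the induction on k passes
    from [h] to its derivative without leaving [S]. It is applied to the family [flat_exp]. *)
Lemma Ck_comp_scalar (k : nat) U f (S : set (R -> R)) (h : R -> R) :
  (forall g : R -> R, S g -> (forall t, derivable g t 1) /\ S (g^`()%classic)) ->
  open U -> S h -> Ck k U f -> Ck k U (h \o f).
Proof.
move=> HS oU; elim: k h => [|k IH] h Sh sf.
all: have ch y : U y -> {for y, continuous (h \o f)}
  by move=> Uy; apply: continuous_comp; [exact: sf.1|
     apply: differentiable_continuous; apply/derivable1_diffP; have [+ _] := HS h Sh; exact].
  by [].
split=> // i; have [d1 d2] := sf.2 i.
have D y : U y -> is_derive y (d i) (h \o f) (h^`()%classic (f y) * 'D_(d i) f y).
  move=> Uy; have dh := (HS h Sh).1 (f y).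
  have Dh : is_diff (f y) h ( *:%R^~ (h^`()%classic (f y))).
    by split; [exact/derivable1_diffP|rewrite deriv1E].
  have := is_derive_comp_diff Dh (derivableP (d1 y Uy)).
  by rewrite [_ *: _]mulrC.
split; first by move=> y Uy; have [] := D y Uy.
apply: (@Ck_ext _ _ k U (fun y => (h^`()%classic \o f) y * 'D_(d i) f y)) => //.
  by move=> y Uy; have [_ ->] := D y Uy.
by apply: CkM => //; apply: IH (Ck_S sf); exact: (HS h Sh).2.
Qed.

End CkTheory.

(** By the chain rule a partial derivative of the composite is a sum of products of partial
    derivatives of [F] with partial derivatives of [G] taken at [F]; the latter are again
    composites, one order lower. *)
Lemma Ck_comp (R : realType) (m l k : nat) (U : set 'rV[R]_m) (W : set 'rV[R]_l)
    (G : 'rV[R]_m -> R) (F : 'rV[R]_l -> 'rV[R]_m) :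
  open U -> open W -> (forall y, W y -> U (F y)) ->
  Ck k U G -> (forall j, Ck k W (fun y => F y 0 j)) -> Ck k W (G \o F).
Proof.
move=> oU oW FWU; elim: k G => [|k IH] G sG sF.
  split=> // y Wy; apply: continuous_comp; last by apply: sG.1; exact: FWU.
  by apply: row_continuous => j; exact: (sF j).1.
have dF y i : W y -> is_derive y (delta_mx 0 i) F
    (\row_j 'D_(delta_mx 0 i) (fun y => F y 0 j) y).
  move=> Wy; have dd : derivable F y (delta_mx 0 i).
    by apply/derivable_mxP => a j; rewrite ord1; have [_ /(_ i)[+ _]] := sF j; exact.
  split=> //; rewrite derive_mx //; apply/rowP => j; rewrite !mxE //.
have D y i : W y -> is_derive y (delta_mx 0 i) (G \o F)
    (\sum_j 'D_(delta_mx 0 i) (fun y => F y 0 j) y * 'D_(delta_mx 0 j) G (F y)).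
  move=> Wy; have dG := Ck1_differentiable oU (FWU _ Wy) sG.
  have := is_derive_comp_diff dG (dF y i Wy).
  by under [in X in is_derive _ _ _ X]eq_bigr do rewrite mxE.
split.
  by move=> y Wy; exact: Ck_continuous (IH _ (Ck_S sG) (fun j => Ck_S (sF j))) Wy.
move=> i; split; first by move=> y Wy; have [] := D y i Wy.
apply: (@Ck_ext _ _ k W (fun y => \sum_j
  'D_(delta_mx 0 i) (fun y => F y 0 j) y * 'D_(delta_mx 0 j) G (F y))) => //.
  by move=> y Wy; have [_ ->] := D y i Wy.
apply: Ck_sum => // j; apply: CkM => //.
  by have [_ /(_ i)[]] := sF j.
apply: (IH (fun y => 'D_(delta_mx 0 j) G y)); last by move=> ?; exact: Ck_S.
by have [_ /(_ j)[]] := sG.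
Qed.

(** * The flat exponential and bump functions *)

Section FlatFunction.
Variable R : realType.

(** The polynomial factor makes the family closed under derivation, so that smoothness reduces to
    one statement on first derivatives. *)
Definition flat_exp (p : {poly R}) (t : R) : R :=
  if 0 < t then p.[t^-1] * expR (- t^-1) else 0.

(** With u = 1/t, the estimate exp(u) >= u^(i+1) / (i+1)! gives u^i exp(-u) <= (i+1)! t for each
    monomial of [p]. *)
Lemma flat_exp_bound (p : {poly R}) : exists C : R, forall t, 0 < t ->
  `|p.[t^-1] * expR (- t^-1)| <= C * t.
Proof.
exists (\sum_(i < size p) `|p`_i| * i.+1`!%:R) => t t0.
have u0 : 0 < t^-1 by rewrite invr_gt0.
rewrite horner_coef mulr_suml mulr_suml; apply: le_trans (ler_norm_sum _ _ _) _.
apply: ler_sum => i _; rewrite -!mulrA normrM; apply: ler_wpM2l => //.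
rewrite ger0_norm; last by rewrite mulr_ge0 ?exprn_ge0 ?expR_ge0 ?(ltW u0).
rewrite expRN ler_pdivrMr ?expR_gt0//.
have f0 : (i.+1`!%:R : R) != 0 by rewrite pnatr_eq0 -lt0n fact_gt0.
have -> : t^-1 ^+ i = i.+1`!%:R * t * (t^-1 ^+ i.+1 / i.+1`!%:R).
  by rewrite exprS; field; rewrite f0 gt_eqF.
apply: ler_wpM2l; first by rewrite mulr_ge0 ?ler0n ?(ltW t0).
by apply: le_trans (expR_ge1Dxn i (ltW u0)); rewrite lerDr.
Qed.

Lemma is_derive_flat_exp (p : {poly R}) (t : R) :
  is_derive t 1 (flat_exp p) (flat_exp ('X^2 * (p - p^`())) t).
Proof.
have [t0|t0|->] := ltgtP t 0.
- apply: (@near_eq_is_derive _ _ _ (fun=> 0 : R^o)).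
    near=> s; rewrite /flat_exp lt_gtF//; near: s; exact: lt_nbhsl.
  by rewrite /flat_exp lt_gtF//; exact: is_derive_cst.
- apply: (@near_eq_is_derive _ _ _ (fun s : R => p.[s^-1] * expR (- s^-1) : R^o)).
    near=> s; rewrite /flat_exp ifT//; near: s; exact: lt_nbhsr.
  have tN0 : t != 0 by rewrite gt_eqF.
  have dV : is_derive t (1:R) (fun s : R => s^-1) (- t^-2).
    by have := is_deriveV tN0 (is_derive_id t (1:R)); rewrite [_ *: _]mulr1.
  have dp : is_derive t (1:R) (horner p \o (fun s : R => s^-1)) (p^`().[t^-1] * - t^-2).
    exact: is_derive1_comp.
  have de : is_derive t (1:R) (expR \o (fun s : R => - s^-1)) (expR (- t^-1) * t^-2).
    by apply: is_derive1_comp; rewrite -[t^-2]opprK; exact: is_deriveN.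
  apply: (@is_derive_eq _ _ _ _ _ _ _ _ (is_deriveM dp de)).
  rewrite /flat_exp t0 /= !hornerE ![_ *: _]mulrC exprVn; ring.
- rewrite [flat_exp (_ * _) _]/flat_exp ltxx.
  (* Applied to ['X * p], the bound controls the difference quotient at 0, whose extra factor 1/s is
     absorbed by the polynomial. *)
  have [C HC] := flat_exp_bound ('X * p).
  have C0 : 0 <= C by have := le_trans (normr_ge0 _) (HC 1 ltr01); rewrite mulr1.
  have {}HC s : `|flat_exp p s / s| <= C * `|s|.
    rewrite /flat_exp; case: ifPn => s0; last by rewrite mul0r normr0 mulr_ge0.
    rewrite (gtr0_norm s0); have := HC s s0.
    by rewrite hornerM hornerX -mulrA [s^-1 * _]mulrC.
  (* Since [0^-1] is 0, this slope function takes at 0 the value 0, which is the expected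
     derivative. *)
  apply/is_derive1_caratheodory; exists (fun s => flat_exp p s / s); split.
  - move=> s; rewrite subr0 {2}/flat_exp ltxx subr0.
    have [->|s0] := eqVneq s 0; first by rewrite mulr0 /flat_exp ltxx.
    by rewrite mulfVK.
  - apply/cvgrPdist_le => e e0; rewrite invr0 mulr0.
    have C1 : 0 < C + 1 by rewrite ltr_wpDl.
    have eC : 0 < (C + 1)^-1 * e by rewrite mulr_gt0// invr_gt0.
    have : \forall s \near (0 : R), `|s| <= (C + 1)^-1 * e.
      apply/nbhs_ballP; exists ((C + 1)^-1 * e) => //= s.
      by rewrite -ball_normE /= sub0r normrN => /ltW.
    apply: filterS => s se; rewrite sub0r normrN; apply: le_trans (HC s) _.
    apply: (@le_trans _ _ ((C + 1) * `|s|)); first by rewrite ler_wpM2r// lerDl.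
    by rewrite -ler_pdivlMl.
  - by rewrite invr0 mulr0.
Unshelve. all: end_near. Qed.

Lemma derive_flat_exp (p : {poly R}) :
  (flat_exp p)^`()%classic = flat_exp ('X^2 * (p - p^`())).
Proof. by apply/funext => t; rewrite derive1E; have [_ ->] := is_derive_flat_exp p t. Qed.

Lemma Ck_flat_exp m k (U : set 'rV[R]_m) f (p : {poly R}) : open U ->
  Ck k U f -> Ck k U (fun y => flat_exp p (f y)).
Proof.
move=> oU; apply: (@Ck_comp_scalar _ _ _ _ _ (range flat_exp) (flat_exp p)) => //.
  move=> _ [q _ <-]; split=> [t|]; first by have [] := is_derive_flat_exp q t.
  by rewrite derive_flat_exp; eexists.
Qed.

(* Division-free: the inner argument 1 - e * flat_exp 1 (1 - t) is 1 for t >= 1 and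
   nonpositive for t <= 0. *)
Definition smooth_step (t : R) : R :=
  flat_exp 1 (1 - expR 1 * flat_exp 1 (1 - t)) * expR 1.

Lemma smooth_step1 t : 1 <= t -> smooth_step t = 1.
Proof.
move=> t1; rewrite /smooth_step {2}/flat_exp ltNge subr_le0 t1 /= mulr0 subr0.
by rewrite /flat_exp ltr01 invr1 hornerC mul1r -expRD addNr expR0.
Qed.

Lemma smooth_step0 t : t <= 0 -> smooth_step t = 0.
Proof.
move=> t0; rewrite /smooth_step {1}/flat_exp ifF ?mul0r//.
have t1 : 0 < 1 - t by rewrite subr_gt0 (le_lt_trans t0).
apply/negbTE; rewrite -leNgt subr_le0 /flat_exp t1 hornerC mul1r -expRD.
have : expR 0 <= expR (1 - (1 - t)^-1).
  by rewrite ler_expR subr_ge0 invf_le1// lerBrDr gerDl.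
by rewrite expR0.
Qed.

Lemma Ck_smooth_step m k (U : set 'rV[R]_m) f : open U -> Ck k U f ->
  Ck k U (fun y => smooth_step (f y)).
Proof.
move=> oU sf.
have affine g a b : Ck k U g -> Ck k U (fun y => a - b * g y).
  move=> sg; rewrite (_ : (fun y => _) = (fun y => a + (- b) * g y)); last first.
    by apply/funext => y; rewrite mulNr.
  by apply: CkD => //; [|apply: CkM => //]; exact: Ck_cst.
apply: CkM => //; last exact: Ck_cst.
apply: Ck_flat_exp => //; apply: (affine); apply: Ck_flat_exp => //.
rewrite (_ : (fun y => _) = (fun y => 1 - 1 * f y)); first exact: affine.
by apply/funext => y; rewrite mul1r.
Qed.

Section Bump.
Variables (m : nat) (p : 'rV[R]_m) (r : R).

(** Squares of coordinates replace the norm, which is a maximum and not smooth. The argument of a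
    factor is at least 1 while its coordinate stays within r, and negative once that coordinate
    exceeds 2r. *)
Definition smooth_bump (y : 'rV[R]_m) : R :=
  \prod_(j < m) smooth_step (2 - ((y - p) 0 j / r) ^+ 2).

Lemma Ck_smooth_bump k : Ck k setT smooth_bump.
Proof.
apply: Ck_prod => [|j]; first exact: openT.
apply: Ck_smooth_step; first exact: openT.
have oT : open [set: 'rV[R]_m] by exact: openT.
rewrite (_ : (fun y => _) = (fun y : 'rV[R]_m => 2 + (y 0 j * r^-1 + - (p 0 j / r)) *
    ((- 1) * (y 0 j * r^-1 + - (p 0 j / r))))); last first.
  by apply/funext => y; rewrite !mxE; ring.
have lin : Ck k setT (fun y : 'rV[R]_m => y 0 j * r^-1 + - (p 0 j / r)).
  by apply: CkD => //; [apply: CkM => //; [exact: Ck_coord|]|]; exact: Ck_cst.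
by apply: CkD => //; [|apply: CkM => //; apply: CkM => //]; exact: Ck_cst.
Qed.

Hypothesis r0 : 0 < r.

Lemma smooth_bump1 y : `|y - p| <= r -> smooth_bump y = 1.
Proof.
move=> yp; rewrite /smooth_bump big1// => j _; apply: smooth_step1.
rewrite lerBrDr -lerBrDl (_ : 2 - 1 = 1 :> R); last by ring.
rewrite -real_normK ?num_real// exprn_ile1// normf_div (gtr0_norm r0).
by rewrite ler_pdivrMr// mul1r; apply: le_trans yp; exact: coord_norm_le.
Qed.

Lemma smooth_bump0 y : 2 * r < `|y - p| -> smooth_bump y = 0.
Proof.
move=> yp; apply/eqP; rewrite prodf_seq_eq0; apply: contraLR yp => H.
rewrite -leNgt; apply: row_norm_le => [|j]; first by rewrite mulr_ge0// ltW.
rewrite leNgt; apply: contra H => jr; apply/hasP; exists j; first exact: mem_index_enum.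
apply/eqP/smooth_step0; rewrite subr_le0 -real_normK ?num_real//.
have : 2 <= `|(y - p) 0 j / r| by rewrite normf_div (gtr0_norm r0) ler_pdivlMr// ltW.
move=> H2; rewrite expr2; apply: le_trans (ler_pM _ _ H2 H2); rewrite ?ler_nat//.
by rewrite -natrM ler_nat.
Qed.

End Bump.

End FlatFunction.

(** * Integrals over the unit interval depending on a parameter *)

Lemma pair_continuous (T U V : topologicalType) (f : T -> U) (g : T -> V) (x : T) :
  {for x, continuous f} -> {for x, continuous g} ->
  {for x, continuous (fun z => (f z, g z))}.
Proof. by move=> cf cg; exact: (cvg_pair cf cg). Qed.

Section UnitIntegral.
Variable R : realType.
Local Notation mu := (@lebesgue_measure R).
Local Notation I := (`[0, 1]%classic : set R).

Definition unit_int (f : R -> R) : R := \int[mu]_(s in I) f s.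

Lemma unit_int_integrable (f : R -> R) : continuous f -> mu.-integrable I (EFin \o f).
Proof.
move=> cf; apply: continuous_compact_integrable; first exact: segment_compact.
exact: continuous_subspaceT.
Qed.

Lemma unit_int_norm_le (f : R -> R) (C : R) : continuous f ->
  (forall s, I s -> `|f s| <= C) -> `|unit_int f| <= C.
Proof.
move=> cf fC; apply: le_trans (le_normr_Rintegral _ (unit_int_integrable cf)) _ => //.
have -> : C = \int[mu]_(s in I) cst C s.
  have mu1 : mu I = 1%E by rewrite lebesgue_measure_itv /= lte_fin ltr01 oppr0 adde0.
  rewrite [RHS]Rintegral_cst//.
  by rewrite (congr1 fine mu1 : fine _ = 1) mulr1.
apply: le_Rintegral => //; apply: unit_int_integrable; last exact: cst_continuous.
by move=> x; apply: continuous_comp; [exact: cf|exact: norm_continuous].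
Qed.

(** Joint continuity gives the estimate near each s; compactness of the unit interval makes it
    uniform in s, and the integral of the difference is then bounded by e. *)
Lemma unit_int_continuous (T : topologicalType) (K : T -> R -> R) (z : T) :
  (forall z s, {for (z, s), continuous (fun q : T * R => K q.1 q.2)}) ->
  {for z, continuous (fun z => unit_int (K z))}.
Proof.
move=> cK; apply/cvgrPdist_le => e e0.
have cKz y : continuous (K y).
  move=> s; rewrite -[K y]/((fun q : T * R => K q.1 q.2) \o (fun s => (y, s))).
  apply: continuous_comp; last exact: cK.
  by apply: pair_continuous; [exact: cvg_cst|exact: cvg_id].
have local s : I s -> \forall s' \near s & y \near z, `|K z s' - K y s'| <= e.
  move=> _.
  have e2 : 0 < e / 2 by rewrite divr_gt0.
  have /cvgrPdist_le/(_ _ e2)[[A B] /= [As Bz] AB] := cK z s.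
  exists (B, A) => //= -[t y] /= [Bt Ay].
  have H1 := AB (y, t) (conj Ay Bt).
  have H2 := AB (z, t) (conj (nbhs_singleton As) Bt).
  rewrite /= in H1 H2.
  rewrite (_ : _ - _ = (K z s - K y t) - (K z s - K z t)); last by ring.
  by rewrite (splitr e); apply: le_trans (ler_normB _ _) _; exact: lerD.
have := (compact_near_coveringP _).1 (@segment_compact R 0 1) T (nbhs z)
  (fun y s => `|K z s - K y s| <= e) _ local.
move=> /(_ _)/filterS; apply => y Hy.
rewrite /unit_int -(RintegralB _ (unit_int_integrable (cKz z)) (unit_int_integrable (cKz y)))//.
apply: (@unit_int_norm_le (fun s => K z s - K y s)) => [|s /Hy//].
by move=> s; apply: continuousB; exact: cKz.
Qed.

Lemma is_derive_unit_int (f df : R -> R -> R) (t0 : R) :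
  (forall t s : R, is_derive t (1 : R) (f^~ s) (df t s)) -> (forall t, continuous (f t)) ->
  (forall t s, {for (t, s), continuous (fun q : R * R => df q.1 q.2)}) ->
  is_derive t0 (1 : R) (fun t => unit_int (f t)) (unit_int (df t0)).
Proof.
move=> Df cf cdf.
have mI : measurable (I : set (measurableTypeR R)) by exact: measurable_itv.
(* The partial derivative is bounded on a compact rectangle, and the bound serves as a constant
   dominating function. *)
have : compact ((fun q : R * R => df q.1 q.2) @` (`[t0 - 1, t0 + 1] `*` `[0, 1])).
  apply: continuous_compact; last by apply: compact_setX; exact: segment_compact.
  by apply: continuous_subspaceT => -[t s]; exact: cdf.
move=> /compact_bounded/pinfty_ex_gt0[B B0 HB].
have DE t s : partial1of2 f t s = df t s.
  by rewrite partial1of2E; have [_ ->] := Df t s.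
have Bdf x y : `]t0 - 1, t0 + 1[%classic x -> I y -> `|partial1of2 f x y| <= B.
  rewrite DE => /= Hx Iy; apply: HB; exists (x, y) => //; split => //=.
  by move: Hx; rewrite !in_itv /= => /andP[/ltW-> /ltW->].
have It0 : `]t0 - 1, t0 + 1[%classic t0 by rewrite /= in_itv /= ltrBlDr ltrDl ltr01.
have int_f x : `]t0 - 1, t0 + 1[%classic x -> mu.-integrable I (EFin \o f x).
  by move=> _; exact: unit_int_integrable.
have der x y : `]t0 - 1, t0 + 1[%classic x -> I y -> derivable (f^~ y) x 1.
  by move=> _ _; have [] := Df x y.
have intB : mu.-integrable I (EFin \o cst B).
  by apply: unit_int_integrable; exact: cst_continuous.
split; first exact: (derivable_under_integral mI It0 int_f der (fun=> ltW B0) intB Bdf).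
rewrite -derive1E (differentiation_under_integral mI It0 int_f der (fun=> ltW B0) intB Bdf).
by apply: eq_Rintegral => s _; exact: DE.
Qed.

Lemma unit_int_FTC (F f : R -> R) : (forall t : R, is_derive t (1 : R) F (f t)) ->
  continuous f -> unit_int f = F 1 - F 0.
Proof.
move=> dF cf; rewrite /unit_int /Rintegral (@continuous_FTC2 _ f F) //.
- exact: continuous_subspaceT.
- have cF x : {for x, continuous F}.
    by apply/differentiable_continuous/derivable1_diffP; have [] := dF x.
  split; first by move=> t _; have [] := dF t.
    exact/cvg_at_right_filter/cF.
  exact/cvg_at_left_filter/cF.
- by move=> t _; rewrite derive1E; have [_ ->] := dF t.
Qed.

End UnitIntegral.

Section UnitIntegralLinear.
Variable R : realType.
Local Notation mu := (@lebesgue_measure R).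

Lemma unit_int_cst (c : R) : unit_int (fun=> c) = c.
Proof.
have mu1 : mu `[0, 1] = 1%E by rewrite lebesgue_measure_itv /= lte_fin ltr01 oppr0 adde0.
by rewrite /unit_int Rintegral_cst// (congr1 fine mu1 : fine _ = 1) mulr1.
Qed.

Lemma unit_int_sum n (c : 'I_n -> R) (f : 'I_n -> R -> R) :
  (forall k, continuous (f k)) ->
  unit_int (fun s => \sum_k c k * f k s) = \sum_k c k * unit_int (f k).
Proof.
move=> cf; elim: n c f cf => [|n IH] c f cf.
  rewrite big_ord0 -[RHS](unit_int_cst 0); congr unit_int.
  by apply/funext => s; rewrite big_ord0.
have mI : measurable (`[0, 1]%classic : set (measurableTypeR R)) by exact: measurable_itv.
have cs : continuous (fun s => \sum_k c (lift ord0 k) * f (lift ord0 k) s).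
  by move=> s; apply: (@cvg_sumr _ _ _ (nbhs s)) => k; apply: cvgM; [exact: cvg_cst|exact: cf].
have c0 : continuous (fun s => c ord0 * f ord0 s).
  by move=> s; apply: cvgM; [exact: cvg_cst|exact: cf].
rewrite big_ord_recl -IH => [|k]; last exact: cf.
rewrite -(RintegralZl _ mI (unit_int_integrable (cf ord0))).
rewrite -(RintegralD mI (unit_int_integrable c0) (unit_int_integrable cs)).
by apply: eq_Rintegral => s _; rewrite big_ord_recl.
Qed.

End UnitIntegralLinear.

Lemma is_derive_of_line (R : realType) (V W : normedModType R) (f : V -> W)
    (x v : V) (df : W) :
  is_derive (0 : R) (1 : R) (fun t => f (t *: v + x)) df -> is_derive x v f df.
Proof.
move=> [d1 d2]; split; first exact/derivable1P.
rewrite -d2 /derive; set g1 := fun h => h^-1 *: _; set g2 := fun h => h^-1 *: _.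
suff -> : g1 = g2 by []; apply/funext => t; rewrite /g1 /g2 /=.
by rewrite addr0 scale0r add0r [t *: 1]mulr1.
Qed.

(** * Hadamard's lemma *)

Section Hadamard.
Variables (R : realType) (m : nat) (p : 'rV[R]_m).
Implicit Types (G : 'rV[R]_m -> R) (z : 'rV[R]_m).
Local Notation d k := (delta_mx 0 k : 'rV[R]_m).

(* The weight [s ^+ w] makes this family stable under partial derivatives,
   d_i (ray_int w G) = ray_int w.+1 (d_i G), hence smooth without any symmetry of
   second derivatives. *)
Definition ray_int (w : nat) G z : R :=
  unit_int (fun s => s ^+ w * G (p + s *: (z - p))).

Lemma ray_integrand_continuous w G z (s : R) : continuous G ->
  {for (z, s), continuous (fun q : 'rV[R]_m * R => q.2 ^+ w * G (p + q.2 *: (q.1 - p)))}.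
Proof.
move=> cG; have cs : (fun q : 'rV[R]_m * R => q.2) x @[x --> (z, s)] --> s by exact: cvg_snd.
apply: cvgM.
  by apply: (continuous_comp (g := fun t : R => t ^+ w)); [exact: cs|exact: exprn_continuous].
apply: continuous_comp; last exact: cG.
apply: cvgD; first exact: cvg_cst.
apply: cvgZ => //; apply: cvgB; last exact: cvg_cst.
exact: cvg_fst.
Qed.

Lemma ray_int_continuous w G : continuous G -> continuous (ray_int w G).
Proof.
move=> cG z; apply: unit_int_continuous => z' s.
exact: ray_integrand_continuous.
Qed.

Lemma is_derive_ray_int w G z i : continuous G ->
  (forall y, derivable G y (d i)) -> continuous (fun y => 'D_(d i) G y) ->
  is_derive z (d i) (ray_int w G) (ray_int w.+1 (fun y => 'D_(d i) G y) z).
Proof.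
move=> cG dG cdG; apply: is_derive_of_line.
pose f (t s : R) := s ^+ w * G (p + s *: (t *: d i + z - p)).
pose df (t s : R) := s ^+ w.+1 * 'D_(d i) G (p + s *: (t *: d i + z - p)).
have cline (t s : R) : {for (t, s), continuous (fun q : R * R => (q.1 *: d i + z, q.2))}.
  apply: pair_continuous; last exact: cvg_snd.
  by apply: cvgD; [apply: cvgZ; [exact: cvg_fst|exact: cvg_cst]|exact: cvg_cst].
have := @is_derive_unit_int R f df 0; rewrite /df scale0r add0r; apply.
- move=> t s; rewrite /f /df exprSr -mulrA.
  apply: is_deriveZ; rewrite mulrC.
  have := is_derive_line (dG (p + s *: (z - p) + (s * t) *: d i)).
  have ds : is_derive t (1 : R) (fun t => s * t) s.
    by have := is_deriveZ s (is_derive_id t (1 : R)); rewrite [s *: 1]mulr1.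
  have E u : p + s *: (z - p) + (s * u) *: d i = p + s *: (u *: d i + z - p).
    by rewrite -[u *: _ + z - p]addrA [s *: (u *: _ + _)]scalerDr scalerA -addrA [X in p + X]addrC.
  move=> /is_derive1_comp/(_ ds); rewrite E; congr is_derive.
  by apply/funext => u /=; rewrite E.
- move=> t s.
  apply: (continuous_comp (f := fun u => (t *: d i + z, u))
     (g := fun q : 'rV[R]_m * R => q.2 ^+ w * G (p + q.2 *: (q.1 - p)))).
    by apply: pair_continuous; [exact: cvg_cst|exact: cvg_id].
  exact: ray_integrand_continuous.
- move=> t s; apply: (continuous_comp (f := fun q : R * R => (q.1 *: d i + z, q.2))
     (g := fun q : 'rV[R]_m * R => q.2 ^+ w.+1 * 'D_(d i) G (p + q.2 *: (q.1 - p)))) => //.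
  by have := @ray_integrand_continuous w.+1 _ (t *: d i + z) s cdG.
Qed.

Lemma Ck_ray_int k w G : Ck k setT G -> Ck k setT (ray_int w G).
Proof.
elim: k w G => [|k IH] w G sG.
  by split=> // y _; apply: ray_int_continuous => z; exact: (Ck_continuous sG).
have cG : continuous G by move=> y; exact: (Ck_continuous sG).
split; first by move=> y _; exact: ray_int_continuous.
move=> i; have [d1 d2] := sG.2 i.
have D z : is_derive z (d i) (ray_int w G) (ray_int w.+1 (fun y => 'D_(d i) G y) z).
  apply: is_derive_ray_int => // y; first exact: d1.
  exact: (Ck_continuous d2).
split; first by move=> z _; have [] := D z.
by under eq_fun do rewrite (@derive_val _ _ _ _ _ _ _ (D _)); exact: IH.
Qed.

Lemma ray_int_center G : ray_int 0 G p = G p.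
Proof.
rewrite -[RHS]unit_int_cst; congr unit_int; apply/funext => s.
by rewrite subrr scaler0 addr0 expr0 mul1r.
Qed.

Lemma hadamard G z : Ck 1 setT G ->
  G z = G p + \sum_k (z - p) 0 k * ray_int 0 (fun y => 'D_(d k) G y) z.
Proof.
move=> sG; have cdG k : continuous (fun y => 'D_(d k) G y).
  by move=> y; have [_ sk] := sG.2 k; exact: (sk.1 y).
have dG y : is_diff y G (fun v => \sum_k v 0 k * 'D_(d k) G y).
  exact: (@Ck1_differentiable _ _ 0 setT G y openT Logic.I sG).
have DE y : 'D_(z - p) G y = \sum_k (z - p) 0 k * 'D_(d k) G y.
  by have [df dE] := dG y; rewrite deriveE // dE.
have cray k : continuous (fun s : R => s ^+ 0 * 'D_(d k) G (p + s *: (z - p))).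
  move=> s; have := @ray_integrand_continuous 0 _ z s (cdG k).
  apply: (continuous_comp (f := fun u => (z, u))).
  by apply: pair_continuous; [exact: cvg_cst|exact: cvg_id].
rewrite -unit_int_sum // (_ : (fun s => _) = fun s => 'D_(z - p) G (p + s *: (z - p))).
  have HF (t : R) : is_derive t (1 : R) (fun t => G (p + t *: (z - p)))
      ('D_(z - p) G (p + t *: (z - p))).
    by apply: is_derive_line; apply: diff_derivable; have [] := dG (p + t *: (z - p)).
  have cF : continuous (fun s : R => 'D_(z - p) G (p + s *: (z - p))).
    rewrite (_ : (fun s => _) = fun s => \sum_k (z - p) 0 k *
      (s ^+ 0 * 'D_(d k) G (p + s *: (z - p)))); last first.
      by apply/funext => s; rewrite DE; apply: eq_bigr => k _; rewrite expr0 mul1r.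
    by move=> s; apply: (@cvg_sumr _ _ _ (nbhs s)) => k; apply: cvgM; [exact: cvg_cst|exact: cray].
  by rewrite (unit_int_FTC HF cF) scale1r scale0r addr0 [p + _]addrC subrK [RHS]addrC subrK.
by apply/funext => s; rewrite DE; apply: eq_bigr => k _; rewrite expr0 mul1r.
Qed.

End Hadamard.

(** * Cutoff functions and frames *)

Section ManifoldFunctions.
Variables (R : realType) (m : nat) (M : manifold R m).
Implicit Types (U V W O K : set M) (f g : M -> R).

Lemma msmooth_on_local U f : open U ->
  (forall x, U x -> exists V g,
     [/\ open V, V x, (forall y, V y -> f y = g y) & msmooth_on V g]) ->
  msmooth_on U f.
Proof.
move=> oU H i k; apply: Ck_eq_local => _ [x [ix Ux] <-].
have [V [g [oV Vx fg sg]]] := H x Ux.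
exists (mchart i @` (mdom i `&` V)), (g \o mchartV i); split.
- exact: open_mchart.
- by exists x.
- by move=> _ [z [iz Vz] <-] /=; rewrite mchartK // fg.
- exact: sg.
Qed.

Lemma msmooth_on_chart (i : mindex M) O (G : 'rV[R]_m -> R) : open O ->
  smooth_on (mchart i @` (mdom i `&` O)) G -> msmooth_on (mdom i `&` O) (G \o mchart i).
Proof.
move=> oO sG j k.
apply: (Ck_comp (U := mchart i @` (mdom i `&` O)) (F := fun y => mchart i (mchartV j y))).
- exact: open_mchart.
- by apply: open_mchart; apply: openI => //; exact: mdom_open.
- by move=> _ [x [jx [ix Ox]] <-]; rewrite mchartK //; exists x.
- exact: sG.
- move=> l; apply: Ck_sub (mchart_smooth j i l k).
  by move=> _ [x [jx [ix Ox]] <-]; exists x.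
Qed.

Lemma rV_closed_ball_compact (p : 'rV[R]_m) (r : R) : compact [set y | `|y - p| <= r].
Proof.
apply: bounded_closed_compact.
  exists (r + `|p|); split; first exact: num_real.
  move=> a ra y /= yr; apply: le_trans (ltW ra).
  by rewrite -{1}[y](subrK p); apply: le_trans (ler_normD _ _) _; rewrite lerD2r.
rewrite [X in closed X](_ : _ = (fun y : 'rV[R]_m => `|y - p|) @^-1` [set t | t <= r]) //.
apply: closed_comp; last exact: closed_le.
have cf : continuous (fun y : 'rV[R]_m => y - p).
  by move=> y; apply: (@cvgB _ _ _ (nbhs y)); [exact: cvg_id|exact: cvg_cst].
by move=> y _; exact: (continuous_comp (cf y) (@norm_continuous _ _ _)).
Qed.

(** The closed set K acts as the support: [O] and the open complement of K cover the manifold, so a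
    function that is smooth on [O] only becomes smooth everywhere once multiplied by [chi]. *)
Record cutoff (chi : M -> R) (V O : set M) : Prop := Cutoff {
  cutoff_smooth : msmooth chi;
  cutoff_open : open V;
  cutoff_one : forall y, V y -> chi y = 1;
  cutoff_zero : exists K, [/\ closed K, K `<=` O & forall y, ~ K y -> chi y = 0] }.

Lemma exists_cutoff O x : open O -> O x -> exists chi V, cutoff chi V O /\ V x.
Proof.
move=> oO Ox; have [i ix] := mdom_cover x; pose p := mchart i x.
have : nbhs p (mchart i @` (mdom i `&` O)).
  by apply: open_nbhs_nbhs; split; [exact: open_mchart|exists x].
(* The bump vanishes beyond distance 2r, which is less than e, so its support stays inside the chart
   image. *)
case/nbhs_ballP => e /= e0 pe; pose r := e / 4.
have r0 : 0 < r by rewrite divr_gt0.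
have inball y : `|y - p| <= 2 * r -> (mchart i @` (mdom i `&` O)) y.
  move=> yr; apply: pe; rewrite -ball_normE /= distrC; apply: le_lt_trans yr _.
  by rewrite /r; lra.
pose K := mchartV i @` [set y | `|y - p| <= 2 * r].
have KO : K `<=` mdom i `&` O.
  by move=> _ [y /inball[z [iz Oz] <-] <-]; rewrite mchartK.
have cK : closed K.
  (* [K] is a continuous image of a compact ball; it is closed because the manifold is Hausdorff. *)
  apply: compact_closed; first by case: (M) => ?.
  apply: continuous_compact; last exact: rV_closed_ball_compact.
  apply: continuous_in_subspaceT => y /set_mem /inball[z [iz _] <-].
  exact: mchartV_continuous.
pose chi z := if `[< mdom i z >] then smooth_bump p r (mchart i z) else 0.
have chi0 z : ~ K z -> chi z = 0.
  move=> nK; rewrite /chi; case: asboolP => // iz; apply: smooth_bump0 => //.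
  rewrite ltNge; apply/negP => zr; apply: nK; exists (mchart i z) => //.
  by rewrite mchartK.
have : nbhs x [set z | mdom i z /\ `|mchart i z - p| <= r].
  apply: filterI; first by apply: open_nbhs_nbhs; split=> //; exact: mdom_open.
  have /cvgrPdist_le/(_ _ r0) := mchart_continuous ix.
  by apply: filterS => z; rewrite distrC.
rewrite nbhsE => -[V [oV Vx] HV].
exists chi, V; split=> //; split=> //.
- apply: msmooth_on_local; first exact: openT.
  move=> z _; have [[iz Oz]|nz] := pselect ((mdom i `&` O) z).
    exists (mdom i `&` O), (smooth_bump p r \o mchart i); split=> //.
    + by apply: openI => //; exact: mdom_open.
    + by move=> y [iy _]; rewrite /chi asboolT.
    + apply: msmooth_on_chart => // k; apply: Ck_sub (Ck_smooth_bump p r k); exact: subsetT.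
  exists (~` K), (fun=> 0); split=> //.
  + exact: closed_openC.
  + by move=> /KO.
  + exact: msmooth_on_cst.
- by move=> y /HV[iy yr]; rewrite /chi asboolT // smooth_bump1.
- by exists K; split=> // z /KO[].
Qed.

Lemma cutoffM chi V O W g : cutoff chi V O -> open O -> open W ->
  msmooth_on (W `&` O) g -> msmooth_on W (fun y => chi y * g y).
Proof.
move=> [sc _ _ [K [cK KO K0]]] oO oW sg; apply: msmooth_on_local => // x Wx.
have [Ox|nO] := pselect (O x).
  exists (W `&` O), (fun y => chi y * g y); split=> //; first exact: openI.
  apply: msmooth_onM => //; first exact: openI.
  exact: msmooth_on_sub sc.
exists (~` K), (fun=> 0); split; [exact: closed_openC|by move=> /KO| |exact: msmooth_on_cst].
by move=> y /K0->; rewrite mul0r.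
Qed.

End ManifoldFunctions.

(** * Locality of derivations at a point *)

Section TangentLocality.
Variables (R : realType) (m : nat) (M : manifold R m).
Local Notation C := (Cinf M).
Variables (x : M) (v : tangent x).
Implicit Types f g : C.

Lemma constC1 : constC M 1 = 1 :> C.
Proof. exact: val_inj. Qed.

Lemma tangentD f g : v (f + g) = v f + v g.
Proof. by have := (tangentP v).1 1 f g; rewrite constC1 !mul1r. Qed.

Lemma tangent0 : v 0 = 0.
Proof. by apply: (@addrI _ (v 0)); rewrite -tangentD !addr0. Qed.

Lemma tangentZ a f : v (constC M a * f) = a * v f.
Proof. by have := (tangentP v).1 a f 0; rewrite !addr0 tangent0 addr0. Qed.

Lemma tangentM f g : v (f * g) = f x * v g + g x * v f.
Proof. exact: (tangentP v).2. Qed.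

Lemma tangentN f : v (- f) = - v f.
Proof. by apply/eqP; rewrite -addr_eq0 -tangentD addNr tangent0. Qed.

Lemma tangent_const a : v (constC M a) = 0.
Proof.
have := tangentM (constC M 1) (constC M 1).
rewrite constC1 mul1r /= mul1r => e1.
have v1 : v 1 = 0 by apply: (@addrI _ (v 1)); rewrite addr0 -e1.
by rewrite -[constC M a]mulr1 tangentZ v1 mulr0.
Qed.

Lemma tangent_sum I (r : seq I) (F : I -> C) : v (\sum_(i <- r) F i) = \sum_(i <- r) v (F i).
Proof.
elim: r => [|i r IH]; first by rewrite !big_nil tangent0.
by rewrite !big_cons tangentD IH.
Qed.

(** With [chi] equal to 1 at [x] and supported in [V], the product chi (f - g) is the zero function;
    the Leibniz rule at [x], where f - g vanishes, turns this into v (f - g) = 0. *)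
Lemma tangent_local (V : set M) f g : open V -> V x ->
  (forall y, V y -> f y = g y) -> v f = v g.
Proof.
move=> oV Vx fg; have [chi [W [[sc _ c1 [K [_ KV K0]]] Wx]]] := exists_cutoff oV Vx.
apply/eqP; rewrite -subr_eq0 -tangentN -tangentD; apply/eqP.
have : mkCinf sc * (f - g) = 0.
  apply: val_inj; apply/funext => y; change (chi y * (f y - g y) = 0).
  have [/KV/fg fgy|/K0->] := pselect (K y); last by rewrite mul0r.
  by rewrite fgy subrr mulr0.
move/(congr1 v); rewrite tangentM tangent0.
have -> : (f - g) x = 0 by change (f x - g x = 0); rewrite fg // subrr.
by rewrite mul0r addr0 (c1 x Wx : mkCinf sc x = 1) mul1r.
Qed.

End TangentLocality.

Section LinearForms.
Variables (K : comPzRingType) (V : lmodType K) (a : dual V).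

Lemma dualP (c : K) u v : a (c *: u + v) = c * a u + a v.
Proof. by case: a => f H; have := asboolW H; apply. Qed.

Lemma dual0 : a 0 = 0.
Proof. by apply: (@addrI _ (a 0)); have := dualP 1 0 0; rewrite scale1r mul1r !addr0. Qed.

Lemma dualZ (c : K) u : a (c *: u) = c * a u.
Proof. by have := dualP c u 0; rewrite !addr0 dual0 addr0. Qed.

Lemma dualD u v : a (u + v) = a u + a v.
Proof. by have := dualP 1 u v; rewrite scale1r mul1r. Qed.

Lemma dual_sum I (r : seq I) (F : I -> V) : a (\sum_(i <- r) F i) = \sum_(i <- r) a (F i).
Proof.
elim: r => [|i r IH]; first by rewrite !big_nil dual0.
by rewrite !big_cons dualD IH.
Qed.

End LinearForms.

Lemma dual_sumE (K : comPzRingType) (V : lmodType K) I (r : seq I) (F : I -> dual V) v :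
  (\sum_(i <- r) F i : dual V) v = \sum_(i <- r) F i v.
Proof. by elim: r => [|i r IH]; rewrite ?big_nil// !big_cons -IH. Qed.

Lemma tangent_sumE (R : realType) (m : nat) (M : manifold R m) (x : M) I (r : seq I)
    (F : I -> tangent x) f :
  (\sum_(i <- r) F i : tangent x) f = \sum_(i <- r) F i f.
Proof. by elim: r => [|i r IH]; rewrite ?big_nil// !big_cons -IH. Qed.

Lemma Cinf_sumE (R : realType) (m : nat) (M : manifold R m) I (r : seq I)
    (F : I -> Cinf M) x :
  (\sum_(i <- r) F i : Cinf M) x = \sum_(i <- r) F i x.
Proof. by elim: r => [|i r IH]; rewrite ?big_nil// !big_cons -IH. Qed.

Lemma nbhs_open (T : topologicalType) (x : T) (P : set T) : nbhs x P ->
  exists V, [/\ open V, V x & V `<=` P].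
Proof. by rewrite nbhsE => -[V [? ?] ?]; exists V. Qed.

Section Frames.
Variables (R : realType) (m : nat) (M : manifold R m).
Local Notation C := (Cinf M).

(** All these sections are global, so that they can serve as arguments and coefficients elsewhere;
    only the duality relations are restricted to [U]. Carrying the dual family along avoids
    inverting matrices. *)
Definition local_frame (E : bundle M) n (b : 'I_n -> sec E)
    (c : 'I_n -> sec (dual_bundle E)) (U : set M) : Prop :=
  forall y, U y -> (forall i j, c i y (b j y) = (i == j)%:R) /\
                   (forall v : E y, v = \sum_i c i y v *: b i y).

Definition framed (E : bundle M) n : Prop := forall x : M, exists b c U,
  [/\ open U, U x & @local_frame E n b c U].

Lemma framed_vector_bundle n (A : vector_bundle M n) : framed A n.
Proof.
move=> x; have [i ix] := vdom_cover A x.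
have [chi [V [cV Vx]]] := exists_cutoff (vdom_open i) ix.
have VO y : V y -> vdom i y.
  move=> Vy; have [_ _ c1 [K [_ KO K0]]] := cV.
  apply: KO; apply: contrapT => /K0 /eqP; rewrite c1 //.
  by rewrite oner_eq0.
have sb k : smooth_vsection (fun y => chi y *: vtrivV i y (delta_mx 0 k)).
  move=> j l; rewrite (_ : (fun y => _) =
    fun y => chi y * vtriv j y (vtrivV i y (delta_mx 0 k)) 0 l); last first.
    by apply/funext => y; rewrite linearZ mxE.
  apply: (cutoffM cV); [exact: vdom_open|exact: vdom_open|].
  by rewrite setIC; exact: vtriv_smooth.
pose c_fun k y (v : A y) : R^o := chi y * vtriv i y v 0 k.
have c_proof k y : @c_fun k y \in dual_pred (V := A y).
  by apply/asboolP => a u v; rewrite /c_fun linearP !mxE; ring.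
have sc k : @smooth_dual _ _ _ A (fun y => MkDual (c_proof k y)).
  move=> X; apply: (cutoffM cV); [exact: vdom_open|exact: openT|].
  by rewrite setTI; exact: (secP X i k).
exists (fun k => @Sec _ _ _ A _ (sb k)), (fun k => @Sec _ _ _ (dual_bundle A) _ (sc k)), V.
split=> //; first exact: cutoff_open cV.
move=> y Vy; have chi1 := cutoff_one cV Vy; have iy := VO y Vy.
split=> [k l|v] /=.
  rewrite /c_fun chi1 scale1r mul1r (vtrivVK iy) mxE eqxx /=.
  by rewrite eq_sym.
apply: (can_inj (vtrivK iy)); rewrite linear_sum; apply/rowP => k.
rewrite summxE (bigD1 k) //= big1 ?addr0 => [|l lk].
  by rewrite /c_fun chi1 mul1r scale1r linearZ /= (vtrivVK iy) !mxE !eqxx mulr1.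
rewrite /c_fun chi1 scale1r linearZ /= (vtrivVK iy) !mxE eqxx /=.
by rewrite eq_sym (negbTE lk) mulr0.
Qed.

Lemma smooth_on_derive (U : set 'rV[R]_m) f k : smooth_on U f ->
  smooth_on U (fun y => 'D_(delta_mx 0 k) f y).
Proof. by move=> sf j; have [_ /(_ k)[]] := sf j.+1. Qed.

(** Hadamard's lemma integrates along whole rays and is therefore stated for functions on all of
    R^m; this supplies such a function with a prescribed germ. *)
Lemma smooth_extension (U : set 'rV[R]_m) (g : 'rV[R]_m -> R) p : open U -> U p ->
  smooth_on U g -> exists2 G, smooth_on setT G & \forall z \near p, G z = g z.
Proof.
move=> oU Up sg; have : nbhs p U by exact: open_nbhs_nbhs.
case/nbhs_ballP => e /= e0 pe; pose r := e / 4.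
have r0 : 0 < r by rewrite divr_gt0.
have oW : open (~` [set y : 'rV[R]_m | `|y - p| <= 2 * r]).
  apply: closed_openC; apply: compact_closed; last exact: rV_closed_ball_compact.
  exact: norm_hausdorff.
exists (fun z => smooth_bump p r z * g z).
  move=> k; apply: Ck_eq_local => z _; have [Uz|nUz] := pselect (U z).
    exists U, (fun z => smooth_bump p r z * g z); split=> //.
    by apply: CkM => //; apply: Ck_sub (Ck_smooth_bump p r k); exact: subsetT.
  exists (~` [set y | `|y - p| <= 2 * r]), (fun=> 0); split=> //.
  - move=> /= zr; apply: nUz; apply: pe; rewrite -ball_normE /= distrC.
    by apply: le_lt_trans zr _; rewrite /r; lra.
  - move=> y /= /negP; rewrite -ltNge => yr; rewrite smooth_bump0 ?mul0r //.
  - exact: Ck_cst.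
apply/nbhs_ballP; exists r => //= z; rewrite -ball_normE /= distrC => /ltW zr.
by rewrite smooth_bump1 // mul1r.
Qed.

(** The frame consists of cut-off coordinate derivations, and its dual of the evaluations [v (X k)]
    at the cut-off coordinate functions. Duality is a computation of partial derivatives; spanning
    is where Hadamard's lemma enters. *)
Lemma framed_tangent_bundle : framed (tangent_bundle M) m.
Proof.
move=> x; have [i ix] := mdom_cover x.
have [chi [V [cV Vx]]] := exists_cutoff (mdom_open i) ix.
have chiE y : mdom i y \/ chi y = 0.
  have [_ _ c1 [K [_ KO K0]]] := cV.
  by have [/KO|/K0] := pselect (K y); [left|right].
have VO y : V y -> mdom i y.
  by move=> Vy; case: (chiE y) => // /eqP; rewrite (cutoff_one cV Vy) oner_eq0.
pose Om := mchart i @` (mdom i `&` setT).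
have oOm : open Om by apply: open_mchart; exact: openT.
have chartO y : mdom i y -> Om (mchart i y) by move=> iy; exists y.
have s_chart (G : 'rV[R]_m -> R) : smooth_on Om G ->
    msmooth (fun y => chi y * G (mchart i y)).
  move=> sG; apply: (cutoffM cV); [exact: mdom_open|exact: openT|].
  have := msmooth_on_chart (i := i) openT sG.
  by rewrite setTI setIT.
have s_coord k : msmooth (fun y => chi y * mchart i y 0 k).
  apply: (s_chart (fun y => y 0 k)) => j; exact: Ck_coord.
pose X k := mkCinf (s_coord k).
have sV (f : C) : smooth_on Om (f \o mchartV i) by exact: (CinfP f i).
have derV (f : C) y k : mdom i y -> derivable (f \o mchartV i) (mchart i y) (delta_mx 0 k).
  by move=> iy; have [_ /(_ k)[+ _]] := sV f 1%N; apply; exact: chartO.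
pose d_fun k y (f : C) : R^o := chi y * 'D_(delta_mx 0 k) (f \o mchartV i) (mchart i y).
have d_proof k y : @d_fun k y \in derivation_pred y.
  apply/asboolP; rewrite /d_fun; have [iy|->] := chiE y; last first.
    by split=> *; rewrite !mul0r ?mulr0 ?addr0.
  split=> [a f g|f g].
    have -> : (constC M a * f + g : C) \o mchartV i =
        ((fun=> a) * (f \o mchartV i)) + (g \o mchartV i) by [].
    rewrite deriveD; [|apply: derivableM; [exact: derivable_cst|]|]; try exact: derV.
    rewrite deriveM; [|exact: derivable_cst|exact: derV].
    by rewrite derive_cst scaler0 addr0 mulrDr [_ *: _]/(_ * _) mulrCA.
  have -> : (f * g : C) \o mchartV i = (f \o mchartV i) * (g \o mchartV i) by [].
  rewrite deriveM; [|exact: derV|exact: derV].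
  rewrite /= mchartK // /GRing.scale /=; ring.
have sd k : @smooth_field _ _ M (fun y => MkTangent (d_proof k y)).
  by move=> f; exact: (s_chart _ (smooth_on_derive k (sV f))).
have c_proof k y : (fun v : tangent y => v (X k) : R^o) \in dual_pred (V := tangent y).
  by apply/asboolP.
have sc k : @smooth_dual _ _ _ (tangent_bundle M) (fun y => MkDual (c_proof k y)).
  by move=> W; exact: (secP W (X k)).
exists (fun k => @Sec _ _ _ (tangent_bundle M) _ (sd k)).
exists (fun k => @Sec _ _ _ (dual_bundle (tangent_bundle M)) _ (sc k)), V.
split=> //; first exact: cutoff_open cV.
move=> y Vy; have iy := VO y Vy; have chi1 := cutoff_one cV Vy.
have near_chart (N : set M) : nbhs y N -> \forall z \near mchart i y, N (mchartV i z) /\ Om z.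
  move=> Ny; apply: filterI; last by apply: open_nbhs_nbhs; split=> //; exact: chartO.
  by apply: mchartV_continuous => //; rewrite mchartK.
have nV : nbhs y V by apply: open_nbhs_nbhs; split=> //; exact: cutoff_open cV.
split=> [k l|v] /=.
  rewrite /d_fun chi1 mul1r; have [_ <-] := is_derive_coord (mchart i y) k l.
  apply: near_eq_derive; apply: filterS (near_chart V nV) => z [Vz [w [iw _] wz]].
  by rewrite /= (cutoff_one cV Vz) mul1r -wz mchartK.
apply: val_inj; apply/funext => f; rewrite /= tangent_sumE.
set p := mchart i y.
have [G sG Gf] := smooth_extension oOm (chartO y iy) (sV f).
pose H k := ray_int p 0 (fun z => 'D_(delta_mx 0 k) G z).
have sH k : smooth_on Om (H k).
  move=> j; apply: (@Ck_sub _ _ _ setT); first exact: subsetT.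
  by apply: Ck_ray_int; exact: (smooth_on_derive k sG).
pose HM k : C := mkCinf (s_chart _ (sH k)).
(* Hadamard's expansion of [f], with each factor cut off to become a global function. The factors
   [X k - constC M (p 0 k)] vanish at [y], so the Leibniz rule leaves only [v (X k)] times a partial
   derivative of [f]. *)
pose F : C := constC M (G p) + \sum_k (X k - constC M (p 0 k)) * HM k.
have chiXy k : X k y = p 0 k by rewrite /= chi1 mul1r.
have HMy k : HM k y = 'D_(delta_mx 0 k) (f \o mchartV i) p.
  by rewrite /= chi1 mul1r /H ray_int_center; exact: near_eq_derive.
have -> : v f = v F.
  have : \forall z \near y, f z = F z.
    have GfM : nbhs y [set z | G (mchart i z) = f (mchartV i (mchart i z))].
      exact: (mchart_continuous iy Gf).
    apply: filterS2 nV GfM => z Vz Gz; rewrite -{1}(mchartK (VO z Vz)) -[LHS]Gz.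
    have chiz := cutoff_one cV Vz.
    have -> : F z = G p + \sum_k (X k z - p 0 k) * HM k z.
      rewrite -[F z]/(G p + (\sum_k (X k - constC M (p 0 k)) * HM k : C) z).
      by rewrite Cinf_sumE.
    rewrite [LHS](hadamard p _ (sG 1%N)); congr (_ + _); apply: eq_bigr => k _.
    by rewrite !mxE /= chiz !mul1r.
  by move/nbhs_open => [W [oW Wy WfF]]; exact: tangent_local oW Wy WfF.
rewrite tangentD tangent_const add0r tangent_sum; apply: eq_bigr => k _.
rewrite tangentM HMy tangentD tangentN tangent_const oppr0 addr0.
rewrite (_ : (X k - constC M (p 0 k)) y = X k y - p 0 k) // chiXy subrr mul0r add0r.
transitivity (v (X k) * (chi y * 'D_(delta_mx 0 k) (f \o mchartV i) p)) => //.
by rewrite chi1 mul1r mulrC.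
Qed.

End Frames.

(** * Derivations of alternating forms *)

Section SlotSum.
Variables (V : Type) (W : zmodType).
Implicit Types (del : V -> V) (f g : seq V -> W).

(** The sum over positions of [is_lie_derivative], rewritten to follow the recursion of [wedge_fun].
    [del] is a bare map because the operators in use are derivations, not linear over the
    functions. *)
Fixpoint slot_sum del f (l : seq V) : W :=
  if l is v :: s then f (del v :: s) + slot_sum del (fun t => f (v :: t)) s else 0.

Lemma slot_sumE (v0 : V) del f l :
  \sum_(i < size l) f (set_nth v0 l i (del (nth v0 l i))) = slot_sum del f l.
Proof.
elim: l f => [|v l IH] f; first by rewrite big_ord0.
by rewrite big_ord_recl /= -IH.
Qed.

Lemma slot_sumD del f g l :
  slot_sum del (fun t => f t + g t) l = slot_sum del f l + slot_sum del g l.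
Proof.
elim: l f g => [|v l IH] f g /=; first by rewrite addr0.
by rewrite IH addrACA.
Qed.

Lemma slot_sumB del f g l :
  slot_sum del (fun t => f t - g t) l = slot_sum del f l - slot_sum del g l.
Proof.
elim: l f g => [|v l IH] f g /=; first by rewrite subr0.
by rewrite IH opprD addrACA.
Qed.

Lemma slot_sum0 del l : slot_sum del (fun=> 0) l = 0.
Proof. by elim: l => [|v l IH] //=; rewrite IH addr0. Qed.

Lemma slot_sum_size del f g l :
  (forall t, size t = size l -> f t = g t) -> slot_sum del f l = slot_sum del g l.
Proof.
elim: l f g => [|v l IH] f g fg //=; rewrite fg //; congr (_ + _).
by apply: IH => t tl; apply: fg; rewrite /= tl.
Qed.

End SlotSum.

Lemma slot_sum_morph (V : Type) (W W' : zmodType) (h : W -> W') (del : V -> V) f l :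
  h 0 = 0 -> (forall x y, h (x + y) = h x + h y) ->
  h (slot_sum del f l) = slot_sum del (fun t => h (f t)) l.
Proof.
move=> h0 hD; elim: l f => [|v l IH] f //=.
by rewrite hD IH.
Qed.

Lemma slot_sum_map (V V' : Type) (W : zmodType) (g : V -> V') (del : V -> V)
    (del' : V' -> V') (f : seq V' -> W) l : (forall v, g (del v) = del' (g v)) ->
  slot_sum del (fun t => f [seq g v | v <- t]) l = slot_sum del' f [seq g v | v <- l].
Proof.
move=> gd; elim: l f => [|v l IH] f //=.
by rewrite gd (IH (fun t => f (g v :: t))).
Qed.

Lemma slot_sum_exchange (V V' : Type) (W : zmodType) (del : V -> V) (eps : V' -> V')
    (F : seq V -> seq V' -> W) l l' :
  slot_sum del (fun t => slot_sum eps (F t) l') l =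
  slot_sum eps (fun t' => slot_sum del (F ^~ t') l) l'.
Proof.
elim: l F => [|v l IH] F /=; first by rewrite slot_sum0.
by rewrite IH -slot_sumD.
Qed.

Section SlotSumRing.
Variables (K : comPzRingType) (V : lmodType K).
Implicit Types (del eps : V -> V) (f g : seq V -> K).

Lemma slot_sum_scale del (c : nat -> K) f l :
  slot_sum del (fun t => c (size t) * f t) l = c (size l) * slot_sum del f l.
Proof.
elim: l c f => [|v l IH] c f /=; first by rewrite mulr0.
by rewrite (IH (fun n => c n.+1)) mulrDr.
Qed.

Lemma multilinear_head f (c : K) u v s : multilinear f ->
  f (c *: u + v :: s) = c * f (u :: s) + f (v :: s).
Proof. by move=> Hf; exact: (Hf [::]). Qed.

Lemma multilinear_head0 f s : multilinear f -> f (0 :: s) = 0.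
Proof.
move=> Hf; have := multilinear_head (-1) 0 0 s Hf.
by rewrite scaler0 addr0 mulN1r addNr.
Qed.

Lemma multilinear_headZ f (c : K) u s : multilinear f -> f (c *: u :: s) = c * f (u :: s).
Proof.
by move=> Hf; rewrite -[c *: u]addr0 multilinear_head // multilinear_head0 // addr0.
Qed.

Lemma slot_sum_combination (c : K) del eps f l : multilinear f ->
  slot_sum (fun v => c *: del v + eps v) f l = c * slot_sum del f l + slot_sum eps f l.
Proof.
elim: l f => [|v l IH] f Hf /=; first by rewrite mulr0 addr0.
by rewrite multilinear_head // IH ?mulrDr 1?addrACA //; exact: multilinear_cons.
Qed.

Lemma slot_sumN del f l : multilinear f ->
  slot_sum (fun v => - del v) f l = - slot_sum del f l.
Proof.
elim: l f => [|v l IH] f Hf /=; first by rewrite oppr0.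
by rewrite -scaleN1r multilinear_headZ // IH ?mulN1r ?opprD //; exact: multilinear_cons.
Qed.

(** Terms in which the two operators act on different slots cancel. The order is reversed on the
    right because acting on arguments is precomposition: the outer [del] reaches the argument
    first. *)
Lemma slot_sum_commutator del eps f l : multilinear f ->
  slot_sum del (slot_sum eps f) l - slot_sum eps (slot_sum del f) l =
  slot_sum (fun v => eps (del v) - del (eps v)) f l.
Proof.
elim: l f => [|v l IH] f Hf /=; first by rewrite subrr.
have -> : f (eps (del v) - del (eps v) :: l) = f (eps (del v) :: l) - f (del (eps v) :: l).
  by rewrite addrC -scaleN1r multilinear_head // mulN1r addrC.
rewrite -(IH (fun t => f (v :: t))) ?slot_sumD; last exact: multilinear_cons.
by ring.
Qed.

Section Derivation.
Variables (D : K -> K) (del : V -> V).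
Hypothesis D_add : forall x y, D (x + y) = D x + D y.
Hypothesis D_mul : forall x y, D (x * y) = x * D y + y * D x.

(** The Lie derivative of a form, when [D] differentiates functions along a vector field and [del]
    differentiates the arguments. *)
Definition lie_op f l : K := D (f l) - slot_sum del f l.

Let D0 : D 0 = 0. Proof. by apply: (@addrI _ (D 0)); rewrite -D_add !addr0. Qed.
Let DN x : D (- x) = - D x.
Proof. by apply/eqP; rewrite -addr_eq0 -D_add addNr D0. Qed.

Lemma lie_op_cons f v s :
  lie_op f (v :: s) = lie_op (fun t => f (v :: t)) s - f (del v :: s).
Proof. by rewrite /lie_op /= opprD addrA addrAC. Qed.

Lemma lie_opD f g s : lie_op (fun t => f t + g t) s = lie_op f s + lie_op g s.
Proof. by rewrite /lie_op slot_sumD D_add opprD addrACA. Qed.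

Lemma lie_op_sign f s :
  lie_op (fun t => (-1) ^+ size t * f t) s = (-1) ^+ size s * lie_op f s.
Proof.
rewrite /lie_op (slot_sum_scale del (fun n => (-1) ^+ n)) mulrBr; congr (_ - _).
by elim: (size s) => [|k IH]; rewrite ?expr0 ?mul1r // exprS -!mulrA !mulN1r DN IH.
Qed.

(** The recursion of [wedge_fun] consumes one argument at a time, and [lie_op_cons] isolates the
    term in which [del] hits that argument. The statement is about arbitrary functions of lists,
    since the intermediate functions of the recursion are no longer values of forms. *)
Lemma lie_op_wedge f g l :
  lie_op (wedge_fun f g) l = wedge_fun (lie_op f) g l + wedge_fun f (lie_op g) l.
Proof.
elim: l f g => [|v l IH] f g; first by rewrite /lie_op /= !subr0 D_mul addrC mulrC.
rewrite lie_op_cons /= lie_opD !IH.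
rewrite (_ : (fun t => lie_op f (v :: t)) =
  (fun t => 1 * lie_op (fun t => f (v :: t)) t + - f (del v :: t))); last first.
  by apply/funext => t; rewrite lie_op_cons mul1r.
rewrite (_ : (fun t => lie_op g (v :: t)) =
  (fun t => 1 * lie_op (fun t => g (v :: t)) t + - g (del v :: t))); last first.
  by apply/funext => t; rewrite lie_op_cons mul1r.
rewrite (_ : lie_op (fun t => (-1) ^+ size t * f t) =
  (fun t => (-1) ^+ size t * lie_op f t)); last first.
  by apply/funext => t; rewrite lie_op_sign.
have NR P Q s : wedge_fun P (fun t => - Q t) s = - wedge_fun P Q s.
  have := wedge_funDr (-1) P Q (fun=> 0) s; rewrite wedge_fun0r addr0 mulN1r => <-.
  by congr wedge_fun; apply/funext => t; rewrite mulN1r addr0.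
rewrite wedge_funDl wedge_funDr wedge_funNl NR !mul1r; ring.
Qed.

End Derivation.

Definition oneform_fun (a : V -> K) (l : seq V) : K := if l is [:: v] then a v else 0.
Definition scalarform_fun (c : K) (l : seq V) : K := if l is [::] then c else 0.

Lemma wedge_scalarform (c : K) g s : wedge_fun (scalarform_fun c) g s = c * g s.
Proof.
elim: s g => [|v s IH] g //=; rewrite wedge_fun0l add0r -(IH (fun t => g (v :: t))).
congr wedge_fun.
by apply/funext => -[|w t] /=; rewrite ?expr0 ?mul1r ?mulr0.
Qed.

Lemma wedge_oneform_cons a g v s :
  wedge_fun (oneform_fun a) g (v :: s) =
  a v * g s - wedge_fun (oneform_fun a) (fun t => g (v :: t)) s.
Proof.
rewrite /= -(wedge_scalarform _ g) -wedge_funNl; congr (_ + _).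
congr wedge_fun; apply/funext => -[|w [|u t]] /=; rewrite ?mulr0 ?oppr0 //.
by rewrite expr1 mulN1r.
Qed.

Lemma wedge_oneform_kernel a g s : (forall v, List.In v s -> a v = 0) ->
  wedge_fun (oneform_fun a) g s = 0.
Proof.
elim: s g => [|v s IH] g as0; first by rewrite /= mul0r.
rewrite wedge_oneform_cons as0; last by left.
by rewrite mul0r sub0r IH ?oppr0// => w ws; apply: as0; right.
Qed.

Lemma wedge_fun_degree (p q : nat) f g s :
  (forall t, size t <> p -> f t = 0) -> (forall t, size t <> q -> g t = 0) ->
  size s <> (p + q)%N -> wedge_fun f g s = 0.
Proof.
elim: s p q f g => [|v s IH] p q f g f0 g0 spq /=.
  case: p f0 spq => [f0|p f0 _]; last by rewrite f0 ?mul0r.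
  by case: q g0 => [//|q g0 _]; rewrite g0 ?mulr0.
case: p f0 spq => [f0|p f0] spq.
  rewrite (_ : (fun t => f (v :: t)) = (fun=> 0)) ?wedge_fun0l; last first.
    by apply/funext => t; rewrite f0.
  rewrite add0r; case: q g0 spq => [g0 _|q g0 spq].
    rewrite (_ : (fun t => g (v :: t)) = (fun=> 0)) ?wedge_fun0r //.
    by apply/funext => t; rewrite g0.
  apply: (IH 0%N q) => [t t0|t tq|sq]; first by rewrite f0 ?mulr0.
    by apply: g0 => /= -[].
  by apply: spq; rewrite /= sq.
rewrite (IH p q); first last.
- by move=> sq; apply: spq; rewrite /= sq.
- exact: g0.
- by move=> t tp; apply: f0 => /= -[].
rewrite add0r; case: q g0 spq => [g0 _|q g0 spq].
  rewrite (_ : (fun t => g (v :: t)) = (fun=> 0)) ?wedge_fun0r //.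
  by apply/funext => t; rewrite g0.
apply: (IH p.+1 q) => [t t0|t tq|sq]; first by rewrite f0 ?mulr0.
  by apply: g0 => /= -[].
by apply: spq; rewrite /= sq addnS.
Qed.

Lemma alternating_swap f s t v w : multilinear f -> alternating f ->
  f (s ++ v :: w :: t) = - f (s ++ w :: v :: t).
Proof.
move=> Hf Af; have Aj s' r u : f (s' ++ u :: u :: r) = 0 by exact: (Af s' [::]).
apply/eqP; rewrite -addr_eq0; apply/eqP.
have := Aj s t (v + w); have /= E1 := Hf s (v + w :: t) 1 v w.
have E2 := Hf (rcons s v) t 1 v w; have E3 := Hf (rcons s w) t 1 v w.
rewrite !scale1r !mul1r !cat_rcons in E1 E2 E3.
by rewrite E1 E2 E3 !Aj add0r addr0.
Qed.

(** Bringing [w] from a slot to the front costs exactly the sign with which the wedge product by [a]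
    extracts that slot. *)
Lemma slot_sum_rank_one a (w : V) f s : multilinear f -> alternating f ->
  slot_sum (fun v => a v *: w) f s = wedge_fun (oneform_fun a) (fun t => f (w :: t)) s.
Proof.
elim: s f => [|v s IH] f Hf Af; first by rewrite /= mul0r.
rewrite wedge_oneform_cons /= IH; last 2 first.
- exact: multilinear_cons.
- by move=> s' t r u; rewrite -cat_cons Af.
rewrite multilinear_headZ //; congr (_ + _); rewrite -[RHS]mulN1r.
have := wedge_funDr (-1) (oneform_fun a) (fun t => f (w :: v :: t)) (fun=> 0) s.
rewrite wedge_fun0r addr0 => <-; congr wedge_fun; apply/funext => t.
by rewrite addr0 mulN1r (alternating_swap [::]).
Qed.

(** * Alternating maps and finite spanning families *)

Section Spanning.
Variables (n : nat) (b : 'I_n -> V) (c : 'I_n -> V -> K).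
Hypothesis span : forall v, v = \sum_i c i v *: b i.

Lemma multilinear_sum f s t I (r : seq I) (x : I -> K) (u : I -> V) : multilinear f ->
  f (s ++ (\sum_(i <- r) x i *: u i) :: t) = \sum_(i <- r) x i * f (s ++ u i :: t).
Proof.
move=> Hf; elim: r => [|i r IH].
  rewrite !big_nil; have := Hf s t (-1) 0 0.
  by rewrite scaler0 addr0 mulN1r addNr.
by rewrite !big_cons Hf IH.
Qed.

Lemma multilinear_basis_eq0 f k : multilinear f ->
  (forall w : seq 'I_n, size w = k -> f [seq b i | i <- w] = 0) ->
  forall l, size l = k -> f l = 0.
Proof.
move=> Hf Hb; suff H l w : (size w + size l)%N = k -> f ([seq b i | i <- w] ++ l) = 0.
  by move=> l lk; exact: (H l [::]).
elim: l w => [|v l IH] w wk; first by rewrite cats0; apply: Hb; rewrite addn0 in wk.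
rewrite (span v) multilinear_sum // big1 // => i _.
have := IH (rcons w i); rewrite map_rcons cat_rcons => ->; first by rewrite mulr0.
by rewrite size_rcons -wk /= addSnnS.
Qed.

Lemma alternating_not_uniq f (w : seq 'I_n) : alternating f -> ~~ uniq w ->
  f [seq b i | i <- w] = 0.
Proof.
move=> Af nu; rewrite -[w]cat0s map_cat; move: [::] => p.
elim: w nu p => [//|i w IH] /= nu p; have [iw|iw] := boolP (i \in w).
  by case/splitPr: iw => t r; rewrite map_cat /=; exact: Af.
by rewrite -cat_rcons -map_rcons; apply: IH; rewrite iw in nu.
Qed.

Lemma alternating_degree_gt f l : multilinear f -> alternating f ->
  (n < size l)%N -> f l = 0.
Proof.
move=> Hf Af nl; apply: (multilinear_basis_eq0 Hf _ (erefl (size l))) => w wl.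
apply: alternating_not_uniq => //; apply/negP => /card_uniqP wc.
by have := max_card (mem w); rewrite wc card_ord wl leqNgt nl.
Qed.

(** Only vanishing is transported, so no sign of a permutation has to be followed; exchanges of
    blocks generate all permutations. *)
Lemma alternating_perm f (w w' : seq 'I_n) : multilinear f -> alternating f ->
  perm_eq w w' -> f [seq b i | i <- w] = 0 -> f [seq b i | i <- w'] = 0.
Proof.
move=> Hf Af; apply: (@catCA_perm_ind _ (fun w => f [seq b i | i <- w] = 0)).
move=> s1 s2 s3 {w w'}.
have move1 p u q r : f (p ++ u :: q ++ r) = 0 -> f (p ++ q ++ u :: r) = 0.
  elim: q p => [//|v q IH] p /=.
  rewrite alternating_swap // => /eqP; rewrite oppr_eq0 => /eqP H.
  by rewrite -cat_rcons; apply: IH; rewrite cat_rcons.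
suff block t1 t2 t3 p : f (p ++ t1 ++ t2 ++ t3) = 0 -> f (p ++ t2 ++ t1 ++ t3) = 0.
  by rewrite !map_cat; exact: (block _ _ _ [::]).
elim: t1 p => [//|u t1 IH] p /= H.
by apply: move1; rewrite -cat_rcons; apply: IH; rewrite cat_rcons.
Qed.

(** A list of n indices either has a repetition, where alternation gives 0, or is a permutation of
    the full enumeration. *)
Lemma alternating_top_eq0 f : multilinear f -> alternating f ->
  f [seq b i | i <- enum 'I_n] = 0 -> forall l, size l = n -> f l = 0.
Proof.
move=> Hf Af fb; apply: multilinear_basis_eq0 => // w wn.
have [uw|] := boolP (uniq w); last exact: alternating_not_uniq.
apply: (alternating_perm Hf Af _ fb); apply: uniq_perm => //; first exact: enum_uniq.
move=> i; rewrite mem_enum; apply/esym.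
have /card_uniqP wc := uw.
have e : #|w| = #|'I_n| by rewrite wc wn card_ord.
exact: (elimT (subset_cardP e) (subset_predT _) i).
Qed.

(* The form [a /\ f] vanishes for degree reasons; contracting it with [w] gives
   [a w * f = a /\ i_w f], and the right-hand side is the sum over the slots. *)
Lemma rank_one_trace a (w : V) f s : (forall (c : K) u v, a (c *: u + v) = c * a u + a v) ->
  multilinear f -> alternating f -> size s = n ->
  slot_sum (fun v => a v *: w) f s = a w * f s.
Proof.
move=> aL Hf Af sn; rewrite slot_sum_rank_one //.
apply/eqP; rewrite eq_sym -subr_eq0 -wedge_oneform_cons; apply/eqP.
have a0 : a 0 = 0.
  by have := aL (-1) 0 0; rewrite scaler0 addr0 mulN1r addNr.
have Ha : multilinear (oneform_fun a).
  move=> [|x [|y p]] [|z q] c' u v //=; rewrite ?mulr0 ?addr0 //.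
have Aa : alternating (oneform_fun a) by move=> [|x [|y p]] [|z q] r u.
apply: alternating_degree_gt; first exact: wedge_multilinear.
  exact: wedge_alternating.
by rewrite /= sn.
Qed.

End Spanning.

End SlotSumRing.

Lemma bialtP (K : comPzRingType) n p (V W : lmodType K) (q : bialt n p V W) :
  [/\ forall w, multilinear (q ^~ w) /\ alternating (q ^~ w),
      forall v, multilinear (q v) /\ alternating (q v) &
      forall v w, ~~ ((size v == n) && (size w == p)) -> q v w = 0].
Proof.
case: q => q H; have [H1 H2 H3] := asboolW H; split=> //= v w vw.
by apply/eqP; apply: contraNT vw => /H3[-> ->]; rewrite !eqxx.
Qed.

(** * Sections, dual frames and top forms *)

Section SectionCalculus.
Variables (R : realType) (m : nat) (M : manifold R m).
Local Notation C := (Cinf M).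
Implicit Types E : bundle M.

Lemma Cinf_eq (f g : C) : (forall x, f x = g x) -> f = g.
Proof. by move=> fg; apply: val_inj; apply/funext. Qed.

Lemma CinfDE (f g : C) x : (f + g) x = f x + g x. Proof. by []. Qed.
Lemma CinfME (f g : C) x : (f * g) x = f x * g x. Proof. by []. Qed.
Lemma CinfNE (f : C) x : (- f) x = - f x. Proof. by []. Qed.
Lemma Cinf0E x : (0 : C) x = 0. Proof. by []. Qed.
Lemma Cinf1E x : (1 : C) x = 1. Proof. by []. Qed.
Definition CinfE := (CinfDE, CinfME, CinfNE, Cinf0E, Cinf1E).

Lemma sec_sumE E I (r : seq I) (F : I -> sec E) x :
  (\sum_(i <- r) F i : sec E) x = \sum_(i <- r) F i x.
Proof. by elim: r => [|i r IH]; rewrite ?big_nil// !big_cons -IH. Qed.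

Lemma dual_ext (K : comPzRingType) (V : lmodType K) (a b : dual V) :
  (forall v, a v = b v) -> a = b.
Proof. by move=> ab; apply: val_inj; apply/funext. Qed.

Lemma tangent_ext (x : M) (v w : tangent x) : (forall f, v f = w f) -> v = w.
Proof. by move=> vw; apply: val_inj; apply/funext. Qed.

Lemma section_through E n x (v : E x) : framed E n -> exists X : sec E, X x = v.
Proof.
move=> /(_ x)[b [c [U [_ Ux /(_ x Ux)[_ span]]]]].
exists (\sum_i constC M (c i x v) *: b i); rewrite sec_sumE.
by rewrite [RHS]span.
Qed.

Lemma sections_through E n x (l : seq (E x)) : framed E n ->
  exists L : seq (sec E), sec_eval L x = l.
Proof.
move=> FE; elim: l => [|v l [L <-]]; first by exists [::].
by have [X <-] := section_through v FE; exists (X :: L).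
Qed.

(** The source of locality for additive operators with a Leibniz rule: applying the rule to
    [chi *: s = 0] shows that their value on [s] vanishes at [x]. *)
Lemma cutoff_section E (s : sec E) (U : set M) x : open U -> U x ->
  (forall y, U y -> s y = 0) -> exists2 chi : C, chi x = 1 & chi *: s = 0.
Proof.
move=> oU Ux s0; have [chi [W [[sc _ c1 [K [_ KU K0]]] Wx]]] := exists_cutoff oU Ux.
exists (mkCinf sc); first exact: c1.
apply: sec_eq => y; change (chi y *: s y = 0).
by have [/KU/s0->|/K0->] := pselect (K y); rewrite ?scaler0 ?scale0r.
Qed.

Lemma tensorial_functional E n (N : sec E -> C) : framed E n ->
  (forall f X Y, N (f *: X + Y) = f * N X + N Y) ->
  exists a : sec (dual_bundle E), forall X, pairing a X = N X.
Proof.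
(* Near x a section is X = sum_i c_i(X) b_i, so N X x only depends on X x. *)
move=> FE NL.
have N0 : N 0 = 0 by apply: (@addrI _ (N 0)); have := NL 1 0 0; rewrite scale1r mul1r !addr0.
have NZ f X : N (f *: X) = f * N X by have := NL f X 0; rewrite N0 !addr0.
have ND X Y : N (X + Y) = N X + N Y by have := NL 1 X Y; rewrite scale1r mul1r.
have pt x : exists a : dual (E x), forall X : sec E, a (X x) = N X x.
  have [b [c [U [oU Ux bcU]]]] := FE x.
  exists (\sum_i (N (b i) x) *: c i x) => X; rewrite dual_sumE.
  pose Y := X - \sum_i pairing (c i) X *: b i.
  have Y0 y : U y -> Y y = 0.
    move=> Uy; have [_ span] := bcU y Uy.
    change (X y + (-1) *: (\sum_i pairing (c i) X *: b i : sec E) y = 0).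
    by rewrite sec_sumE scaleN1r {1}[X y]span subrr.
  have [chi chi1 chiY] := cutoff_section oU Ux Y0.
  have NY0 : N Y x = 0.
    by have := congr1 (fun f : C => f x) (NZ chi Y); rewrite chiY N0 CinfME chi1 mul1r.
  have -> : N X = N Y + \sum_i pairing (c i) X * N (b i).
    rewrite -{1}(subrK (\sum_i pairing (c i) X *: b i) X) ND; congr (_ + _).
    by elim/big_rec2: _ => // i f Z _ <-; rewrite NL.
  by rewrite CinfDE NY0 add0r Cinf_sumE; apply: eq_bigr => i _; rewrite mulrC.
pose a x := projT1 (cid (pt x)); have aE x := projT2 (cid (pt x)).
have sa : @smooth_dual _ _ _ E a.
  by move=> X; rewrite (_ : (fun x => _) = N X); [exact: CinfP|apply/funext => x].
by exists (@Sec _ _ _ (dual_bundle E) a sa) => X; apply: Cinf_eq => x; rewrite /= aE.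
Qed.

Lemma pairing_inj E n (a b : sec (dual_bundle E)) : framed E n ->
  (forall X, pairing a X = pairing b X) -> a = b.
Proof.
move=> FE ab; apply: sec_eq => x; apply: dual_ext => v.
have [X <-] := section_through v FE.
by have := congr1 (fun f : C => f x) (ab X).
Qed.

Section Evaluation.
Variables (E : bundle M) (X : sec E).

Definition ev_fun x (a : dual (E x)) : R^o := a (X x).

Lemma ev_proof x : @ev_fun x \in dual_pred (V := dual (E x)).
Proof. by apply/asboolP. Qed.

Definition ev : sec (dual_bundle (dual_bundle E)) :=
  @Sec _ _ _ (dual_bundle (dual_bundle E)) (fun x => MkDual (ev_proof x)) (fun a => secP a X).
End Evaluation.

Lemma local_frame_dual E n (b : 'I_n -> sec E) c (U : set M) :
  local_frame b c U -> @local_frame _ _ _ (dual_bundle E) n c (fun i => ev (b i)) U.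
Proof.
move=> bcU y Uy; have [b1 b2] := bcU y Uy; split=> [i j|a].
  by rewrite /= /ev_fun b1 eq_sym.
apply: dual_ext => v; rewrite dual_sumE [in LHS](b2 v) dual_sum.
by apply: eq_bigr => i _; rewrite dualZ mulrC.
Qed.

Lemma framed_dual E n : framed E n -> framed (dual_bundle E) n.
Proof.
move=> FE x; have [b [c [U [oU Ux bcU]]]] := FE x.
exists c, (fun i => ev (b i)), U; split=> //; exact: local_frame_dual.
Qed.

Section Forms.
Variable E : bundle M.
Implicit Types (P Q : sec (alt_bundle E)) (l : seq (sec E)).

Lemma alt_eval_wedge P Q l :
  alt_eval (sec_wedge P Q) l = wedge_fun (alt_eval P) (alt_eval Q) l.
Proof.
apply: Cinf_eq => x; rewrite /=.
(* The recursive calls of [wedge_fun] involve a sign depending on the length, so the induction runs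
   over arbitrary functions of lists instead of sections of [alt_bundle]. *)
have main (p q : seq (sec E) -> C) (p' q' : seq (E x) -> R) l' :
    (forall t, p' (sec_eval t x) = p t x) -> (forall t, q' (sec_eval t x) = q t x) ->
    wedge_fun p' q' (sec_eval l' x) = wedge_fun p q l' x.
  elim: l' p q p' q' => [|X l' IH] p q p' q' Hp Hq.
    by rewrite [RHS](_ : _ = p [::] x * q [::] x) // -Hp -Hq.
  rewrite [RHS](_ : _ = wedge_fun (fun t => p (X :: t)) q l' x +
    wedge_fun (fun t => (-1) ^+ size t * p t) (fun t => q (X :: t)) l' x) //.
  congr (_ + _); apply: IH => // t; [by rewrite -Hp| |by rewrite -Hq].
  rewrite size_map Hp CinfME; congr (_ * _).
  by elim: (size t) => [|k IHk]; rewrite ?expr0 // !exprS CinfME -IHk.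
by apply: main.
Qed.

Lemma of_degree_wedge p q P Q : of_degree p P -> of_degree q Q ->
  of_degree (p + q) (sec_wedge P Q).
Proof. by move=> dP dQ x l; apply: wedge_fun_degree => t; [exact: dP|exact: dQ]. Qed.

Lemma of_degreeZ p (f : C) P : of_degree p P -> of_degree p (f *: P).
Proof.
by move=> dP x l lp; change (f x * P x l = 0); rewrite dP // mulr0.
Qed.

Section Form0.
Variable f : C.
Lemma form0_proof x : (scalarform_fun (f x) : seq (E x) -> R^o) \in alt_pred (V := E x).
Proof.
by apply/asboolP; split=> [[|? s] t a u v|[|? s] t r v] //=; rewrite mulr0 addr0.
Qed.
Fact form0_smooth : smooth_alt (fun x => MkAlt (form0_proof x)).
Proof. by move=> [|X l]; [exact: CinfP|exact: msmooth_on_cst]. Qed.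
Definition form0 : sec (alt_bundle E) := @Sec _ _ _ (alt_bundle E) _ form0_smooth.
End Form0.

Section Form1.
Variable a : sec (dual_bundle E).
Lemma form1_proof x : (oneform_fun (a x) : seq (E x) -> R^o) \in alt_pred (V := E x).
Proof.
apply/asboolP; split=> [[|? [|? s]] [|? t] c u v|[|? [|? s]] [|? t] r v] //=;
  rewrite ?mulr0 ?addr0 //; exact: dualP.
Qed.
Fact form1_smooth : smooth_alt (fun x => MkAlt (form1_proof x)).
Proof.
move=> [|X [|Y l]]; [exact: msmooth_on_cst|exact: (secP a X)|exact: msmooth_on_cst].
Qed.
Definition form1 : sec (alt_bundle E) := @Sec _ _ _ (alt_bundle E) _ form1_smooth.
End Form1.

Lemma of_degree_form0 f : of_degree 0 (form0 f).
Proof. by move=> x [|v l]. Qed.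

Lemma of_degree_form1 a : of_degree 1 (form1 a).
Proof. by move=> x [|v [|w l]]. Qed.

Lemma wedge_form0 f P : sec_wedge (form0 f) P = f *: P.
Proof.
by apply: sec_eq => x; apply: val_inj; apply/funext => l; exact: wedge_scalarform.
Qed.

Definition wedge_forms (s : seq (sec (dual_bundle E))) : sec (alt_bundle E) :=
  foldr (fun a P => sec_wedge (form1 a) P) (form0 1) s.

Lemma of_degree_wedge_forms s : of_degree (size s) (wedge_forms s).
Proof.
elim: s => [|a s IH]; first exact: of_degree_form0.
exact: (of_degree_wedge (of_degree_form1 a) IH).
Qed.

(** Expanding along the first covector, [c i] is 1 on [b i] and kills all later arguments, so a
    single term survives. *)
Lemma wedge_forms_dual (I : eqType) (b : I -> sec E) (c : I -> sec (dual_bundle E))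
    (x : M) (s : seq I) : (forall i j, c i x (b j x) = (i == j)%:R) -> uniq s ->
  wedge_forms [seq c i | i <- s] x [seq b i x | i <- s] = 1.
Proof.
move=> cb; elim: s => [|i s IH] //= /andP[nis us].
rewrite -[LHS]/(wedge_fun (oneform_fun (c i x)) (wedge_forms [seq c i | i <- s] x)
  (b i x :: [seq b j x | j <- s])).
rewrite wedge_oneform_cons cb eqxx mul1r IH // wedge_oneform_kernel ?subr0 // => v.
elim: s nis {IH us} => [//|j s IH] /=; rewrite inE negb_or => /andP[ij nis].
move=> [<-|]; last exact: IH.
by rewrite cb (negbTE ij).
Qed.

(** In degree n the difference of the two sides is alternating and vanishes on the frame, hence
    identically; in all other degrees both sides are 0. *)
Lemma top_form_local n (b : 'I_n -> sec E) c (U : set M) mu y :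
  local_frame b c U -> U y -> of_degree n mu ->
  mu y = (alt_eval mu [seq b i | i <- enum 'I_n] *:
          wedge_forms [seq c i | i <- enum 'I_n]) y.
Proof.
move=> bcU Uy dmu; have [cb span] := bcU y Uy.
set g := alt_eval mu _; set W := wedge_forms _.
have dW : of_degree n W.
  have := @of_degree_wedge_forms [seq c i | i <- enum 'I_n].
  by rewrite size_map size_enum_ord.
apply: val_inj; apply/funext => l; have [ln|ln] := eqVneq (size l) n; last first.
  have {}ln : size l <> n by apply/eqP.
  by transitivity (0 : R); [exact: dmu|exact/esym/(of_degreeZ g dW)].
apply/eqP; rewrite -subr_eq0; apply/eqP.
pose h (t : seq (E y)) : R := mu y t - g y * W y t.
have Hh : multilinear h /\ alternating h.
  have := @alt_comb _ _ (- g y) (W y) (mu y) (altmapP (W y)) (altmapP (mu y)).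
  by rewrite (_ : (fun s => _) = h) //; apply/funext => s; rewrite /h mulNr addrC.
apply: (alternating_top_eq0 span Hh.1 Hh.2) ln.
rewrite /h wedge_forms_dual // ?enum_uniq // mulr1 /= /sec_eval -map_comp.
by rewrite subrr.
Qed.

End Forms.

End SectionCalculus.

(** * Lie derivatives of covectors and of top forms *)

Section FieldAction.
Variables (R : realType) (m : nat) (M : manifold R m).
Local Notation C := (Cinf M).
Implicit Types (V W : sec (tangent_bundle M)) (f g : C).

Lemma field_actD V f g : field_act V (f + g) = field_act V f + field_act V g.
Proof. by apply: Cinf_eq => x; exact: tangentD. Qed.

Lemma field_actM V f g : field_act V (f * g) = f * field_act V g + g * field_act V f.
Proof. by apply: Cinf_eq => x; exact: tangentM. Qed.

Lemma field_act0 V : field_act V 0 = 0.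
Proof. by apply: Cinf_eq => x; exact: tangent0. Qed.

Lemma field_actN V f : field_act V (- f) = - field_act V f.
Proof. by apply: Cinf_eq => x; exact: tangentN. Qed.

Lemma field_actB V f g : field_act V (f - g) = field_act V f - field_act V g.
Proof. by rewrite field_actD field_actN. Qed.

Lemma field_act_const V c : field_act V (constC M c) = 0.
Proof. by apply: Cinf_eq => x; exact: tangent_const. Qed.

Lemma field_act_comb V W f g : field_act (f *: V + W) g = f * field_act V g + field_act W g.
Proof. exact: Cinf_eq. Qed.

Lemma field_ext V W : (forall f, field_act V f = field_act W f) -> V = W.
Proof.
move=> VW; apply: sec_eq => x; apply: tangent_ext => f.
by have := congr1 (fun h : C => h x) (VW f).
Qed.

Lemma field_act_bracket V W f :
  field_act (field_bracket V W) f = field_act V (field_act W f) - field_act W (field_act V f).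
Proof. exact: Cinf_eq. Qed.

Lemma field_bracket_leibniz V f W Z : field_bracket V (f *: W + Z) =
  f *: field_bracket V W + field_act V f *: W + field_bracket V Z.
Proof.
apply: field_ext => g; rewrite -[field_act V f *: W]scale1r -addrA !scale1r.
rewrite !field_act_comb !field_act_bracket !field_act_comb field_actD field_actM.
ring.
Qed.

Lemma field_bracket_combl f V V' W : field_bracket (f *: V + V') W =
  f *: field_bracket V W + (- field_act W f *: V + field_bracket V' W).
Proof.
apply: field_ext => g.
rewrite !field_act_comb !field_act_bracket !field_act_comb field_actD field_actM.
ring.
Qed.

Lemma field_bracket_jacobi V W Z : field_bracket (field_bracket V W) Z =
  field_bracket V (field_bracket W Z) - field_bracket W (field_bracket V Z).
Proof.
apply: field_ext => g; rewrite -scaleN1r addrC field_act_comb !field_act_bracket.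
rewrite !field_actB; ring.
Qed.

(** A covector with these values exists only when [del] obeys a Leibniz rule along [V], for then the
    derivatives of the coefficient cancel in the difference; hence the choice operator with default
    0, resolved in [dual_opE]. *)
Definition dual_op (E : bundle M) (V : sec (tangent_bundle M)) (del : sec E -> sec E)
    (a : sec (dual_bundle E)) : sec (dual_bundle E) :=
  xget 0 [set b | forall X, pairing b X = field_act V (pairing a X) - pairing a (del X)].

(* For E = A and del = [X, .] this gives the Lie derivative of covectors, for E = TM and
   del = [V, .] that of differential forms. *)
Section DerivationPair.
Variables (E : bundle M) (n : nat) (FE : framed E n) (V : sec (tangent_bundle M)).
Variable del : sec E -> sec E.
Hypothesis del_leibniz : forall f X Y,
  del (f *: X + Y) = f *: del X + field_act V f *: X + del Y.

Lemma pairing_comb (a : sec (dual_bundle E)) f X Y :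
  pairing a (f *: X + Y) = f * pairing a X + pairing a Y.
Proof. by apply: Cinf_eq => x; exact: dualP. Qed.

Lemma pairing_combl (a b : sec (dual_bundle E)) f X :
  pairing (f *: a + b) X = f * pairing a X + pairing b X.
Proof. exact: Cinf_eq. Qed.

Lemma pairingZ (a : sec (dual_bundle E)) f X : pairing a (f *: X) = f * pairing a X.
Proof. by apply: Cinf_eq => x; exact: dualZ. Qed.

Lemma pairing0 (a : sec (dual_bundle E)) : pairing a 0 = 0.
Proof. by apply: Cinf_eq => x; exact: dual0. Qed.

Lemma section_ext (X Y : sec E) : (forall a, pairing a X = pairing a Y) -> X = Y.
Proof.
move=> XY; apply: sec_eq => x; have [b [c [U [_ Ux /(_ x Ux)[_ span]]]]] := FE x.
rewrite [LHS]span [RHS]span; apply: eq_bigr => i _; congr (_ *: _).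
by have := congr1 (fun f : C => f x) (XY (c i)).
Qed.

Lemma dual_opE a X :
  pairing (dual_op V del a) X = field_act V (pairing a X) - pairing a (del X).
Proof.
have [|b Hb] := @tensorial_functional _ _ _ E n
    (fun X => field_act V (pairing a X) - pairing a (del X)) FE.
  move=> f Y Z; rewrite del_leibniz -addrA !pairing_comb field_actD field_actM; ring.
by rewrite /dual_op; case: xgetP => [c _ /(_ X)//|/(_ b)[]].
Qed.

Lemma dual_op_leibniz f a b : dual_op V del (f *: a + b) =
  f *: dual_op V del a + field_act V f *: a + dual_op V del b.
Proof.
apply: (pairing_inj FE) => X; rewrite dual_opE -addrA !pairing_combl !dual_opE.
rewrite field_actD field_actM; ring.
Qed.

Local Notation lie := (lie_op (field_act V) del).

Lemma alt_eval_form0 f (l : seq (sec E)) : alt_eval (form0 E f) l = scalarform_fun f l.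
Proof. by case: l => *; exact: Cinf_eq. Qed.

Lemma alt_eval_form1 a (l : seq (sec E)) : alt_eval (form1 a) l = oneform_fun (pairing a) l.
Proof. by case: l => [|X [|Y l]]; exact: Cinf_eq. Qed.

Lemma lie_op_ext (f g : seq (sec E) -> C) l : (forall t, f t = g t) -> lie f l = lie g l.
Proof. by move=> fg; congr (lie _ l); apply/funext. Qed.

Lemma lie_op_scalarform f l : lie (scalarform_fun f) l = scalarform_fun (field_act V f) l.
Proof.
case: l => [|X l]; first by rewrite /lie_op subr0.
rewrite /lie_op (@slot_sum_size _ _ del _ (fun=> 0)) => [|[|? ?]//].
by rewrite slot_sum0 field_act0 subr0.
Qed.

Lemma lie_op_oneform a l :
  lie (oneform_fun (pairing a)) l = oneform_fun (pairing (dual_op V del a)) l.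
Proof.
case: l => [|X [|Y l]]; first by rewrite /lie_op /= field_act0 subr0.
  by rewrite /lie_op /= addr0 dual_opE.
rewrite /lie_op (@slot_sum_size _ _ del _ (fun=> 0)) => [|[|? [|? ?]]//].
by rewrite slot_sum0 field_act0 subr0.
Qed.

Lemma alt_evalD (P Q : sec (alt_bundle E)) l :
  alt_eval (P + Q) l = alt_eval P l + alt_eval Q l.
Proof. exact: Cinf_eq. Qed.

Lemma lie_op_alt_wedge P Q l : lie (alt_eval (sec_wedge P Q)) l =
  wedge_fun (lie (alt_eval P)) (alt_eval Q) l + wedge_fun (alt_eval P) (lie (alt_eval Q)) l.
Proof.
rewrite (lie_op_ext _ (alt_eval_wedge P Q)) lie_op_wedge //.
- exact: field_actD.
- exact: field_actM.
Qed.

(** A relation and not an operator: existence of [Q] is obtained only for wedge products of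
    covectors and for top forms, and the Schouten bracket has to be recognised as such a [Q]. *)
Definition has_lie (P Q : sec (alt_bundle E)) : Prop :=
  forall l, alt_eval Q l = lie (alt_eval P) l.

Lemma has_lie_wedge P P' Q Q' : has_lie P P' -> has_lie Q Q' ->
  has_lie (sec_wedge P Q) (sec_wedge P' Q + sec_wedge P Q').
Proof.
move=> HP HQ l; rewrite alt_evalD !alt_eval_wedge lie_op_alt_wedge.
by congr (_ + _); congr wedge_fun; apply/funext.
Qed.

Lemma has_lie_form0 f : has_lie (form0 E f) (form0 E (field_act V f)).
Proof.
by move=> l; rewrite alt_eval_form0 (lie_op_ext _ (alt_eval_form0 f)) lie_op_scalarform.
Qed.

Lemma has_lie_form1 a : has_lie (form1 a) (form1 (dual_op V del a)).
Proof.
by move=> l; rewrite alt_eval_form1 (lie_op_ext _ (alt_eval_form1 a)) lie_op_oneform.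
Qed.

Lemma has_lie_wedge_forms s : exists Q, has_lie (wedge_forms s) Q.
Proof.
elim: s => [|a s [Q HQ]]; eexists; first exact: has_lie_form0.
exact: has_lie_wedge (has_lie_form1 a) HQ.
Qed.

Lemma slot_sum_eval x (f : seq (sec E) -> C) l :
  slot_sum del f l x = slot_sum del (fun t => f t x) l.
Proof. exact: (slot_sum_morph (h := fun g : C => g x)). Qed.

Lemma lie_op_local (U : set M) x (f g : seq (sec E) -> C) l : open U -> U x ->
  (forall y t, U y -> f t y = g t y) -> lie f l x = lie g l x.
Proof.
move=> oU Ux fg; rewrite /lie_op !CinfE !slot_sum_eval.
congr (_ - _); last by congr slot_sum; apply/funext => t; exact: fg.
by exact: (@tangent_local _ _ _ x (V x) U (f l) (g l) oU Ux (fun y Uy => fg y l Uy)).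
Qed.

(** Near [x] the form is a function times a wedge product of frame covectors, whose Lie derivative
    exists by the Leibniz rule; its value at [x] is taken as that of [nu]. On sections these choices
    give the smooth functions of the global formula, so [nu] is smooth. *)
Lemma has_lie_top mu : of_degree n mu -> exists nu, has_lie mu nu.
Proof.
move=> dmu.
have pt x : exists q : altmap (E x), forall l, q (sec_eval l x) = lie (alt_eval mu) l x.
  have [b [c [U [oU Ux bcU]]]] := FE x.
  have [Q HQ] := has_lie_wedge_forms [seq c i | i <- enum 'I_n].
  have := has_lie_wedge (has_lie_form0 (alt_eval mu [seq b i | i <- enum 'I_n])) HQ.
  set Q' := (X in has_lie _ X) => HQ'; exists (Q' x) => l.
  rewrite -[LHS]/(alt_eval Q' l x) HQ'; refine (lie_op_local l oU Ux _) => y t Uy.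
  rewrite wedge_form0; apply/esym.
  exact: (congr1 (fun p : altmap (E y) => p (sec_eval t y)) (top_form_local bcU Uy dmu)).
pose q x := projT1 (cid (pt x)); have qE x := projT2 (cid (pt x)).
have sq : @smooth_alt _ _ _ E q.
  move=> l; rewrite (_ : (fun x => _) = lie (alt_eval mu) l); first exact: CinfP.
  exact/funext.
by exists (@Sec _ _ _ (alt_bundle E) q sq) => l; apply: Cinf_eq => x; rewrite /= qE.
Qed.

End DerivationPair.

Lemma lie_derivativeE V (mu : sec (form M)) l : of_degree m mu ->
  alt_eval (lie_derivative V mu) l =
  lie_op (field_act V) (field_bracket V) (alt_eval mu) l.
Proof.
move=> dmu; have [nu Hnu] := has_lie_top (@framed_tangent_bundle _ _ M)
  (field_bracket_leibniz V) dmu.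
have isl : is_lie_derivative V mu nu by move=> k; rewrite slot_sumE; exact: Hnu.
(* The existence of [nu] ensures that the choice obeys the formula and is not a mere default. *)
rewrite /lie_derivative; case: xgetP => [c _ /(_ l)->|/(_ nu)[]//].
by rewrite slot_sumE.
Qed.

End FieldAction.

(** * The Schouten bracket with a section of A *)

Section Algebroid.
Variables (R : realType) (m : nat) (M : manifold R m) (n : nat).
Variable A : lie_algebroid M n.
Local Notation C := (Cinf M).
Local Notation "[ X , Y ]" := (la_bracket X Y).
Implicit Types (X Y Z : sec A) (f g : C) (a : sec (dual_bundle A)).

Lemma framed_algebroid : framed A n.
Proof. exact: framed_vector_bundle. Qed.

Lemma la_bracketDl X Y Z : [X + Y, Z] = [X, Z] + [Y, Z].
Proof. by have := la_bilinear 1 X Y Z; rewrite constC1 !scale1r. Qed.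

Lemma la_bracket_leibniz X f Y Z :
  [X, f *: Y + Z] = f *: [X, Y] + field_act (rho X) f *: Y + [X, Z].
Proof. by rewrite la_skew la_bracketDl opprD -!la_skew la_leibniz. Qed.

Lemma la_bracketZl f X Y : [f *: X, Y] = f *: [X, Y] - field_act (rho Y) f *: X.
Proof. by rewrite la_skew la_leibniz opprD -scalerN -la_skew. Qed.

Lemma la_bracket_combl f X Y Z :
  [f *: X + Y, Z] = f *: [X, Z] + (- field_act (rho Z) f *: X + [Y, Z]).
Proof. by rewrite la_bracketDl la_bracketZl scaleNr addrA. Qed.

Lemma rho_comb f X Y : rho (f *: X + Y) = f *: rho X + rho Y.
Proof. by apply: sec_eq => x; rewrite /= linearP. Qed.

Lemma la_bracketNr X Y : [X, - Y] = - [X, Y].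
Proof.
rewrite -scaleN1r la_leibniz field_actN -(constC1 M) field_act_const oppr0 scale0r addr0.
by rewrite constC1 scaleN1r.
Qed.

Lemma la_jacobi_leibniz X Y Z : [[X, Y], Z] = [X, [Y, Z]] - [Y, [X, Z]].
Proof.
have := la_jacobi X Y Z; rewrite (la_skew Z [X, Y]) => /eqP; rewrite subr_eq0 => /eqP <-.
by rewrite (la_skew Z X) la_bracketNr.
Qed.

Lemma rho_bracket X Y f : field_act (rho [X, Y]) f =
  field_act (rho X) (field_act (rho Y) f) - field_act (rho Y) (field_act (rho X) f).
Proof.
(* The Jacobi identity for X, Y, f Z gives h Z = 0, so h vanishes at x unless all
   sections of A do. *)
pose h := field_act (rho X) (field_act (rho Y) f) - field_act (rho Y) (field_act (rho X) f)
  - field_act (rho [X, Y]) f.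
have hZ Z : h *: Z = 0.
  apply: (section_ext framed_algebroid) => a.
  have := congr1 (pairing a) (la_jacobi_leibniz X Y (f *: Z)).
  rewrite !la_leibniz !la_bracket_leibniz !la_leibniz -[- (_ + _)]scaleN1r.
  rewrite -[f *: [X, [Y, Z]] + _ + _]addrA -[f *: [Y, [X, Z]] + _ + _]addrA.
  rewrite [X in _ = pairing a X]addrC !(pairing_comb, pairingZ).
  rewrite la_jacobi_leibniz -[- [Y, [X, Z]]]scaleN1r [_ + -1 *: _]addrC pairing_comb.
  rewrite pairing0 /h => E; apply/eqP; rewrite -subr_eq0 subr0; apply/eqP.
  transitivity (f * (-1 * pairing a [Y, [X, Z]] + pairing a [X, [Y, Z]]) + 
    (h * pairing a Z + field_act (rho [X, Y]) f * pairing a Z)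
    - (f * (-1 * pairing a [Y, [X, Z]] + pairing a [X, [Y, Z]]) +
     field_act (rho [X, Y]) f * pairing a Z)); first by rewrite /h; ring.
  by rewrite E /h; ring.
apply: Cinf_eq => x; have [[Z Zx]|nZ] := pselect (exists Z : sec A, Z x <> 0).
  have /eqP : h x *: Z x = 0 by exact: (congr1 (fun s : sec A => s x) (hZ Z)).
  by rewrite scaler_eq0 => /orP[/eqP/subr0_eq/esym|/eqP].
(* If all sections vanish at [x], so does every anchored field there, and both sides are 0. *)
have Z0 Z : Z x = 0 by apply: contrapT => Zx; apply: nZ; exists Z.
have r0 Z g : field_act (rho Z) g x = 0 by rewrite /= Z0 linear0.
by rewrite CinfDE CinfNE !r0 subrr.
Qed.

Definition lie_dual X : sec (dual_bundle A) -> sec (dual_bundle A) :=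
  dual_op (rho X) (la_bracket X).

Lemma lie_dualE X a Y :
  pairing (lie_dual X a) Y = field_act (rho X) (pairing a Y) - pairing a [X, Y].
Proof. exact: (dual_opE framed_algebroid (la_bracket_leibniz X)). Qed.

Lemma lie_dual_leibniz X f a b : lie_dual X (f *: a + b) =
  f *: lie_dual X a + field_act (rho X) f *: a + lie_dual X b.
Proof. exact: (dual_op_leibniz framed_algebroid (la_bracket_leibniz X)). Qed.

Section AnchorDifferential.
Variable f : C.
(** The algebroid differential of [f]. It is the covector through which [lie_dual] fails to be
    linear over the functions in its vector argument. *)
Definition anchor_diff_fun x (v : A x) : R^o := la_anchor A x v f.
Lemma anchor_diff_proof x : @anchor_diff_fun x \in dual_pred (V := A x).
Proof. by apply/asboolP => c u v; rewrite /anchor_diff_fun linearP. Qed.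
Lemma anchor_diff_smooth : @smooth_dual _ _ _ A (fun x => MkDual (anchor_diff_proof x)).
Proof. by move=> X; exact: CinfP (field_act (rho X) f). Qed.
Definition anchor_diff : sec (dual_bundle A) :=
  @Sec _ _ _ (dual_bundle A) _ anchor_diff_smooth.
End AnchorDifferential.

Lemma lie_dual_combl f X Y a : lie_dual (f *: X + Y) a =
  f *: lie_dual X a + (pairing a X *: anchor_diff f + lie_dual Y a).
Proof.
apply: (pairing_inj framed_algebroid) => Z.
rewrite !pairing_combl !lie_dualE rho_comb field_act_comb la_bracket_combl !pairing_comb.
rewrite (_ : pairing (anchor_diff f) Z = field_act (rho Z) f); last exact: Cinf_eq.
ring.
Qed.

Lemma lie_dual_bracket X Y a :
  lie_dual [X, Y] a = lie_dual X (lie_dual Y a) - lie_dual Y (lie_dual X a).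
Proof.
apply: (pairing_inj framed_algebroid) => Z.
rewrite -scaleN1r addrC pairing_combl !lie_dualE la_jacobi_leibniz rho_bracket.
rewrite -[- [Y, [X, Z]]]scaleN1r [_ + -1 *: _]addrC pairing_comb !field_actB; ring.
Qed.

Lemma vectorE X : vector X = form1 (ev X).
Proof. by apply: sec_eq => x; apply: val_inj. Qed.

Lemma scalarE f : scalar A f = form0 (dual_bundle A) f.
Proof. by apply: sec_eq => x; apply: val_inj. Qed.

Section Schouten.
Variable br : sec (multivector A) -> sec (multivector A) -> sec (multivector A).
Hypothesis Hbr : is_schouten br.
Local Notation lie X := (lie_op (field_act (rho X)) (lie_dual X)).
Local Notation has_lie X := (has_lie (rho X) (lie_dual X)).

Lemma br_form0 X f : has_lie X (form0 _ f) (br (vector X) (form0 _ f)).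
Proof.
rewrite -scalarE (schouten_scalar Hbr) !scalarE.
exact: has_lie_form0.
Qed.

Lemma br_form1 X Y : has_lie X (form1 (ev Y)) (br (vector X) (form1 (ev Y))).
Proof.
rewrite -vectorE (schouten_vector Hbr) !vectorE => l.
rewrite alt_eval_form1 (lie_op_ext _ _ _ (alt_eval_form1 (ev Y))).
rewrite (lie_op_oneform (framed_dual framed_algebroid) (lie_dual_leibniz X)).
(* Dualising twice returns the bracket: the two derivatives of the pairing along [rho X] cancel. *)
congr (oneform_fun (pairing _) l); apply: (pairing_inj (framed_dual framed_algebroid)) => a.
rewrite (dual_opE (framed_dual framed_algebroid) (lie_dual_leibniz X)).
have evE Z b : pairing (ev Z) b = pairing b Z by exact: Cinf_eq.
by rewrite !evE lie_dualE opprB addrC subrK.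
Qed.

Lemma br_wedge X p q Q S : of_degree p Q -> of_degree q S ->
  has_lie X Q (br (vector X) Q) -> has_lie X S (br (vector X) S) ->
  has_lie X (sec_wedge Q S) (br (vector X) (sec_wedge Q S)).
Proof.
move=> dQ dS HQ HS.
rewrite (schouten_leibniz Hbr (p := 1) _ dQ dS); last first.
  by rewrite vectorE; exact: of_degree_form1.
(* A vector has degree 1, so the shifted exponent of the sign is the even number 2p. *)
rewrite mul2n -signr_odd odd_double expr0 scale1r.
exact: has_lie_wedge.
Qed.

Lemma br_wedge_forms X I (b : I -> sec A) (s : seq I) :
  has_lie X (wedge_forms [seq ev (b i) | i <- s])
    (br (vector X) (wedge_forms [seq ev (b i) | i <- s])).
Proof.
elim: s => [|i s IH]; first exact: br_form0.
apply: br_wedge IH; [exact: of_degree_form1|exact: of_degree_wedge_forms|exact: br_form1].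
Qed.

Lemma br_scale X p f P : of_degree p P ->
  br (vector X) (f *: P) = field_act (rho X) f *: P + f *: br (vector X) P.
Proof.
move=> dP; rewrite -(wedge_form0 f P).
rewrite (schouten_leibniz Hbr (p := 1) _ (@of_degree_form0 _ _ _ _ f) dP); last first.
  by rewrite vectorE; exact: of_degree_form1.
rewrite muln0 expr0 scale1r wedge_form0 -scalarE (schouten_scalar Hbr) scalarE.
by rewrite wedge_form0.
Qed.

(** The difference P - Q vanishes on [U], and multiplied by a cutoff it vanishes everywhere;
    [br_scale] at [x] then leaves the bracket with P - Q alone. Homogeneity is assumed because the
    Leibniz axiom is graded. *)
Lemma br_local X p P Q (U : set M) x : of_degree p P -> of_degree p Q ->
  open U -> U x -> (forall y, U y -> P y = Q y) ->
  br (vector X) P x = br (vector X) Q x.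
Proof.
move=> dP dQ oU Ux PQ.
have brD S T : br (vector X) (S + T) = br (vector X) S + br (vector X) T.
  by have := schouten_linearr Hbr 1 (vector X) S T; rewrite constC1 !scale1r.
have br0 : br (vector X) 0 = 0 by apply: (@addrI _ (br (vector X) 0)); rewrite -brD !addr0.
have Z0 y : U y -> (P - Q) y = 0.
  by move=> Uy; change (P y + (-1) *: Q y = 0); rewrite PQ // scaleN1r subrr.
have dZ : of_degree p (P - Q).
  move=> y l lp; change (P y l + (-1) * Q y l = 0).
  by rewrite dP // dQ // mulr0 addr0.
have [chi chi1 chiZ] := cutoff_section oU Ux Z0.
have E : br (vector X) (P - Q) x = 0.
  have := br_scale X chi dZ; rewrite chiZ br0 => /(congr1 (fun S : sec (multivector A) => S x)).
  rewrite [RHS](_ : _ = field_act (rho X) chi x *: (P - Q) x +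
    chi x *: br (vector X) (P - Q) x) //.
  by rewrite Z0 // scaler0 add0r chi1 scale1r.
rewrite -{1}(subrK Q P) brD.
change (br (vector X) (P - Q) x + br (vector X) Q x = br (vector X) Q x).
by rewrite E add0r.
Qed.

Lemma br_top X eta : of_degree n eta -> has_lie X eta (br (vector X) eta).
Proof.
move=> deta l; apply: Cinf_eq => x.
(* The dual frame of the dual bundle consists of the evaluations [ev (b i)], which are vectors: the
   axioms prescribe the bracket on them. *)
have [b [c [U [oU Ux /local_frame_dual bcU]]]] := framed_algebroid x.
set g := alt_eval eta [seq c i | i <- enum 'I_n].
set W := wedge_forms [seq ev (b i) | i <- enum 'I_n].
have loc y : U y -> eta y = sec_wedge (form0 _ g) W y.
  by move=> Uy; rewrite wedge_form0; have H := top_form_local bcU Uy deta; exact: H.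
have dW : of_degree n W.
  have := @of_degree_wedge_forms _ _ _ _ [seq ev (b i) | i <- enum 'I_n].
  by rewrite size_map size_enum_ord.
have dgW : of_degree n (sec_wedge (form0 _ g) W).
  exact: (of_degree_wedge (of_degree_form0 _) dW).
rewrite [LHS](_ : _ = alt_eval (br (vector X) (sec_wedge (form0 _ g) W)) l x); last first.
  by rewrite /= (br_local X deta dgW oU Ux loc).
rewrite (br_wedge (of_degree_form0 _) dW (br_form0 X g) (br_wedge_forms X b (enum 'I_n))).
refine (lie_op_local _ _ l oU Ux _) => y t Uy.
exact/esym/(congr1 (fun P : altmap (dual (A y)) => P (sec_eval t y)) (loc y Uy)).
Qed.

End Schouten.
End Algebroid.

(** * The representation on Q_A *)

Section LineBundle.
Variables (R : realType) (m : nat) (M : manifold R m) (n : nat).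
Variable A : lie_algebroid M n.
Local Notation C := (Cinf M).
Local Notation dA := (dual_bundle A).
Local Notation TM := (tangent_bundle M).
Implicit Types (X Y : sec A) (f g : C) (a : seq (sec dA)) (v : seq (sec TM)) (s t : sec (QA A)).

Let FdA : framed dA n := framed_dual (framed_algebroid A).
Let FTM : framed TM m := @framed_tangent_bundle R m M.

Definition bi_eval s a v : C := mkCinf (secP s a v).

Lemma bi_eval_multilinear_l s v : multilinear (bi_eval s ^~ v).
Proof.
move=> p q f X Y; apply: Cinf_eq => x; have [H _ _] := bialtP (s x).
have := (H (sec_eval v x)).1 (sec_eval p x) (sec_eval q x) (f x) (X x) (Y x).
by rewrite CinfDE CinfME /= /sec_eval !map_cat.
Qed.

Lemma bi_eval_multilinear_r s a : multilinear (bi_eval s a).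
Proof.
move=> p q f X Y; apply: Cinf_eq => x; have [_ H _] := bialtP (s x).
have := (H (sec_eval a x)).1 (sec_eval p x) (sec_eval q x) (f x) (X x) (Y x).
by rewrite CinfDE CinfME /= /sec_eval !map_cat.
Qed.

Lemma bi_eval_size s a v : ~~ ((size a == n) && (size v == m)) -> bi_eval s a v = 0.
Proof.
move=> av; apply: Cinf_eq => x; have [_ _ H] := bialtP (s x).
by rewrite /= H // !size_map.
Qed.

Lemma QA_fiber_ext x (p q : QA A x) :
  (forall a v, p (sec_eval a x) (sec_eval v x) = q (sec_eval a x) (sec_eval v x)) -> p = q.
Proof.
move=> pq; apply: val_inj; apply/funext => l; apply/funext => r.
have [a <-] := @sections_through _ _ _ dA n x l FdA.
have [v <-] := @sections_through _ _ _ TM m x r FTM.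
exact: pq.
Qed.

Lemma QA_ext s t : (forall a v, bi_eval s a v = bi_eval t a v) -> s = t.
Proof.
move=> st; apply: sec_eq => x; apply: QA_fiber_ext => a v.
by have := congr1 (fun f : C => f x) (st a v).
Qed.

Lemma bi_eval_comb f s t a v : bi_eval (f *: s + t) a v = f * bi_eval s a v + bi_eval t a v.
Proof. exact: Cinf_eq. Qed.

Lemma tensE (eta : sec (multivector A)) (mu : sec (form M)) x l r : tens eta mu x l r =
  if (size l == n) && (size r == m) then eta x l * mu x r else 0.
Proof. by []. Qed.

(** The coefficient of [s] in the frames is absorbed into [eta]. Equality is tested with
    [alternating_top_eq0] twice, in the covectors with the vectors fixed and then in the vectors
    with the frame covectors inserted. *)
Lemma local_tensor s x : exists U (eta : sec (multivector A)) (mu : sec (form M)),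
  [/\ open U, U x, of_degree n eta, of_degree m mu &
      forall y, U y -> s y = tens eta mu y].
Proof.
have [b [c [U [oU Ux bcU]]]] := FdA x; have [e [d [W [oW Wx edW]]]] := FTM x.
pose g := bi_eval s [seq b i | i <- enum 'I_n] [seq e i | i <- enum 'I_m].
pose WA := wedge_forms [seq c i | i <- enum 'I_n].
pose WT := wedge_forms [seq d i | i <- enum 'I_m].
have dWA : of_degree n WA.
  have := @of_degree_wedge_forms _ _ _ _ [seq c i | i <- enum 'I_n].
  by rewrite size_map size_enum_ord.
have dWT : of_degree m WT.
  have := @of_degree_wedge_forms _ _ _ _ [seq d i | i <- enum 'I_m].
  by rewrite size_map size_enum_ord.
exists (U `&` W), (g *: WA), WT; split=> //; [exact: openI|exact: of_degreeZ|].
move=> y [Uy Wy]; have [cb spanA] := bcU y Uy; have [de spanT] := edW y Wy.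
have [H1 H2 H3] := bialtP (s y).
apply: val_inj; apply/funext => l; apply/funext => r.
rewrite [RHS]tensE; case: ifP => [/andP[/eqP ln /eqP rm]|/negbT /H3 //].
apply/eqP; rewrite -subr_eq0; apply/eqP.
pose h (l : seq (dual (A y))) (r : seq (tangent y)) : R := s y l r - g y * WA y l * WT y r.
have hl r' : multilinear (h ^~ r') /\ alternating (h ^~ r').
  have := @alt_comb _ _ (- (g y * WT y r')) (WA y) ((s y) ^~ r') (altmapP (WA y)) (H1 r').
  by rewrite (_ : (fun l0 => _) = h ^~ r') //; apply/funext => l'; rewrite /h; ring.
have hr l' : multilinear (h l') /\ alternating (h l').
  have := @alt_comb _ _ (- (g y * WA y l')) (WT y) (s y l') (altmapP (WT y)) (H2 l').
  by rewrite (_ : (fun l0 => _) = h l') //; apply/funext => r'; rewrite /h; ring.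
apply: (alternating_top_eq0 spanA (hl r).1 (hl r).2) ln.
apply: (alternating_top_eq0 spanT (hr _).1 (hr _).2) rm.
rewrite /h !wedge_forms_dual ?enum_uniq // !mulr1.
by rewrite /g /= /sec_eval -!map_comp subrr.
Qed.

Variable phi : sec dA.

Local Notation S1 X := (slot_sum (lie_dual X)).
Local Notation S2 X := (slot_sum (field_bracket (rho X))).

Definition weight X : C := (n%:R - 1) * pairing phi X.
(* The value of D_X s on lists of sections, as a function of the values F of s. *)
Definition D_eval X (F : seq (sec dA) -> seq (sec TM) -> C) a v : C :=
  field_act (rho X) (F a v) - S1 X (F ^~ v) a - S2 X (F a) v - weight X * F a v.

Lemma D_eval_leibniz X f F G a v :
  D_eval X (fun a v => f * F a v + G a v) a v =
  f * D_eval X F a v + field_act (rho X) f * F a v + D_eval X G a v.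
Proof.
rewrite /D_eval !slot_sumD !(slot_sum_scale _ (fun=> f)) field_actD field_actM; ring.
Qed.

(** The operator on covectors is pointwise, so [slot_sum_map] moves the sum to the fibre, where a
    finite spanning family is available for [rank_one_trace]. Off the top degree both sides are
    0. *)
Lemma slot_sum_trace_l X f s a v :
  slot_sum (fun b => pairing b X *: anchor_diff A f) (bi_eval s ^~ v) a =
  field_act (rho X) f * bi_eval s a v.
Proof.
have [an|an] := eqVneq (size a) n; last first.
  rewrite bi_eval_size ?negb_and ?an // mulr0.
  rewrite (@slot_sum_size _ _ _ _ (fun=> 0)) ?slot_sum0 // => b ba.
  by rewrite bi_eval_size // ba negb_and an.
apply: Cinf_eq => x; have [b [c [U [oU Ux /(_ x Ux)[_ span]]]]] := FdA x.
rewrite slot_sum_eval CinfME.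
have [H1 _ _] := bialtP (s x).
pose del' (al : dual (A x)) := al (X x) *: anchor_diff A f x.
rewrite [LHS](@slot_sum_map _ _ _ (fun b : sec dA => b x) _ del' ((s x) ^~ (sec_eval v x))) //.
rewrite (@rank_one_trace _ _ _ _ _ span (fun al : dual (A x) => al (X x)) (anchor_diff A f x)) //.
- exact: (H1 _).1.
- exact: (H1 _).2.
- by rewrite size_map.
Qed.

Lemma slot_sum_trace_r X f s a v :
  slot_sum (fun W => - field_act W f *: rho X) (bi_eval s a) v =
  - field_act (rho X) f * bi_eval s a v.
Proof.
have [vm|vm] := eqVneq (size v) m; last first.
  rewrite bi_eval_size ?negb_and ?vm ?orbT // mulr0.
  rewrite (@slot_sum_size _ _ _ _ (fun=> 0)) ?slot_sum0 // => b bv.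
  by rewrite bi_eval_size // bv negb_and vm orbT.
apply: Cinf_eq => x; have [b [c [U [oU Ux /(_ x Ux)[_ span]]]]] := FTM x.
rewrite slot_sum_eval CinfME.
have [_ H2 _] := bialtP (s x).
pose del' (w : tangent x) := - w f *: rho X x.
rewrite [LHS](@slot_sum_map _ _ _ (fun W : sec TM => W x) _ del' (s x (sec_eval a x))) //.
rewrite (@rank_one_trace _ _ _ _ _ span (fun w : tangent x => - w f) (rho X x)) //.
- by move=> k u w; rewrite mulrN -opprD.
- exact: (H2 _).1.
- exact: (H2 _).2.
- by rewrite size_map.
Qed.

(* The derivatives of f enter through two traces of opposite signs, one over covectors
   and one over tangent vectors. *)
Lemma D_eval_comb f X Y s a v : D_eval (f *: X + Y) (bi_eval s) a v =
  f * D_eval X (bi_eval s) a v + D_eval Y (bi_eval s) a v.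
Proof.
have E1 : S1 (f *: X + Y) (bi_eval s ^~ v) a = f * S1 X (bi_eval s ^~ v) a +
    (field_act (rho X) f * bi_eval s a v + S1 Y (bi_eval s ^~ v) a).
  rewrite -slot_sum_trace_l -[X in _ + (X + _)]mul1r.
  rewrite -!slot_sum_combination; try exact: bi_eval_multilinear_l.
  congr slot_sum; apply/funext => b; rewrite lie_dual_combl scale1r //.
have E2 : S2 (f *: X + Y) (bi_eval s a) v = f * S2 X (bi_eval s a) v +
    (- field_act (rho X) f * bi_eval s a v + S2 Y (bi_eval s a) v).
  rewrite -slot_sum_trace_r -[X in _ + (X + _)]mul1r.
  rewrite -!slot_sum_combination; try exact: bi_eval_multilinear_r.
  congr slot_sum; apply/funext => W; rewrite rho_comb field_bracket_combl scale1r //.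
rewrite /D_eval E1 E2 rho_comb field_act_comb /weight pairing_comb; ring.
Qed.

Lemma field_act_nat V k : field_act V (k%:R : C) = 0.
Proof.
elim: k => [|k IH]; first exact: field_act0.
by rewrite -natr1 field_actD IH add0r -(constC1 M) field_act_const.
Qed.

(** Terms symmetric in [X] and [Y] cancel; for those acting on one covector slot and one vector slot
    the symmetry is [slot_sum_exchange]. There remain the commutators within each family of slots,
    the bracket of anchored fields on the value, and the derivatives of the weights, which the
    cocycle condition turns into the weight of the bracket. *)
Lemma D_eval_bracket X Y s a v : is_cocycle phi ->
  D_eval X (D_eval Y (bi_eval s)) a v - D_eval Y (D_eval X (bi_eval s)) a v =
  D_eval (la_bracket X Y) (bi_eval s) a v.
Proof.
move=> cphi; set F := bi_eval s.
have Fl : multilinear (F ^~ v) by exact: bi_eval_multilinear_l.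
have Fr : multilinear (F a) by exact: bi_eval_multilinear_r.
have expand X' Y' : D_eval X' (D_eval Y' F) a v =
  field_act (rho X') (field_act (rho Y') (F a v))
  - S1 Y' (fun b => field_act (rho X') (F b v)) a
  - S2 Y' (fun w => field_act (rho X') (F a w)) v
  - (weight Y' * field_act (rho X') (F a v) + F a v * field_act (rho X') (weight Y'))
  - (S1 X' (fun b => field_act (rho Y') (F b v)) a - S1 X' (S1 Y' (F ^~ v)) a
     - S1 X' (fun b => S2 Y' (F b) v) a - weight Y' * S1 X' (F ^~ v) a)
  - (S2 X' (fun w => field_act (rho Y') (F a w)) v - S2 X' (fun w => S1 Y' (F ^~ w) a) v
     - S2 X' (S2 Y' (F a)) v - weight Y' * S2 X' (F a) v)
  - weight X' * D_eval Y' F a v.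
  rewrite [LHS](_ : _ = field_act (rho X') (D_eval Y' F a v) - S1 X' (D_eval Y' F ^~ v) a
    - S2 X' (D_eval Y' F a) v - weight X' * D_eval Y' F a v) //.
  have -> : S1 X' (D_eval Y' F ^~ v) a =
      S1 X' (fun b => field_act (rho Y') (F b v)) a - S1 X' (S1 Y' (F ^~ v)) a
     - S1 X' (fun b => S2 Y' (F b) v) a - weight Y' * S1 X' (F ^~ v) a.
    by rewrite /D_eval !slot_sumB (slot_sum_scale _ (fun=> weight Y')).
  have -> : S2 X' (D_eval Y' F a) v =
      S2 X' (fun w => field_act (rho Y') (F a w)) v - S2 X' (fun w => S1 Y' (F ^~ w) a) v
     - S2 X' (S2 Y' (F a)) v - weight Y' * S2 X' (F a) v.
    by rewrite /D_eval !slot_sumB (slot_sum_scale _ (fun=> weight Y')).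
  do 3 congr (_ - _); rewrite /D_eval !field_actB field_actM.
  by rewrite !(slot_sum_morph _ _ _ (field_act0 (rho X')) (field_actD (rho X'))).
have C1 := slot_sum_commutator (lie_dual X) (lie_dual Y) a Fl.
have C2 := slot_sum_commutator (field_bracket (rho X)) (field_bracket (rho Y)) v Fr.
have E1 : S1 (la_bracket X Y) (F ^~ v) a =
    S1 Y (S1 X (F ^~ v)) a - S1 X (S1 Y (F ^~ v)) a.
  rewrite -[RHS]opprB C1 -slot_sumN //; congr slot_sum; apply/funext => b.
  by rewrite lie_dual_bracket opprB.
have E2 : S2 (la_bracket X Y) (F a) v = S2 Y (S2 X (F a)) v - S2 X (S2 Y (F a)) v.
  rewrite -[RHS]opprB C2 -slot_sumN //; congr slot_sum; apply/funext => W.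
  rewrite opprB -field_bracket_jacobi; congr field_bracket.
  by apply: field_ext => f; rewrite rho_bracket field_act_bracket.
have X1 := slot_sum_exchange (lie_dual X) (field_bracket (rho Y)) F a v.
have X2 := slot_sum_exchange (lie_dual Y) (field_bracket (rho X)) F a v.
have W1 : weight (la_bracket X Y) =
    field_act (rho X) (weight Y) - field_act (rho Y) (weight X).
  have n0 V : field_act V (n%:R - 1 : C) = 0.
    by rewrite field_actB field_act_nat -(constC1 M) field_act_const subrr.
  rewrite /weight !field_actM !n0 !mulr0 !addr0 -mulrBr; congr (_ * _).
  by apply/esym/subr0_eq; exact: cphi.
rewrite [RHS]/D_eval E1 E2 W1 rho_bracket !expand X1 X2 /D_eval; ring.
Qed.

End LineBundle.

(** * The operator D: values, existence, representation property *)

Section Connection.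
Variables (R : realType) (m : nat) (M : manifold R m) (n : nat).
Variable A : lie_algebroid M n.
Variable phi : sec (dual_bundle A).
Variable br : sec (multivector A) -> sec (multivector A) -> sec (multivector A).
Hypothesis Hbr : is_schouten br.
Local Notation C := (Cinf M).
Local Notation dA := (dual_bundle A).
Local Notation TM := (tangent_bundle M).
Implicit Types (X Y : sec A) (f g : C) (a : seq (sec dA)) (v : seq (sec TM)) (s t : sec (QA A)).
Implicit Types (eta : sec (multivector A)) (mu : sec (form M)).

(** For p = 1 the first correction has coefficient 0, and the second contracts the vector with [phi]
    to a function, with sign +1 inside the subtracted term. *)
Lemma schouten_jacobi_vector X eta :
  schouten_jacobi br phi 1 n (vector X) eta = br (vector X) eta - weight phi X *: eta.
Proof.
rewrite /schouten_jacobi subrr scale0r addr0 -signr_odd expr0 mul1r.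
have -> : sec_insertion phi (vector X) = form0 _ (pairing phi X).
  by apply: sec_eq => x; apply: val_inj; apply/funext => -[|? ?].
by rewrite wedge_form0 scalerA.
Qed.

(** The Leibniz rule splits the derivative of the product of values: one half joins the covector
    slots into the bracket ([br_top]), the other joins the vector slots into the Lie derivative
    ([lie_derivativeE]). The slot sums only see values of [s] at [x], while the derivative needs the
    product form on the whole of [U]. *)
Lemma Dphi_formula U X s eta mu x a v : open U -> U x ->
  of_degree n eta -> of_degree m mu -> (forall y, U y -> s y = tens eta mu y) ->
  (tens (schouten_jacobi br phi 1 n (vector X) eta) mu +
   tens eta (lie_derivative (rho X) mu) : sec (QA A)) x (sec_eval a x) (sec_eval v x) =
  D_eval phi X (bi_eval s) a v x.
Proof.
move=> oU Ux deta dmu sE.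
rewrite [LHS](_ : _ =
   tens (schouten_jacobi br phi 1 n (vector X) eta) mu x (sec_eval a x) (sec_eval v x) +
   tens eta (lie_derivative (rho X) mu) x (sec_eval a x) (sec_eval v x)) //.
rewrite !tensE !size_map; case: ifPn => [/andP[/eqP an /eqP vm]|av]; last first.
  (* For lists of the wrong lengths every term vanishes, since [slot_sum] evaluates on lists of
     unchanged length. *)
  rewrite addr0 /D_eval !CinfE bi_eval_size // field_act0 !slot_sum_eval mulr0 !subr0.
  rewrite (@slot_sum_size _ _ (lie_dual X) _ (fun=> 0)) => [|b ba]; last first.
    by rewrite bi_eval_size // ba.
  rewrite (@slot_sum_size _ _ (field_bracket (rho X)) _ (fun=> 0)) => [|b bv]; last first.
    by rewrite bi_eval_size // bv.
  by rewrite !slot_sum0 !subr0.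
have sE' y b w : U y -> size b = n -> size w = m ->
    bi_eval s b w y = alt_eval eta b y * alt_eval mu w y.
  move=> Uy bn wm; rewrite [LHS](_ : _ = s y (sec_eval b y) (sec_eval w y)) //.
  by rewrite sE // tensE !size_map bn wm !eqxx.
rewrite schouten_jacobi_vector.
rewrite [X in X * _](_ : _ = alt_eval (br (vector X) eta) a x -
    weight phi X x * alt_eval eta a x) //; last first.
  by rewrite [LHS](_ : _ = alt_eval (br (vector X) eta) a x + 
    (-1) * (weight phi X x * alt_eval eta a x)) // mulN1r.
rewrite (br_top Hbr X deta) [X in _ + _ * X](_ : _ = alt_eval (lie_derivative (rho X) mu) v x) //.
rewrite (lie_derivativeE _ _ dmu) /lie_op /D_eval !CinfE !slot_sum_eval.
have -> : field_act (rho X) (bi_eval s a v) x =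
    field_act (rho X) (alt_eval eta a * alt_eval mu v) x.
  apply: (@tangent_local _ _ _ x (rho X x) U _ _ oU Ux) => y Uy.
  by rewrite sE'.
rewrite field_actM !CinfE sE' //.
rewrite (@slot_sum_size _ _ (lie_dual X) (fun b => bi_eval s b v x)
  (fun b => alt_eval eta b x * alt_eval mu v x)) => [|b ba]; last first.
  by rewrite sE' // ba.
rewrite (@slot_sum_size _ _ (field_bracket (rho X)) (bi_eval s a ^~ x)
  (fun w => alt_eval eta a x * alt_eval mu w x)) => [|w wv]; last first.
  by rewrite sE' // wv.
rewrite -(@slot_sum_morph _ _ _ (fun r : R => r * alt_eval mu v x)) ?mul0r //; last first.
  by move=> ? ?; rewrite mulrDl.
rewrite -(@slot_sum_morph _ _ _ (fun r : R => alt_eval eta a x * r)) ?mulr0 //; last first.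
  by move=> ? ?; rewrite mulrDr.
rewrite /=; ring.
Qed.

Lemma Dphi_eval D X s a v : is_Dphi br phi D ->
  bi_eval (D X s) a v = D_eval phi X (bi_eval s) a v.
Proof.
move=> HD; apply: Cinf_eq => x.
have [U [eta [mu [oU Ux deta dmu sE]]]] := local_tensor s x.
rewrite -(Dphi_formula X a v oU Ux deta dmu sE).
by rewrite -(Dphi_tens HD X oU deta dmu sE Ux).
Qed.

(** As for the Lie derivative of a top form: local tensors supply the fibre elements, and the
    right-hand side, already a smooth function, supplies smoothness. *)
Lemma D_eval_section X s : exists t, forall a v, bi_eval t a v = D_eval phi X (bi_eval s) a v.
Proof.
have pt x : exists q : QA A x, forall a v,
    (q : bialt n m (dual (A x)) (tangent x)) (sec_eval a x) (sec_eval v x) =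
    D_eval phi X (bi_eval s) a v x.
  have [U [eta [mu [oU Ux deta dmu sE]]]] := local_tensor s x.
  eexists => a v; exact: (Dphi_formula X a v oU Ux deta dmu sE).
pose q x := projT1 (cid (pt x)); have qE x := projT2 (cid (pt x)).
have sq : @smooth_bialt _ _ _ _ A q.
  move=> a v; rewrite (_ : (fun x => _) = D_eval phi X (bi_eval s) a v).
    exact: CinfP.
  by apply/funext => x; exact: qE.
by exists (@Sec _ _ _ (QA A) q sq) => a v; apply: Cinf_eq => x; exact: qE.
Qed.

Lemma exists_Dphi : exists D, is_Dphi br phi D.
Proof.
pose D X s := projT1 (cid (D_eval_section X s)).
have DE X s := projT2 (cid (D_eval_section X s)).
exists D; split=> [c X Y s|c X s t|U X s eta mu oU deta dmu sE x Ux].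
- by apply: QA_ext => a v; rewrite bi_eval_comb !DE D_eval_comb.
- apply: QA_ext => a v; rewrite bi_eval_comb !DE.
  rewrite (_ : bi_eval (constC M c *: s + t) =
    fun a v => constC M c * bi_eval s a v + bi_eval t a v) //.
    by rewrite D_eval_leibniz field_act_const mul0r addr0.
  by apply/funext => b; apply/funext => w; rewrite bi_eval_comb.
- apply: QA_fiber_ext => a v; rewrite (Dphi_formula X a v oU Ux deta dmu sE).
  by rewrite -DE.
Qed.

Lemma Dphi_representation D : is_cocycle phi -> is_Dphi br phi D -> is_representation D.
Proof.
move=> cphi HD; have DE X s a v := Dphi_eval X s a v HD.
have DE' X s : bi_eval (D X s) = D_eval phi X (bi_eval s).
  by apply/funext => a; apply/funext => v.
(* [is_Dphi] asks for linearity over constants; linearity over functions is read off the formula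
   that determines D. *)
have Dscale f X s : D (f *: X) s = f *: D X s.
  have D0 a v : D_eval phi 0 (bi_eval s) a v = 0.
    apply: (@addrI _ (D_eval phi 0 (bi_eval s) a v)).
    by have := D_eval_comb phi 1 0 0 s a v; rewrite scaler0 !addr0 mul1r => <-.
  apply: QA_ext => a v; rewrite DE -[f *: X]addr0 D_eval_comb D0 addr0 -DE.
  exact: Cinf_eq.
have DX0 X : D X 0 = 0.
  apply: (@addrI _ (D X 0)).
  by have := Dphi_linearr HD 1 X 0 0; rewrite constC1 !scale1r !addr0 => <-.
split.
- by move=> X Y s; have := Dphi_linearl HD 1 X Y s; rewrite constC1 !scale1r.
- exact: Dphi_linearr HD.
- exact: Dscale.
- move=> f X s; apply: QA_ext => a v; rewrite bi_eval_comb !DE.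
  rewrite -[f *: s]addr0 (_ : bi_eval (f *: s + 0) =
    fun a v => f * bi_eval s a v + bi_eval 0 a v); last first.
    by apply/funext => b; apply/funext => w; rewrite bi_eval_comb.
  rewrite D_eval_leibniz -!DE DX0 -addrA; congr (_ + _).
  by apply: Cinf_eq => x; rewrite CinfDE /= addr0.
- move=> X Y s; apply: QA_ext => a v.
  rewrite -scaleN1r addrC bi_eval_comb !DE !DE' mulN1r addrC.
  exact: D_eval_bracket.
Qed.

End Connection.

Theorem proposition12 (R : realType) (m : nat) (M : manifold R m) (n : nat)
    (A : lie_algebroid M n) (phi0 : sec (dual_bundle A))
    (br : sec (multivector A) -> sec (multivector A) -> sec (multivector A)) :
  is_cocycle phi0 ->
  is_schouten br ->
  (exists! D : sec A -> sec (QA A) -> sec (QA A), is_Dphi br phi0 D) /\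
  (forall D : sec A -> sec (QA A) -> sec (QA A),
     is_Dphi br phi0 D -> is_representation D).
Proof.
move=> cphi Hbr; split; last by move=> D; exact: Dphi_representation.
have [D HD] := exists_Dphi phi0 Hbr; exists D; split=> // D' HD'.
apply/funext => X; apply/funext => s; apply: QA_ext => a v.
by rewrite (Dphi_eval Hbr X s a v HD) (Dphi_eval Hbr X s a v HD').
Qed.
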